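(* For every positive integer $\ell$, there exists a connected common graph with chromatic number $\ell$.
   Context: All graphs are finite, simple and loopless. A graphon is a measurable function $W:[0,1]^2\to[0,1]$ that is symmetric, i.e. $W(x,y)=W(y,x)$ for all $x,y\in[0,1]$. For a graph $H$ with vertex set $V(H)$ and edge set $E(H)$, the homomorphism density of $H$ in a graphon $W$ is $$t(H,W)=\int_{[0,1]^{V(H)}}\prod_{uv\in E(H)}W(x_u,x_v)\,dx_{V(H)}.$$ Let $e(H)=|E(H)|$. A graph $H$ is common if $t(H,W)+t(H,1-W)\ge 2^{1-e(H)}$ for every graphon $W$. (Equivalently, the number of monochromatic copies of $H$ in a $2$-edge-coloring of a complete graph is asymptotically minimized by the random $2$-edge-coloring, where each edge receives each of the two colors with probability $1/2$.) *)

(* Defs.v *)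
From HB Require Import structures.
From mathcomp Require Import all_boot all_order all_algebra.
From mathcomp Require Import all_classical all_reals all_analysis.

Set Implicit Arguments.
Unset Strict Implicit.
Unset Printing Implicit Defensive.

Import Order.TTheory GRing.Theory Num.Theory.
Import numFieldNormedType.Exports.

Local Open Scope classical_set_scope.
Local Open Scope ring_scope.

Record sgraph := SGraph {
  vertex :> finType;
  adj : rel vertex;
  adj_sym : symmetric adj;
  adj_irrefl : irreflexive adj }.
Arguments adj {s}.

(* Each edge uv occurs exactly once, as the ordered pair of its ends in which
   the end that comes first in the enumeration of the vertices is listed
   first.  Since graphons are symmetric, the choice of order is immaterial
   in [hom_density]. *)
Definition edges (H : sgraph) : {set H * H} :=
  [set e | adj e.1 e.2 && (enum_rank e.1 < enum_rank e.2)%N].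

Definition num_edges (H : sgraph) : nat := #|edges H|.

Definition connected_graph (H : sgraph) : Prop :=
  (0 < #|H|)%N /\ forall u v : H, connect adj u v.

Definition colorable (H : sgraph) (k : nat) : bool :=
  [exists c : {ffun H -> 'I_k}, [forall u, forall v, adj u v ==> (c u != c v)]].

Lemma colorable_exists (H : sgraph) : exists k, colorable H k.
Proof.
exists #|H|; apply/existsP; exists [ffun v => enum_rank v].
apply/forallP => u; apply/forallP => v; apply/implyP => uv; rewrite !ffunE.
by apply: contraTneq uv => /enum_rank_inj ->; rewrite adj_irrefl.
Qed.

Definition chromatic_number (H : sgraph) : nat := ex_minn (colorable_exists H).

(* The library has binary product measures but no [n]-fold ones; the latter
   are built by transporting the binary product along [T * n.-tuple T] ~
   [n.+1.-tuple T].  The measurable sets of [n.-tuple T] are those of the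
   library: the sigma-algebra generated by the coordinates. *)
Section cons_measure.
Context d (T : measurableType d) (R : realType) (n : nat).
Variable m : {sigma_finite_measure set T -> \bar R}.
Variable p : {sigma_finite_measure set (n.-tuple T) -> \bar R}.
Local Open Scope ereal_scope.

Let cons_pair (x : T * n.-tuple T) : n.+1.-tuple T := [tuple of x.1 :: x.2].

Let measurable_cons_pair : measurable_fun [set: T * n.-tuple T] cons_pair.
Proof. exact: (measurable_cons measurable_fst measurable_snd). Qed.

Definition cons_measure : set (n.+1.-tuple T) -> \bar R :=
  pushforward (m \x p) cons_pair.

Let pushforward_cons : {measure set (n.+1.-tuple T) -> \bar R} :=
  measure_function_pushforward__canonical__measure_function_Measure
    (m \x p) measurable_cons_pair.

Let cons_measure0 : cons_measure set0 = 0.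
Proof. exact: (measure0 pushforward_cons). Qed.

Let cons_measure_ge0 A : 0 <= cons_measure A.
Proof. exact: (measure_ge0 pushforward_cons). Qed.

Let cons_measure_sigma_additive : semi_sigma_additive cons_measure.
Proof. exact: (@measure_semi_sigma_additive _ _ _ pushforward_cons). Qed.

HB.instance Definition _ := isMeasure.Build _ _ _ cons_measure
  cons_measure0 cons_measure_ge0 cons_measure_sigma_additive.

Let sigma_finite_cons_measure : sigma_finite [set: n.+1.-tuple T] cons_measure.
Proof.
have /sigma_finiteP[F [FT ndF Foo]] := sigma_finiteT m.
have /sigma_finiteP[G [GT ndG Goo]] := sigma_finiteT p.
pose uncons (x : n.+1.-tuple T) := (thead x, [tuple of behead x]).
have muncons : measurable_fun setT uncons.
  apply/measurable_fun_pairP; split; first exact: measurable_tnth.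
  exact: measurable_behead.
exists (fun k => uncons @^-1` (F k `*` G k)).
  rewrite -preimage_bigcup (_ : \bigcup_k _ = setT) ?preimage_setT//.
  apply/seteqP; split => // -[x t] _.
  have [i _ Fx] : (\bigcup_k F k) x by rewrite -FT.
  have [j _ Gt] : (\bigcup_k G k) t by rewrite -GT.
  exists (maxn i j) => //; split.
    by move: x Fx; exact/subsetPset/ndF/leq_maxl.
  by move: t Gt; exact/subsetPset/ndG/leq_maxr.
move=> k; have [mF Fk] := Foo k; have [mG Gk] := Goo k.
have mFG : measurable (F k `*` G k) by exact: measurableX.
split; first by rewrite -[X in measurable X]setTI; exact: muncons.
rewrite /cons_measure /pushforward -comp_preimage.
rewrite (_ : uncons \o cons_pair = id) ?preimage_id.
  by rewrite product_measure1E// lte_mul_pinfty// ge0_fin_numE.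
apply/funext => -[x t]; rewrite /uncons /cons_pair/= theadE; congr pair.
exact: val_inj.
Qed.

HB.instance Definition _ := Measure_isSigmaFinite.Build _ _ _ cons_measure
  sigma_finite_cons_measure.

End cons_measure.

Fixpoint tuple_measure d (T : measurableType d) (R : realType)
    (m : {sigma_finite_measure set T -> \bar R}) (n : nat) :
    {sigma_finite_measure set (n.-tuple T) -> \bar R} :=
  match n with
  | 0 => \d_ ([tuple] : 0.-tuple T)
  | n'.+1 => cons_measure m (tuple_measure m n')
  end.

Lemma tuple_measureE d (T : measurableType d) (R : realType)
    (m : {sigma_finite_measure set T -> \bar R}) (n : nat)
    (A : 'I_n -> set T) : (forall i, measurable (A i)) ->
  (tuple_measure m n [set x | forall i, A i (tnth x i)] =
   \prod_(i < n) m (A i))%E.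
Proof.
elim: n A => [|n IH] A mA.
  rewrite big_ord0 /= diracE (_ : _ \in _ = true)//.
  by apply/mem_set => -[].
rewrite big_ord_recl /= /cons_measure /pushforward.
rewrite [X in (_ \x _)%E X](_ : _ =
  A ord0 `*` [set x | forall i, A (lift ord0 i) (tnth x i)]).
  rewrite product_measure1E//; first by rewrite (IH (fun i => A (lift ord0 i))).
  rewrite (_ : [set x | _] = \bigcap_(i in [set: 'I_n])
      ((@tnth n T ^~ i) @^-1` A (lift ord0 i))).
    apply: fin_bigcap_measurable => // i _.
    by rewrite -[X in measurable X]setTI; exact: measurable_tnth.
  by apply/seteqP; split => x h i => [_|]; [exact: (h i)|exact: (h i I)].
apply/seteqP; split => -[x t] /=.
  move=> h; split; first by have := h ord0.
  by move=> i; have := h (lift ord0 i); rewrite tnthS.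
move=> [h0 h] i; case: (unliftP ord0 i) => [j|] ->; last exact: h0.
by rewrite tnthS; exact: h.
Qed.

(* [measurableTypeR R] is [R] with its Borel sigma-algebra, as carrier of
   [lebesgue_measure]. *)
Definition lebesgue_tuple (R : realType) (n : nat) :
    {sigma_finite_measure set (n.-tuple (measurableTypeR R)) -> \bar R} :=
  tuple_measure [the {sigma_finite_measure set (measurableTypeR R) -> \bar R}
                 of @lebesgue_measure R] n.

Definition unit_cube (R : realType) (n : nat) :
    set (n.-tuple (measurableTypeR R)) :=
  [set x | forall i, 0 <= (tnth x i : R) <= 1].

Definition unit_square (R : realType) :
    set (measurableTypeR R * measurableTypeR R) :=
  [set z | 0 <= (z.1 : R) <= 1 /\ 0 <= (z.2 : R) <= 1].

(* A graphon is given by a function on the whole plane of which only the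
   restriction to the unit square matters. *)
Definition graphon (R : realType) (W : R * R -> R) : Prop :=
  [/\ measurable_fun (@unit_square R) W,
      forall x y, unit_square (x, y) -> 0 <= W (x, y) <= 1
    & forall x y, unit_square (x, y) -> W (x, y) = W (y, x)].

(* The coordinate of [x] attached to the vertex [v] is the one of index
   [enum_rank v]. *)
Definition hom_density (R : realType) (H : sgraph) (W : R * R -> R) : R :=
  \int[lebesgue_tuple R #|H|]_(x in @unit_cube R #|H|)
    \prod_(e in edges H) W (tnth x (enum_rank e.1), tnth x (enum_rank e.2)).

Definition common (R : realType) (H : sgraph) : Prop :=
  forall W : R * R -> R, graphon W ->
    hom_density H W + hom_density H (fun z => 1 - W z)
      >= 2 ^ (1 - (num_edges H)%:Z).

(* Main.v *)
From HB Require Import structures.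
Require Import Defs.
From mathcomp Require Import all_boot all_order all_algebra.
From mathcomp Require Import all_classical all_reals all_analysis.
From mathcomp Require Import measurable_realfun ring lra zify.

(** For [l = 1] the graph with one vertex will do.  For larger [l], take a
    connected graph [G] of chromatic number [l] without cycles of length less
    than [12] (Erdos), a vertex [r] of [G], and a large even [n], and let [H]
    be the complete bipartite graph with [n] vertices on each side, each vertex
    of the left side being joined by an edge to the copy of [r] in its own copy
    of [G] ([pendant r n]).  Then [H] is connected and, as the bipartite part
    only needs two colors, it has chromatic number [l].

    That [H] is common is first reduced to matrices: the values of a graphon at
    finitely many random points form a matrix, in which the density of [H] has
    nearly the expectation [hom_density H W] ([common_of_finite]).  So let [T] be
    a finite set with the uniform measure, and write the two colors [W] and
    [1 - W] as [(1 + U) / 2] and [(1 - U) / 2] with [U] symmetric and bounded by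
    [1] in absolute value.  In the color [P = 1 + U] let [f z] be the density of
    the copies of [G] with root [z], and [g x] the average of [P x z * f z] over
    [z].  The density of [H] is that of the complete bipartite graph with weight
    [g] at the vertices of the left side ([dens_pendant], [bip]), and the claim
    is that the densities for [1 + U] and [1 - U] have sum at least [2].  The
    argument depends on the size of [defect U], the average of the squared
    degrees of [U] plus the density of the four-cycle in [U].

    Small defect ([near_rooted]).  Jensen's inequality, applied on both sides
    of the bipartite graph, bounds the density of [H] below in terms of the
    average [X] of [g] and of the density of the four-cycle with weight [g] at
    two opposite vertices.  The latter is at least [X ^+ 2] times
    [1 + 4 e + c * defect U], where [e] is the average of [U] and [c] is a
    positive constant ([wcodeg2_ge]); the term [4 e] cancels between the two
    colors.  On the other hand, the product of the averages [X] for the two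
    colors may fall below [1], but only by a constant multiple of the defect,
    which is outweighed when [n] is large: the excess [c * defect U] is
    amplified by the exponent [n], whereas the loss is not ([balanced_powers]).
    That the loss is so small is where the girth of [G] matters.  Expand
    [f] into the densities of the subgraphs of [G] in [U].  A subgraph that
    has no long path has leaves, and averaging over the value at a leaf
    produces a degree of [U]; a subgraph that has a long path contains an
    induced matching of four edges, because there are no short cycles, and each
    of these edges contributes a factor of at most the fourth root of the density
    of the four-cycle.  Thus [f] is near [1] in the quadratic mean
    ([rooted_near]), and subgraphs with at least two edges contribute no more
    than the defect to the average of [f] ([mon_avg_le]); subgraphs with one
    edge cancel between the colors.

    Large defect ([far_rooted]).  One of the colors, [P] say, has
    noticeably more four-cycles than a random coloring does, hence many
    pairs of vertices with codegree at least [1 + del / 4].  If [g] is not too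
    small on many of these pairs, then the density of [H] in this color is huge
    for large [n].  Otherwise [g] is tiny on a set of positive measure, and this
    set contains few cliques of the size of [G] plus one; so it has a sparse part
    of positive measure ([sparse_or_clique]).  On this part the other color is
    nearly complete, and the density of [H] in that color is huge ([far_color]).

    The graph [G] comes from a random graph on [n] vertices with edge
    probability [1 / q], with [n / q] a large constant: for large [q], the
    expected number of short cycles is small compared with [n], and with high
    probability all stable sets have less than [n / (2 k)] vertices.
    Deleting a vertex of each short cycle leaves a set that is not
    [k]-colorable, and a minimal set of vertices with this property induces a
    connected graph of chromatic number [k + 1]
    ([exists_large_girth_chromatic]). *)

Set Implicit Arguments.
Unset Strict Implicit.
Unset Printing Implicit Defensive.

Import Order.TTheory GRing.Theory Num.Theory.
Import numFieldNormedType.Exports.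

(** * Uniform averages over finite types *)

(** Locked, lest unification compare two averages by unfolding them to sums. *)
HB.lock Definition avg (R : realFieldType) (T : finType) (F : T -> R) : R :=
  ((\sum_x F x) / #|T|%:R)%R.

Notation "\avg_ x F" := (avg (fun x => F%R))
  (at level 41, F at level 41, x name, right associativity,
   format "\avg_ x  F") : ring_scope.
Notation "\avg_ ( x : T ) F" := (@avg _ T (fun x => F%R))
  (at level 41, F at level 41, x at level 50, right associativity,
   format "\avg_ ( x  :  T )  F") : ring_scope.

Section Averages.
Variable R : realFieldType.
Local Open Scope ring_scope.
Implicit Types T S : finType.

Lemma eq_avg T (F G : T -> R) : F =1 G -> avg F = avg G.
Proof. by move=> FG; rewrite !avg.unlock; congr (_ / _); apply: eq_bigr. Qed.

Lemma avgD T (F G : T -> R) : \avg_x (F x + G x) = avg F + avg G.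
Proof. by rewrite !avg.unlock big_split mulrDl. Qed.

Lemma avgN T (F : T -> R) : \avg_x (- F x) = - avg F.
Proof. by rewrite !avg.unlock sumrN mulNr. Qed.

Lemma avgB T (F G : T -> R) : \avg_x (F x - G x) = avg F - avg G.
Proof. by rewrite avgD avgN. Qed.

Lemma avgZl T c (F : T -> R) : \avg_x (c * F x) = c * avg F.
Proof. by rewrite !avg.unlock -mulr_sumr mulrA. Qed.

Lemma avgZr T c (F : T -> R) : \avg_x (F x * c) = avg F * c.
Proof. by rewrite mulrC -avgZl; apply: eq_avg => x; rewrite mulrC. Qed.

Lemma avg_sum T (I : Type) (r : seq I) (P : pred I) (F : I -> T -> R) :
  \avg_x (\sum_(i <- r | P i) F i x) = \sum_(i <- r | P i) avg (F i).
Proof. by rewrite !avg.unlock exchange_big mulr_suml. Qed.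

Lemma ler_avg T (F G : T -> R) : (forall x, F x <= G x) -> avg F <= avg G.
Proof. by move=> FG; rewrite !avg.unlock ler_wpM2r ?invr_ge0 ?ler0n// ler_sum. Qed.

Lemma avg_ge0 T (F : T -> R) : (forall x, 0 <= F x) -> 0 <= avg F.
Proof. by move=> F0; rewrite avg.unlock divr_ge0 ?ler0n ?sumr_ge0. Qed.

Lemma avg0 T : \avg_(x : T) (0 : R) = 0.
Proof. by rewrite !avg.unlock big1 ?mul0r. Qed.

Lemma ler_norm_avg T (F : T -> R) : `|avg F| <= \avg_x `|F x|.
Proof.
rewrite !avg.unlock normrM [`|_^-1|]ger0_norm ?invr_ge0 ?ler0n//.
by rewrite ler_wpM2r ?invr_ge0 ?ler0n// ler_norm_sum.
Qed.

Lemma avg_const T c : (0 < #|T|)%N -> \avg_(x : T) (c : R) = c.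
Proof.
move=> T0; rewrite !avg.unlock sumr_const -(mulr_natr c) mulfK//.
by rewrite pnatr_eq0 -lt0n.
Qed.

Lemma avg_le_const T c (F : T -> R) :
  (0 < #|T|)%N -> (forall x, F x <= c) -> avg F <= c.
Proof. by move=> T0 Fc; rewrite -[leRHS](@avg_const T)//; apply: ler_avg. Qed.

Lemma avg_ge_const T c (F : T -> R) :
  (0 < #|T|)%N -> (forall x, c <= F x) -> c <= avg F.
Proof. by move=> T0 Fc; rewrite -[leLHS](@avg_const T)//; apply: ler_avg. Qed.

Lemma avg_swap T S (F : T -> S -> R) : \avg_x \avg_y F x y = \avg_y \avg_x F x y.
Proof.
rewrite !avg.unlock -!mulr_suml exchange_big /= -!mulrA; congr (_ * _).
by rewrite mulrC.
Qed.

Lemma avg_pair T S (F : T -> S -> R) :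
  \avg_x \avg_y F x y = \avg_(p : (T * S)%type) F p.1 p.2.
Proof.
by rewrite !avg.unlock -mulr_suml pair_bigA card_prod natrM invfM -mulrA [_^-1 * _]mulrC.
Qed.

Lemma avg_bij T S (h : T -> S) (F : S -> R) :
  bijective h -> avg F = \avg_x F (h x).
Proof.
move=> bh; rewrite !avg.unlock (bij_eq_card bh); congr (_ / _).
by rewrite (reindex h) //; apply: onW_bij.
Qed.

Lemma mul_avg T S (F : T -> R) (G : S -> R) :
  avg F * avg G = \avg_x \avg_y (F x * G y).
Proof.
by rewrite -avgZr; apply: eq_avg => x; rewrite avgZl.
Qed.

(** The coordinates of a uniformly random map are independent. *)
Lemma prod_avg (I T : finType) (F : I -> T -> R) :
  \prod_i avg (F i) = \avg_(y : {ffun I -> T}) \prod_i F i (y i).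
Proof.
rewrite !avg.unlock big_split /= bigA_distr_bigA /= card_ffun natrX.
by rewrite prodr_const exprVn.
Qed.

Lemma avg_expr (I T : finType) (F : T -> R) :
  (avg F) ^+ #|I| = \avg_(y : {ffun I -> T}) \prod_i F (y i).
Proof. by rewrite -(prod_avg (fun=> F)) prodr_const. Qed.

(** Cauchy-Schwarz, from the nonnegative quadratic [avg ((a G - b F)^2)]. *)
Lemma avg_CS T (F G : T -> R) :
  (\avg_x (F x * G x)) ^+ 2 <= (\avg_x F x ^+ 2) * (\avg_x G x ^+ 2).
Proof.
set a := \avg_x F x ^+ 2; set b := \avg_x G x ^+ 2; set c := \avg_x (_ * _).
have a0 : 0 <= a by apply: avg_ge0 => x; apply: sqr_ge0.
have b0 : 0 <= b by apply: avg_ge0 => x; apply: sqr_ge0.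
have H u w : 0 <= u ^+ 2 * a + w ^+ 2 * b - 2 * u * w * c.
  rewrite -!avgZl -avgD -avgB; apply: avg_ge0 => x.
  rewrite [X in _ <= X](_ : _ = (u * F x - w * G x) ^+ 2) ?sqr_ge0//; ring.
have [b_eq0|b_neq0] := eqVneq b 0.
  have := H c (a + 1); rewrite b_eq0 => Hc.
  suff : c ^+ 2 * (a + 2) <= 0 by rewrite mulr0 pmulr_lle0//; lra.
  by lra.
have bp : 0 < b by rewrite lt_def b_neq0.
have := H b c.
rewrite [X in 0 <= X](_ : _ = b * (a * b - c ^+ 2)); last by ring.
by rewrite pmulr_rge0// subr_ge0.
Qed.

(** Bernoulli's inequality in homogeneous form; the induction step gives away a
    multiple of [(x - t) ^+ 2]. *)
Lemma exp_ge_tangent (x t : R) k : 0 <= x -> 0 <= t ->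
  t ^+ k.+1 + k.+1%:R * t ^+ k * (x - t) <= x ^+ k.+1.
Proof.
move=> x0 t0; elim: k => [|k IH]; first by rewrite expr0 !expr1; lra.
rewrite [leRHS]exprS; apply: le_trans (ler_wpM2l x0 IH).
rewrite -subr_ge0 [X in 0 <= X](_ : _ = k.+1%:R * t ^+ k * (x - t) ^+ 2).
  by rewrite mulr_ge0 ?sqr_ge0 ?mulr_ge0 ?ler0n ?exprn_ge0.
by rewrite !exprS -[k.+2]addn1 natrD; ring.
Qed.

(** The tangent of the power at the mean with respect to the weight [w] lies below
    it; the factor [avg w ^+ k] accounts for a weight of total mass other than [1]. *)
Lemma avg_Jensen T (w F : T -> R) k :
    (forall x, 0 <= w x) -> (forall x, 0 <= F x) ->
  (\avg_x (w x * F x)) ^+ k.+1 <= (avg w) ^+ k * \avg_x (w x * F x ^+ k.+1).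
Proof.
move=> w0 F0; set a := avg w; set b := \avg_x (w x * F x).
have a0 : 0 <= a by apply: avg_ge0.
have b0 : 0 <= b by apply: avg_ge0 => x; rewrite mulr_ge0.
have c0 : 0 <= \avg_x (w x * F x ^+ k.+1).
  by apply: avg_ge0 => x; rewrite mulr_ge0// exprn_ge0.
have [a_eq0|a_neq0] := eqVneq a 0.
  suff -> : b = 0 by rewrite expr0n a_eq0; case: (k) => [|j]; rewrite ?mul1r// expr0n mul0r.
  move/eqP: a_eq0; rewrite /a avg.unlock mulf_eq0 => /orP[|/eqP Tinv].
    rewrite psumr_eq0// => /allP w_eq0; rewrite /b avg.unlock big1 ?mul0r// => x _.
    by have /eqP-> := w_eq0 x (mem_index_enum _); rewrite mul0r.
  by rewrite /b avg.unlock Tinv mulr0.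
have ap : 0 < a by rewrite lt_def a_neq0.
pose m := b / a; have m0 : 0 <= m by rewrite divr_ge0.
have bE : b = a * m by rewrite mulrC divfK.
have : a * m ^+ k.+1 <= \avg_x (w x * F x ^+ k.+1).
  have -> : a * m ^+ k.+1 =
      \avg_x (w x * (m ^+ k.+1 + k.+1%:R * m ^+ k * (F x - m))).
    rewrite (eq_avg (G := fun x => m ^+ k.+1 * w x +
      k.+1%:R * m ^+ k * (w x * F x - m * w x))); last by move=> x; ring.
    rewrite avgD !avgZl avgB avgZl -/a -/b bE; ring.
  by apply: ler_avg => x; rewrite ler_wpM2l// exp_ge_tangent.
rewrite -(ler_pM2l (exprn_gt0 k ap)) => /(le_trans _); apply.
by rewrite bE exprMn [a ^+ k.+1]exprSr -mulrA.
Qed.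

Lemma avg_Jensen1 T (F : T -> R) k : (0 < #|T|)%N -> (forall x, 0 <= F x) ->
  (avg F) ^+ k <= \avg_x F x ^+ k.
Proof.
move=> T0 F0; case: k => [|k]; first by rewrite expr0 avg_const.
have := @avg_Jensen T (fun=> 1) F k (fun=> ler01) F0.
rewrite avg_const// expr1n mul1r (eq_avg (G := F)); last by move=> x; rewrite mul1r.
by rewrite [X in _ <= X -> _](eq_avg (G := fun x => F x ^+ k.+1))// => x; rewrite mul1r.
Qed.

Lemma avg_sqr T (F : T -> R) : (0 < #|T|)%N -> (avg F) ^+ 2 <= \avg_x F x ^+ 2.
Proof.
move=> T0; have := avg_CS (fun=> 1) F.
rewrite expr1n avg_const// mul1r (eq_avg (G := F))// => x.
by rewrite mul1r.
Qed.

(** * Resampling one coordinate of a random map *)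

Definition upd (V T : finType) (phi : {ffun V -> T}) (v : V) (z : T) :
  {ffun V -> T} := [ffun u => if u == v then z else phi u].

Lemma upd_eq (V T : finType) (phi : {ffun V -> T}) v z : upd phi v z v = z.
Proof. by rewrite ffunE eqxx. Qed.

Lemma upd_neq (V T : finType) (phi : {ffun V -> T}) v z u :
  u != v -> upd phi v z u = phi u.
Proof. by rewrite ffunE => /negPf->. Qed.

Lemma updC (V T : finType) (phi : {ffun V -> T}) v z u w : u != v ->
  upd (upd phi u w) v z = upd (upd phi v z) u w.
Proof.
move=> uv; apply/ffunP => t; rewrite !ffunE.
by case: (eqVneq t v) => // ->; rewrite eq_sym (negPf uv).
Qed.

(** Averaging over the value at [v] once more changes nothing: the pair of a
    map and a fresh value can be swapped by an involution. *)
Lemma avg_upd (V T : finType) v (F : {ffun V -> T} -> R) :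
  avg F = \avg_phi \avg_z F (upd phi v z).
Proof.
case: (posnP #|T|) => [T0|T0].
  have T_eq0 : \avg_(x : {ffun V -> T}) (0 : R) = 0 by apply: avg0.
  rewrite !avg.unlock [X in X / _]big1 ?[X in _ = X / _]big1// => phi _.
    by rewrite T0 invr0 mulr0.
  by have := fintype0 (phi v) T0.
pose h (p : {ffun V -> T} * T) := (upd p.1 v p.2, p.1 v).
have hK : involutive h.
  move=> [phi z]; rewrite /h /= upd_eq; congr pair.
  by apply/ffunP => u; rewrite !ffunE; case: eqVneq => [->|].
have bh : bijective h by exists h.
rewrite avg_pair -(avg_bij (fun p => F p.1) bh) -(avg_pair (fun x _ => F x)).
by apply: eq_avg => phi; rewrite avg_const.
Qed.

(** * Maps on sums and products of finite types *)

Definition ffun_sum (A B T : finType) (al : {ffun A -> T}) (be : {ffun B -> T}) :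
    {ffun (A + B)%type -> T} :=
  [ffun s => match s with inl a => al a | inr b => be b end].

Lemma avg_ffun_sum (A B T : finType) (F : {ffun (A + B)%type -> T} -> R) :
  avg F = \avg_al \avg_be F (ffun_sum al be).
Proof.
rewrite avg_pair; apply: avg_bij.
exists (fun phi : {ffun (A + B)%type -> T} =>
    ([ffun a => phi (inl a)] : {ffun A -> T}, [ffun b => phi (inr b)] : {ffun B -> T})).
  by move=> [al be]; congr pair; apply/ffunP => i; rewrite !ffunE.
by move=> phi; apply/ffunP => -[i|i]; rewrite !ffunE.
Qed.

(** The restrictions of a random map to the copies of [V] are independent. *)
Lemma avg_ffun_prod (I V T : finType) (F : I -> {ffun V -> T} -> R) :
  \avg_(phi : {ffun (I * V)%type -> T})
     \prod_i F i [ffun v => phi (i, v)] = \prod_i avg (F i).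
Proof.
rewrite prod_avg.
pose h (y : {ffun I -> {ffun V -> T}}) : {ffun (I * V)%type -> T} :=
  [ffun p => y p.1 p.2].
rewrite (avg_bij _ (h := h)).
  apply: eq_avg => y; apply: eq_bigr => i _; congr (F i _).
  by apply/ffunP => v; rewrite !ffunE.
exists (fun phi : {ffun (I * V)%type -> T} =>
    [ffun i => [ffun v => phi (i, v)]] : {ffun I -> {ffun V -> T}}).
  by move=> y; apply/ffunP => i; apply/ffunP => v; rewrite !ffunE.
by move=> phi; apply/ffunP => -[i v]; rewrite !ffunE.
Qed.

End Averages.

(** * Kernels on a finite probability space *)

Section KernelDefs.
Variables (R : realFieldType) (T : finType).
Local Open Scope ring_scope.
Implicit Types (U : T -> T -> R) (f : T -> R).

Definition deg U x : R := \avg_y U x y.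

Definition codeg U x y : R := \avg_z (U x z * U y z).

(** The integral operator with kernel [U]. *)
Definition act U f x : R := \avg_y (U x y * f y).

(** The density of the complete bipartite graph [K_{2,M}], with weight [g] at both
    vertices of the first side. *)
Definition wcodeg U g M : R := \avg_x \avg_y (g x * g y * codeg U x y ^+ M).

(** The homomorphism density of the four-cycle. *)
Definition c4 U : R := \avg_x \avg_y codeg U x y ^+ 2.

(** The quantity that measures how far [1 + U] is from the constant [1]: the
    density of the path with two edges plus that of the four-cycle. *)
Definition defect U : R := (\avg_x deg U x ^+ 2) + c4 U.

Definition symk U := forall x y, U x y = U y x.

Lemma symk_opp U : symk U -> symk (fun x y => - U x y).
Proof. by move=> sU x y; rewrite sU. Qed.

Lemma deg_opp U x : deg (fun x y => - U x y) x = - deg U x.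
Proof. exact: avgN. Qed.

Lemma codeg_opp U x y : codeg (fun x y => - U x y) x y = codeg U x y.
Proof. by apply: eq_avg => z; rewrite mulrNN. Qed.

Lemma c4_opp U : c4 (fun x y => - U x y) = c4 U.
Proof. by apply: eq_avg => x; apply: eq_avg => y; rewrite codeg_opp. Qed.

Lemma defect_opp U : defect (fun x y => - U x y) = defect U.
Proof.
by congr (_ + _); [apply: eq_avg => x; rewrite deg_opp sqrrN|apply: c4_opp].
Qed.

Lemma c4_ge0 U : 0 <= c4 U.
Proof. by do 2!apply: avg_ge0 => ?; apply: sqr_ge0. Qed.

Lemma c4_le_defect U : c4 U <= defect U.
Proof. by rewrite lerDr; apply: avg_ge0 => x; apply: sqr_ge0. Qed.

Lemma deg_le_defect U : \avg_x deg U x ^+ 2 <= defect U.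
Proof. by rewrite lerDl c4_ge0. Qed.

Lemma defect_ge0 U : 0 <= defect U.
Proof. exact: le_trans (c4_ge0 U) (c4_le_defect U). Qed.

Hypothesis T0 : (0 < #|T|)%N.

Lemma codeg_add1 U x y :
  codeg (fun x y => 1 + U x y) x y = 1 + deg U x + deg U y + codeg U x y.
Proof.
rewrite /codeg (eq_avg (G := fun z => 1 + U x z + U y z + U x z * U y z)).
  by rewrite !avgD avg_const.
by move=> z; ring.
Qed.

Lemma act_add1 U f x : act (fun x y => 1 + U x y) f x = avg f + act U f x.
Proof. by rewrite /act -avgD; apply: eq_avg => y; rewrite mulrDl mul1r. Qed.

Lemma act_dot U f g : symk U ->
  \avg_x (act U f x * g x) = \avg_x (f x * act U g x).
Proof.
move=> sU.
rewrite (eq_avg (G := fun x => \avg_y (U x y * f y * g x))); last first.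
  by move=> x; rewrite avgZr.
rewrite avg_swap; apply: eq_avg => y; rewrite -avgZl.
by apply: eq_avg => x; rewrite sU; ring.
Qed.

Lemma act_sqr U f : symk U ->
  \avg_x act U f x ^+ 2 = \avg_x \avg_y (f x * f y * codeg U x y).
Proof.
move=> sU; transitivity (\avg_x (act U f x * act U f x)).
  by apply: eq_avg => x; rewrite expr2.
rewrite act_dot//; apply: eq_avg => x; rewrite -avgZl.
rewrite (eq_avg (F := fun y => f x * f y * _) (G := fun y => \avg_z (f x * f y * (U x z * U y z)))); last first.
  by move=> y; rewrite avgZl.
rewrite avg_swap; apply: eq_avg => z; rewrite mulrA -avgZl.
by apply: eq_avg => y; rewrite [U z y]sU; ring.
Qed.

(** The operator norm of [U] is at most the fourth root of [c4 U], its Schatten norm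
    of exponent 4: by Cauchy-Schwarz, as the squared norm of [act U f] pairs the
    codegrees with [f x * f y]. *)
Lemma act_norm U f (rho : R) : symk U -> 0 <= rho -> c4 U <= rho ^+ 2 ->
  \avg_x act U f x ^+ 2 <= rho * \avg_x f x ^+ 2.
Proof.
move=> sU r0 hr; set n2 := \avg_x f x ^+ 2.
have n0 : 0 <= n2 by apply: avg_ge0 => x; apply: sqr_ge0.
rewrite -ler_sqr ?nnegrE ?mulr_ge0//; last first.
  by apply: avg_ge0 => x; apply: sqr_ge0.
rewrite act_sqr// avg_pair.
apply: le_trans (avg_CS (fun p => f p.1 * f p.2) (fun p => codeg U p.1 p.2)) _.
rewrite -(avg_pair (fun x y => (f x * f y) ^+ 2)).
rewrite -(avg_pair (fun x y => codeg U x y ^+ 2)) -/(c4 U).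
rewrite (_ : \avg_x _ = n2 ^+ 2).
  by rewrite [leRHS]exprMn mulrC ler_wpM2r// sqr_ge0.
rewrite expr2 mul_avg; apply: eq_avg => x; apply: eq_avg => y; ring.
Qed.

Lemma avg_dev_sqr (F : T -> R) :
  \avg_x (F x - avg F) ^+ 2 = (\avg_x F x ^+ 2) - avg F ^+ 2.
Proof.
set m := avg F; rewrite (eq_avg (G := fun x => F x ^+ 2 - 2 * m * F x + m ^+ 2)).
  by rewrite avgD avgB (avgZl _ F) avg_const// -/m; ring.
by move=> x; ring.
Qed.

(** One color in the regime of small defect, of which [lam] is the fourth root.
    The weight [f] is to be a rooted density of a fixed graph, which is bounded
    and, in quadratic mean, as near to [1] as the defect permits; [g] is the
    same density with an edge prolonging the root.  The lemmas bound the terms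
    in the expansion of the density of the four-cycle with weight [g] at two
    opposite vertices. *)
Section Color.
Variables (U : T -> T -> R) (f : T -> R) (C lam : R).
Hypothesis sU : symk U.
Hypothesis U1 : forall x y, `|U x y| <= 1.
Hypothesis f0 : forall x, 0 <= f x <= C.
Hypothesis C1 : 1 <= C.
Hypothesis lam0 : 0 <= lam.
Hypothesis lamC : 200 * 100 * C ^+ 2 * lam <= 1.
Hypothesis lamE : defect U = lam ^+ 4.
Hypothesis f_near : \avg_x (f x - 1) ^+ 2 <= C ^+ 2 * lam ^+ 4.

Let phi x := f x - 1.
Let d := deg U.
Let g := act (fun x y => 1 + U x y) f.
Let X := avg g.

(** The codegrees with [x] are the image under [U] of the row of [x]. *)
Lemma codeg_row x : \avg_y codeg U x y ^+ 2 <= lam ^+ 2.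
Proof.
have -> : \avg_y codeg U x y ^+ 2 = \avg_y act U (U x) y ^+ 2.
  by apply: eq_avg => y; congr (_ ^+ 2); apply: eq_avg => z; rewrite mulrC.
have l2 : c4 U <= (lam ^+ 2) ^+ 2.
  by rewrite -exprM -lamE c4_le_defect.
apply: le_trans (act_norm (U x) sU (sqr_ge0 _) l2) _.
rewrite -[leRHS]mulr1 ler_wpM2l ?sqr_ge0//.
by apply: avg_le_const => // y; rewrite -real_normK ?num_real// expr_le1.
Qed.

Lemma act_norm_lam h : \avg_x act U h x ^+ 2 <= lam ^+ 2 * \avg_x h x ^+ 2.
Proof.
by apply: act_norm => //; rewrite ?sqr_ge0// -exprM -lamE c4_le_defect.
Qed.

Lemma lam_le1 : lam <= 1.
Proof.
have c2 : 1 <= C ^+ 2 by rewrite exprn_ege1.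
have : lam <= C ^+ 2 * lam by rewrite ler_peMl.
by have := lamC; have := lam0; lra.
Qed.

Lemma avg_le_of_sqr (F : T -> R) (c : R) : 0 <= c ->
  \avg_x F x ^+ 2 <= c ^+ 2 -> `|avg F| <= c.
Proof.
move=> c0 h; rewrite -ler_sqr ?nnegrE// real_normK ?num_real//.
exact: le_trans (avg_sqr F T0) h.
Qed.

Lemma avg_mul_le (F G : T -> R) (a b : R) : 0 <= a -> 0 <= b ->
  \avg_x F x ^+ 2 <= a ^+ 2 -> \avg_x G x ^+ 2 <= b ^+ 2 ->
  `|\avg_x (F x * G x)| <= a * b.
Proof.
move=> a0 b0 ha hb; rewrite -ler_sqr ?nnegrE ?mulr_ge0// real_normK ?num_real//.
rewrite exprMn; apply: le_trans (avg_CS F G) _.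
by apply: ler_pM => //; apply: avg_ge0 => x; apply: sqr_ge0.
Qed.

Lemma deg_sqr_le : \avg_x d x ^+ 2 <= (lam ^+ 2) ^+ 2.
Proof. by rewrite -exprM -lamE deg_le_defect. Qed.

Lemma dev_sqr_le : \avg_x phi x ^+ 2 <= (C * lam ^+ 2) ^+ 2.
Proof. by rewrite exprMn -exprM. Qed.

Lemma act_dev_sqr_le : \avg_x act U phi x ^+ 2 <= (C * lam ^+ 3) ^+ 2.
Proof.
apply: le_trans (act_norm_lam phi) _.
apply: le_trans (ler_wpM2l (sqr_ge0 _) dev_sqr_le) _.
by rewrite le_eqVlt; apply/orP; left; apply/eqP; ring.
Qed.

Lemma dev_add1 : f =1 (fun x => 1 + phi x).
Proof. by move=> x; rewrite /phi; ring. Qed.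

Lemma act_dev x : act U f x = d x + act U phi x.
Proof.
rewrite /d /deg /act -avgD; apply: eq_avg => y; rewrite dev_add1; ring.
Qed.

Lemma act_decomp x : g x = avg f + d x + act U phi x.
Proof. by rewrite /g act_add1 act_dev addrA. Qed.

Lemma avg_act_decomp : X = avg f + avg d + avg (act U phi).
Proof.
by rewrite /X (eq_avg act_decomp) !avgD avg_const.
Qed.

Lemma avg_act_dev : avg (act U phi) = \avg_x (phi x * d x).
Proof.
rewrite (eq_avg (G := fun x => act U phi x * 1)) => [|x]; last by rewrite mulr1.
rewrite act_dot//; apply: eq_avg => x; congr (_ * _).
by apply: eq_avg => y; rewrite mulr1.
Qed.

(** Although [act U phi] itself is of order [lam ^+ 3], its average pairs [phi] with
    the degrees, and so is of order [lam ^+ 4]. *)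
Lemma avg_act_dev_le : `|avg (act U phi)| <= C * lam ^+ 4.
Proof.
have C0 : 0 <= C by exact: le_trans C1.
rewrite avg_act_dev (_ : C * _ = (C * lam ^+ 2) * lam ^+ 2); last by ring.
by apply: avg_mul_le dev_sqr_le deg_sqr_le; rewrite ?mulr_ge0 ?sqr_ge0.
Qed.

Lemma avg_dev : avg f = 1 + avg phi.
Proof. by rewrite (eq_avg dev_add1) avgD avg_const. Qed.

Lemma avg_act_near1 : `|X - 1| <= 3 * C * lam ^+ 2.
Proof.
have l1 := lam_le1; have l0 := lam0; have C0 : 0 <= C by exact: le_trans C1.
have h1 : `|avg phi| <= C * lam ^+ 2.
  by apply: avg_le_of_sqr dev_sqr_le; rewrite mulr_ge0 ?sqr_ge0.
have h2 : `|avg d| <= lam ^+ 2 by apply: avg_le_of_sqr deg_sqr_le; rewrite sqr_ge0.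
have h3 : `|avg (act U phi)| <= C * lam ^+ 3.
  by apply: avg_le_of_sqr act_dev_sqr_le; rewrite mulr_ge0 ?exprn_ge0.
rewrite avg_act_decomp avg_dev.
have -> : 1 + avg phi + avg d + avg (act U phi) - 1 =
  avg phi + avg d + avg (act U phi) by ring.
apply: le_trans (ler_normD _ _) _; apply: le_trans (lerD (ler_normD _ _) h3) _.
apply: le_trans (lerD (lerD h1 h2) (lexx _)) _.
have l2 : 0 <= lam ^+ 2 by apply: sqr_ge0.
have : lam ^+ 3 <= lam ^+ 2 by rewrite (exprS lam 2); nra.
have : lam ^+ 2 <= C * lam ^+ 2 by rewrite ler_peMl.
by move=> a b; have := ler_wpM2l C0 b; lra.
Qed.

Lemma avg_act_bounds : 1 / 2 <= X <= 3 / 2.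
Proof.
have := avg_act_near1; have C1' := C1; have l0 := lam0; have lC := lamC; have : 3 * C * lam ^+ 2 <= 1 / 2.
  have : C * lam <= C ^+ 2 * lam by rewrite ler_wpM2r// expr2 ler_peMl//; lra.
  have : C * lam ^+ 2 <= C * lam.
    rewrite ler_wpM2l//; first by lra.
    by rewrite expr2 ler_piMl// lam_le1.
  lra.
by move=> h; rewrite ler_norml => /andP[]; lra.
Qed.

Lemma act_bounds x : 0 <= g x <= 2 * C.
Proof.
apply/andP; split.
  apply: avg_ge0 => y; have /andP[fy0 _] := f0 y.
  by apply: mulr_ge0 => //; have := U1 x y; rewrite ler_norml => /andP[]; lra.
apply: avg_le_const => // y; have /andP[fy0 fyC] := f0 y.
have := U1 x y; rewrite ler_norml => /andP[U_ge U_le].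
by apply: ler_pM => //; lra.
Qed.

Let q := act U phi.

Lemma act_sub_avg x : g x - X = (d x - avg d) + (q x - avg q).
Proof. by rewrite act_decomp avg_act_decomp -/q; ring. Qed.

(** The degrees dominate: [act U phi] is smaller by a factor of order [lam]. *)
Lemma act_variance : \avg_x (g x - X) ^+ 2 <= 4 * lam ^+ 4.
Proof.
have dv : \avg_x (d x - avg d) ^+ 2 <= (lam ^+ 2) ^+ 2.
  rewrite avg_dev_sqr; apply: le_trans deg_sqr_le.
  by have := sqr_ge0 (avg d); lra.
have qv : \avg_x (q x - avg q) ^+ 2 <= (C * lam ^+ 3) ^+ 2.
  rewrite avg_dev_sqr; apply: le_trans act_dev_sqr_le.
  by have := sqr_ge0 (avg q); rewrite /q; lra.
apply: (@le_trans _ _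
    (2 * (\avg_x (d x - avg d) ^+ 2) + 2 * (\avg_x (q x - avg q) ^+ 2))).
  rewrite -!avgZl -avgD; apply: ler_avg => x; rewrite act_sub_avg.
  by have := sqr_ge0 ((d x - avg d) - (q x - avg q)); nra.
have cl : (C * lam ^+ 3) ^+ 2 <= lam ^+ 4.
  rewrite (_ : _ ^+ 2 = C ^+ 2 * lam * lam * lam ^+ 4); last by ring.
  rewrite ler_piMl ?exprn_ge0//.
  have := lamC; have := lam0; have := lam_le1 => l1 l0 lC.
  have h : C ^+ 2 * lam <= 1 by lra.
  by apply: mulr_ile1 => //; rewrite mulr_ge0// sqr_ge0.
by move: dv; rewrite -exprM; lra.
Qed.

(** By [act_sub_avg] the deviation of [g] from its average consists of that of the
    degrees, which contributes their variance, and of that of [act U phi], which is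
    of higher order. *)
Lemma act_dot_deg_ge : X * avg d - C * lam ^+ 5 <= \avg_x (g x * d x).
Proof.
have -> : \avg_x (g x * d x) = X * avg d + (\avg_x (d x - avg d) ^+ 2)
    + \avg_x (q x * (d x - avg d)).
  have -> : X * avg d = \avg_x (X * d x) by rewrite avgZl.
  have -> : \avg_x (d x - avg d) ^+ 2 = \avg_x ((d x - avg d) * d x).
    rewrite avg_dev_sqr.
    rewrite [RHS](eq_avg (G := fun x => d x ^+ 2 - avg d * d x)); last by move=> x; ring.
    by rewrite avgB avgZl; ring.
  have -> : \avg_x (q x * (d x - avg d)) = \avg_x ((q x - avg q) * d x).
    rewrite (eq_avg (G := fun x => q x * d x - q x * avg d)); last by move=> x; ring.
    rewrite [RHS](eq_avg (G := fun x => q x * d x - avg q * d x)); last by move=> x; ring.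
    by rewrite !avgB avgZl avgZr.
  rewrite -!avgD; apply: eq_avg => x.
  have -> : g x = X + (d x - avg d) + (q x - avg q) by have := act_sub_avg x; lra.
  ring.
have v0 : 0 <= \avg_x (d x - avg d) ^+ 2 by apply: avg_ge0 => x; apply: sqr_ge0.
have C0 : 0 <= C by exact: le_trans C1.
have : `|\avg_x (q x * (d x - avg d))| <= (C * lam ^+ 3) * lam ^+ 2.
  apply: avg_mul_le act_dev_sqr_le _; rewrite ?mulr_ge0 ?exprn_ge0//.
  rewrite avg_dev_sqr; apply: le_trans deg_sqr_le.
  by have := sqr_ge0 (avg d); lra.
rewrite ler_norml => /andP[+ _].
have -> : C * lam ^+ 3 * lam ^+ 2 = C * lam ^+ 5 by ring.
lra.
Qed.

(** [g] is the constant [X] up to an error of order [lam ^+ 2], which [U] contracts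
    by another factor [lam]. *)
Lemma act_act_ge :
  X ^+ 2 / 2 * (\avg_x d x ^+ 2) - 4 * lam ^+ 6 <= \avg_x act U g x ^+ 2.
Proof.
pose e x := g x - X.
have e2 : \avg_x act U e x ^+ 2 <= 4 * lam ^+ 6.
  apply: le_trans (act_norm_lam e) _.
  rewrite (_ : 4 * _ = lam ^+ 2 * (4 * lam ^+ 4)); last by ring.
  by rewrite ler_wpM2l ?sqr_ge0 ?act_variance.
suff : X ^+ 2 / 2 * (\avg_x d x ^+ 2) - (\avg_x act U e x ^+ 2)
    <= \avg_x act U g x ^+ 2 by lra.
rewrite -avgZl -avgB; apply: ler_avg => x.
have -> : act U g x = X * d x + act U e x.
  rewrite /d /deg -avgZl -avgD; apply: eq_avg => y; rewrite /e; ring.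
by have := sqr_ge0 (X * d x + 2 * act U e x); nra.
Qed.

Lemma act_codeg_ge :
  X ^+ 2 / 2 * c4 U - 12 * lam ^+ 6 <= \avg_x \avg_y (g x * g y * codeg U x y ^+ 2).
Proof.
pose e x := g x - X.
have H : \avg_x (e x ^+ 2 * \avg_y codeg U x y ^+ 2) <= 4 * lam ^+ 6.
  apply: (@le_trans _ _ (\avg_x (e x ^+ 2 * lam ^+ 2))).
    by apply: ler_avg => x; rewrite ler_wpM2l ?sqr_ge0 ?codeg_row.
  rewrite avgZr; have := act_variance; rewrite -/e => h.
  apply: le_trans (ler_wpM2r (sqr_ge0 _) h) _.
  by rewrite le_eqVlt; apply/orP; left; apply/eqP; ring.
have K : \avg_x \avg_y (e y ^+ 2 * codeg U x y ^+ 2) =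
    \avg_x (e x ^+ 2 * \avg_y codeg U x y ^+ 2).
  rewrite avg_swap; apply: eq_avg => y; rewrite -avgZl; apply: eq_avg => x.
  by congr (_ * _ ^+ 2); apply: eq_avg => z; rewrite mulrC.
suff : X ^+ 2 / 2 * c4 U
    - (3 / 2 * (\avg_x (e x ^+ 2 * \avg_y codeg U x y ^+ 2))
      + 3 / 2 * (\avg_x \avg_y (e y ^+ 2 * codeg U x y ^+ 2)))
    <= \avg_x \avg_y (g x * g y * codeg U x y ^+ 2) by rewrite K; lra.
rewrite /c4 -!avgZl -!avgD -avgB; apply: ler_avg => x.
rewrite -!avgZl -!avgD -avgB; apply: ler_avg => y.
have -> : g x = X + e x by rewrite /e; ring.
have -> : g y = X + e y by rewrite /e; ring.
rewrite -subr_ge0.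
rewrite (_ : _ - _ = ((X / 2 + e x) ^+ 2 + (X / 2 + e y) ^+ 2 +
  (e x + e y) ^+ 2 / 2) * codeg U x y ^+ 2); last by field.
by rewrite mulr_ge0 ?sqr_ge0// !addr_ge0 ?sqr_ge0// divr_ge0 ?sqr_ge0.
Qed.

Lemma act_deg_sum_le :
  \avg_x \avg_y (g x * g y * (d x + d y) ^+ 2) <= 8 * C * X * \avg_x d x ^+ 2.
Proof.
apply: (@le_trans _ _ (\avg_x \avg_y (4 * C * (d x ^+ 2 * g y + g x * d y ^+ 2)))).
  apply: ler_avg => x; apply: ler_avg => y.
  have /andP[gx0 gx1] := act_bounds x; have /andP[gy0 gy1] := act_bounds y.
  apply: (@le_trans _ _ (g x * g y * (2 * d x ^+ 2 + 2 * d y ^+ 2))).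
    rewrite ler_wpM2l ?mulr_ge0//; have := sqr_ge0 (d x - d y); nra.
  have h1 : 0 <= d x ^+ 2 * g y * (2 * C - g x).
    by rewrite mulr_ge0 ?subr_ge0// mulr_ge0 ?sqr_ge0.
  have h2 : 0 <= d y ^+ 2 * g x * (2 * C - g y).
    by rewrite mulr_ge0 ?subr_ge0// mulr_ge0 ?sqr_ge0.
  nra.
rewrite (eq_avg (G := fun x => 4 * C * (d x ^+ 2 * X + g x * \avg_y d y ^+ 2))).
  by rewrite avgZl avgD avgZr avgZr -/X; lra.
by move=> x; rewrite avgZl avgD avgZl avgZl.
Qed.

(** With [w] the sum of the degrees of two points and [v] their codegree, the square
    of the codegree in [1 + U] is [1 + 2 w + 2 v + (w + v) ^+ 2].  Only a fraction
    [th] of the last square is used, which is at least [v ^+ 2 / 2 - w ^+ 2]. *)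
Lemma wcodeg2_expand th : 0 <= th <= 1 ->
  X ^+ 2 + 4 * X * (\avg_x (g x * d x)) + 2 * (\avg_x act U g x ^+ 2)
  + th * ((\avg_x \avg_y (g x * g y * codeg U x y ^+ 2)) / 2
          - \avg_x \avg_y (g x * g y * (d x + d y) ^+ 2))
  <= wcodeg (fun x y => 1 + U x y) g 2.
Proof.
move=> /andP[th0 th1].
set A := \avg_x \avg_y (_ * codeg U _ _ ^+ 2); set B := \avg_x \avg_y (_ * (_ + _) ^+ 2).
have -> : X ^+ 2 = \avg_x \avg_y (g x * g y) by rewrite -mul_avg -expr2.
have -> : 4 * X * (\avg_x (g x * d x)) =
    \avg_x \avg_y (2 * (g x * g y * (d x + d y))).
  rewrite [RHS](eq_avg (G := fun x => 2 * ((g x * d x) * X + g x * \avg_y (g y * d y)))).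
    by rewrite avgZl avgD !avgZr -/X; ring.
  move=> x; rewrite avgZl; congr (2 * _); rewrite /X -(avgZl (g x * d x)) -(avgZl (g x)) -avgD.
  by apply: eq_avg => y; ring.
rewrite act_sqr// /A /B mulrDr mulrN mulrCA.
rewrite -(avgZr _ (fun x => \avg_y _)) -!avgZl -avgB -!avgD; apply: ler_avg => x.
rewrite -avgZr -!avgZl -avgB -!avgD; apply: ler_avg => y.
have /andP[gx0 _] := act_bounds x; have /andP[gy0 _] := act_bounds y.
rewrite codeg_add1 -/d; set v := codeg U x y; set w := d x + d y.
have -> : 1 + d x + d y + v = 1 + w + v by rewrite /w; ring.
have gg : 0 <= g x * g y by rewrite mulr_ge0.
rewrite -subr_ge0 (_ : _ - _ = g x * g y * ((1 - th) * (w + v) ^+ 2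
    + th * ((2 * w + v) ^+ 2 / 2))); last by field.
apply: mulr_ge0 => //; apply: addr_ge0; apply: mulr_ge0; rewrite ?subr_ge0 ?divr_ge0 ?sqr_ge0//.
Qed.

(** The terms [2 w] and [2 v] of the expansion yield the linear term and a multiple of
    the average squared degree, and the last square a multiple of the density
    of the four-cycle.  The fraction [1 / (32 C)] of that square is so small that
    the loss from [w ^+ 2] takes only part of the gain in the squared degrees. *)
Lemma wcodeg2_ge :
  X ^+ 2 * (1 + 4 * avg d + defect U / (256 * C)) <= wcodeg (fun x y => 1 + U x y) g 2.
Proof.
have C0 : 0 < C by exact: lt_le_trans C1.
set i := (32 * C)^-1; have i0 : 0 <= i by rewrite invr_ge0 mulr_ge0 ?ltW.
have iC : i * C = 1 / 32 by rewrite /i; field; rewrite gt_eqF.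
have i1 : i <= 1 / 32 by rewrite -iC ler_peMr.
have th01 : 0 <= i <= 1 by rewrite i0; apply: le_trans i1 _; lra.
apply: le_trans (wcodeg2_expand th01).
have /andP[X_ge X_le] := avg_act_bounds.
have l0 := lam0; have l1 := lam_le1.
have hG := act_dot_deg_ge; have hN := act_act_ge; have hV := act_codeg_ge; have hB := act_deg_sum_le.
move: hG hN hV hB.
set G := \avg_x (_ * _); set N := \avg_x act _ _ _ ^+ 2.
set V := \avg_x \avg_y (_ * codeg _ _ _ ^+ 2); set B := \avg_x \avg_y (_ * (_ + _) ^+ 2).
have -> : defect U / (256 * C) = (lam ^+ 4) * i / 8.
  by rewrite lamE /i; field; rewrite gt_eqF.
have := lamE; rewrite /defect -/d.
set D := \avg_x _; set tau := c4 U; set e := avg d => sE hG hN hV hB.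
have D0 : 0 <= D by apply: avg_ge0 => x; apply: sqr_ge0.
have t0 : 0 <= tau := c4_ge0 U.
have X2 : X <= 2 * X ^+ 2 by nra.
have G' : 4 * X * (X * e - C * lam ^+ 5) <= 4 * X * G by rewrite ler_wpM2l//; lra.
have V' : i * (X ^+ 2 / 2 * tau - 12 * lam ^+ 6) <= i * V by rewrite ler_wpM2l.
have B' : i * B <= X / 4 * D.
  rewrite (_ : X / 4 * D = i * (8 * C * X * D)); first by rewrite ler_wpM2l.
  by transitivity (8 * (i * C) * X * D); [rewrite iC; field|ring].
have XD : X / 4 * D <= X ^+ 2 / 2 * D by rewrite ler_wpM2r//; lra.
have iD : i * (X ^+ 2 * D) <= 1 / 32 * (X ^+ 2 * D).
  by rewrite ler_wpM2r// mulr_ge0// sqr_ge0.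
have l6 : lam ^+ 6 <= C * lam ^+ 5.
  rewrite (exprS lam 5) ler_wpM2r ?exprn_ge0//; apply: le_trans C1; exact: l1.
have l6' : 0 <= lam ^+ 6 by rewrite exprn_ge0.
have il6 : i * lam ^+ 6 <= 1 / 32 * lam ^+ 6 by rewrite ler_wpM2r.
have XL : X * (C * lam ^+ 5) <= 3 / 2 * (C * lam ^+ 5).
  by rewrite ler_wpM2r// mulr_ge0 ?exprn_ge0// ltW.
have key : 15 * (C * lam ^+ 5) <= i * lam ^+ 4 / 32.
  rewrite (_ : 15 * _ = (i * lam ^+ 4) * (480 * C ^+ 2 * lam)); last first.
    transitivity (480 * (i * C) * (C * lam ^+ 5)); last by ring.
    by rewrite iC; field.
  rewrite ler_wpM2l ?mulr_ge0 ?exprn_ge0//.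
  by have := lamC; lra.
have Xs : 1 / 4 * (i * lam ^+ 4) <= X ^+ 2 * (i * lam ^+ 4).
  rewrite ler_wpM2r//; first by rewrite mulr_ge0 ?exprn_ge0.
  nra.
have sX : X ^+ 2 * (i * lam ^+ 4) = i * (X ^+ 2 * D) + i * (X ^+ 2 * tau).
  by rewrite -sE; ring.
have XX : 0 <= X ^+ 2 * D by rewrite mulr_ge0 ?sqr_ge0.
nra.
Qed.

End Color.
End KernelDefs.

(** * Two colors of small defect *)

Section NearTwoColors.
Variable R : realType.
Local Open Scope ring_scope.

(** The bound on [X ^+ 2 * s ^+ m.+1] is its tangent at the point [t] where
    [X ^+ 2 * t ^+ m = 1]: there the slope [m.+1] does not depend on [X], so that
    bounds for different [X] can be added. *)
Lemma color_tangent (X s K L : R) (m : nat) :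
    1 / 2 <= X <= 3 / 2 -> `|X - 1| <= K * L -> 0 <= s -> (6 <= m)%N ->
  exists w, [/\ X ^+ 2 = expR w, w ^+ 2 <= 100 * (K * L) ^+ 2 &
    m.+1%:R * s - (m%:R - w + 2 * w ^+ 2 / m%:R) <= X ^+ 2 * s ^+ m.+1].
Proof.
move=> /andP[X_ge X_le] XKL s0 m6.
have p0 : 0 < X ^+ 2 by rewrite exprn_gt0//; lra.
(* [w] is the logarithm of [X ^+ 2], so [t] is [expR (- w / m)]. *)
have [w wE] := expR_total p0; exists w.
have w_le : w <= X ^+ 2 - 1 by have := expR_ge1Dx w; lra.
have w_ge : - w <= (X ^+ 2)^-1 - 1 by have := expR_ge1Dx (- w); rewrite expRN wE; lra.
have p_ge : 1 / 4 <= X ^+ 2 by nra.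
have pV : (X ^+ 2)^-1 <= 4.
  by rewrite -[leRHS]invrK lef_pV2 ?posrE ?invr_gt0//; lra.
have pV1 : (X ^+ 2)^-1 - 1 = (X ^+ 2)^-1 * (1 - X) * (1 + X).
  have : X != 0 by rewrite gt_eqF//; lra.
  by move=> ?; field.
move: XKL; rewrite ler_norml => /andP[XL1 XL2].
have KL0 : 0 <= K * L by lra.
have pV0 : 0 <= (X ^+ 2)^-1 by rewrite invr_ge0 ltW.
have w_norm : `|w| <= 10 * (K * L).
  rewrite ler_norml; apply/andP; split; last by nra.
  suff : (X ^+ 2)^-1 * (1 - X) * (1 + X) <= 10 * (K * L) by lra.
  apply: (@le_trans _ _ (4 * (K * L) * (1 + X))); last by nra.
  rewrite ler_wpM2r//; first by lra.
  apply: (@le_trans _ _ ((X ^+ 2)^-1 * (K * L))); first by rewrite ler_wpM2l//; lra.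
  by rewrite ler_wpM2r.
split=> //.
  rewrite -[leLHS]real_normK ?num_real//.
  have -> : 100 * (K * L) ^+ 2 = (10 * (K * L)) ^+ 2 by ring.
  by rewrite ler_sqr ?nnegrE// mulr_ge0.
have m_ge : 6 <= m%:R :> R by rewrite ler_nat.
have m0 : m%:R != 0 :> R by rewrite gt_eqF//; lra.
pose u := w / m%:R; pose t := expR (- u).
have u_ge : - (1 / 2) <= u.
  by rewrite /u ler_pdivlMr; lra.
have t0 : 0 <= t := expR_ge0 _.
have pt : X ^+ 2 * t ^+ m = 1.
  rewrite /t -wE -expRM_natl -expRD (_ : w + _ = 0) ?expR0//.
  by rewrite /u; field.
have t_le : t <= 1 - u + 2 * u ^+ 2.
  have u1 : 0 < 1 + u by lra.
  rewrite /t expRN; apply: (@le_trans _ _ (1 + u)^-1).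
    by rewrite lef_pV2 ?posrE ?expR_gt0// expR_ge1Dx.
  rewrite -[leLHS]mul1r ler_pdivrMr//.
  have : 0 <= u ^+ 2 * (1 + 2 * u) by rewrite mulr_ge0 ?sqr_ge0//; lra.
  nra.
apply: (@le_trans _ _ (m.+1%:R * s - m%:R * t)).
  rewrite lerD2l lerN2.
  rewrite (_ : _ - w + _ = m%:R * (1 - u + 2 * u ^+ 2)); last by rewrite /u; field.
  by rewrite ler_wpM2l.
have := ler_wpM2l (ltW p0) (exp_ge_tangent m s0 t0); apply: le_trans.
rewrite mulrDr [t ^+ m.+1]exprS (mulrCA _ t) pt.
rewrite [X ^+ 2 * (_ * _ * _)](_ : _ = m.+1%:R * (X ^+ 2 * t ^+ m) * (s - t)); last by ring.
by rewrite pt -[m.+1]addn1 natrD; lra.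
Qed.

(** The tangents for the two colors add up to [m.+1] times the excess of [s + s']
    over [2], plus the logarithm of [X ^+ 2 * X' ^+ 2], up to errors of order
    [L ^+ 2 / m].  The logarithm is not multiplied by [m], so the excess prevails. *)
Lemma balanced_powers (K K2 gam : R) : 0 <= K -> 0 <= K2 -> 0 < gam ->
  exists m0 : nat, forall (m : nat) (X X' s s' L : R), (m0 <= m)%N ->
    1 / 2 <= X <= 3 / 2 -> 1 / 2 <= X' <= 3 / 2 ->
    `|X - 1| <= K * L -> `|X' - 1| <= K * L -> 1 - K2 * L ^+ 2 <= X * X' ->
    0 <= s -> 0 <= s' -> 2 + 2 * gam * L ^+ 2 <= s + s' ->
  2 <= X ^+ 2 * s ^+ m.+1 + X' ^+ 2 * s' ^+ m.+1.
Proof.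
move=> K0 K20 g0.
pose B := (16 * K2 + 200 * K ^+ 2) / gam.
exists (maxn 6 (Num.trunc B).+1) => m X X' s s' L.
rewrite geq_max => /andP[m6 mB] hX hX' XL XL' XX s0 s0' ss.
have [w [wE w2 h]] := color_tangent hX XL s0 m6.
have [w' [wE' w2' h']] := color_tangent hX' XL' s0' m6.
have mB' : B <= m%:R.
  apply/ltW; apply: lt_le_trans (_ : (Num.trunc B).+1%:R <= _); last by rewrite ler_nat.
  exact: truncnS_gt.
have m_ge : 6 <= m%:R :> R by rewrite ler_nat.
have mp : 0 < m%:R :> R by lra.
have X0 : 1 / 4 <= X * X'.
  case/andP: hX => hx _; case/andP: hX' => hx' _.
  have : 0 <= (X - 1 / 2) * (X' - 1 / 2) by rewrite mulr_ge0 ?subr_ge0.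
  by move: hx hx'; clear; lra.
have ww : - (w + w') <= 32 * K2 * L ^+ 2.
  have := expR_ge1Dx (- (w + w')).
  rewrite expRN expRD -wE -wE' -exprMn.
  set z := X * X' in XX X0 *.
  have z2 : 1 / 16 <= z ^+ 2 by nra.
  have : (z ^+ 2)^-1 - 1 = (1 - z ^+ 2) * (z ^+ 2)^-1.
    by field; rewrite gt_eqF//; lra.
  have zV : (z ^+ 2)^-1 <= 16.
    by rewrite -[leRHS]invrK lef_pV2 ?posrE ?invr_gt0//; lra.
  have zV0 : 0 <= (z ^+ 2)^-1 by rewrite invr_ge0; lra.
  have z1 : 1 - z ^+ 2 <= 2 * K2 * L ^+ 2 by have := sqr_ge0 (z - 1); nra.
  have KL : 0 <= 2 * K2 * L ^+ 2 by rewrite mulr_ge0 ?sqr_ge0// mulr_ge0.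
  have : (1 - z ^+ 2) * (z ^+ 2)^-1 <= 2 * K2 * L ^+ 2 * 16.
    by apply: le_trans (ler_wpM2r zV0 z1) _; rewrite ler_wpM2l.
  lra.
have mg : 16 * K2 + 200 * K ^+ 2 <= gam * m%:R.
  by rewrite [gam * _]mulrC -ler_pdivrMr.
have L0 := sqr_ge0 L.
have err : (2 * w ^+ 2 / m%:R + 2 * w' ^+ 2 / m%:R) <= 400 * K ^+ 2 * L ^+ 2.
  rewrite -mulrDl ler_pdivrMr//.
  apply: (@le_trans _ _ (400 * K ^+ 2 * L ^+ 2 * 1)).
    by move: w2 w2'; rewrite exprMn; lra.
  have c0 : 0 <= 400 * K ^+ 2 * L ^+ 2.
    by have := sqr_ge0 (K * L); rewrite exprMn; lra.
  by rewrite ler_wpM2l//; lra.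
have mL : (16 * K2 + 200 * K ^+ 2) * L ^+ 2 <= gam * m%:R * L ^+ 2 by rewrite ler_wpM2r.
have : m.+1%:R * (2 + 2 * gam * L ^+ 2) <= m.+1%:R * (s + s') by rewrite ler_wpM2l ?ler0n.
rewrite -[m.+1]addn1 natrD in h h' *.
have gL : 0 <= gam * L ^+ 2 by rewrite mulr_ge0// ltW.
lra.
Qed.

(** The density of the complete bipartite graph [K_{N,M}], with weight [g] at the
    vertices of the first side. *)
Definition bip (T : finType) (P : T -> T -> R) (g : T -> R) (N M : nat) : R :=
  \avg_(y : {ffun 'I_M -> T}) (\avg_x (g x * \prod_j P x (y j))) ^+ N.

Lemma bip2E (T : finType) (P : T -> T -> R) (g : T -> R) M :
  bip P g 2 M = wcodeg P g M.
Proof.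
rewrite /bip (eq_avg (G := fun y : {ffun 'I_M -> T} => \avg_x \avg_x'
    (g x * g x' * \prod_j (P x (y j) * P x' (y j))))); last first.
  move=> y; rewrite expr2 mul_avg; apply: eq_avg => x; apply: eq_avg => x'.
  by rewrite big_split /=; ring.
rewrite avg_swap; apply: eq_avg => x; rewrite avg_swap; apply: eq_avg => x'.
rewrite avgZl; congr (_ * _).
by rewrite -[in RHS](card_ord M) /codeg avg_expr.
Qed.

(** [K_{2a,M}] consists of [a] copies of [K_{2,M}] that share the second side, for
    which Jensen's inequality applies. *)
Lemma bip_ge_wcodeg (T : finType) (P : T -> T -> R) (g : T -> R) a M :
    (0 < #|T|)%N -> (forall x y, 0 <= P x y) -> (forall x, 0 <= g x) ->
  wcodeg P g M ^+ a <= bip P g (2 * a) M.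
Proof.
move=> T0 P0 g0; rewrite -bip2E /bip.
under [X in _ <= X]eq_avg do rewrite exprM.
apply: avg_Jensen1 => [|y]; last exact: sqr_ge0.
by rewrite card_ffun expn_gt0 T0.
Qed.

(** Jensen's inequality for the square of the codegree, with the weight [g x * g y]
    on pairs. *)
Lemma wcodeg_Jensen (T : finType) (P : T -> T -> R) (g : T -> R) (m : nat) :
    (forall x, 0 <= g x) -> 0 < avg g ->
  avg g ^+ 2 * (wcodeg P g 2 / avg g ^+ 2) ^+ m.+1 <= wcodeg P g (2 * m.+1).
Proof.
move=> g0 X0; set X := avg g.
have := @avg_Jensen R _ (fun p : T * T => g p.1 * g p.2)
  (fun p => codeg P p.1 p.2 ^+ 2) m _ (fun p => sqr_ge0 _).
rewrite -(avg_pair (fun x y => g x * g y)) -(avg_pair (fun x y => g x * g y * codeg P x y ^+ 2)).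
rewrite -(avg_pair (fun x y => g x * g y * (codeg P x y ^+ 2) ^+ m.+1)).
rewrite -mul_avg -/X -expr2 -/(wcodeg P g 2) => /(_ _)-H.
have {}H := H (fun p => mulr_ge0 (g0 p.1) (g0 p.2)).
have XX : 0 < X ^+ 2 by rewrite exprn_gt0.
rewrite -(ler_pM2l (exprn_gt0 m XX)).
set S := wcodeg P g 2 in H *.
rewrite [leLHS](_ : _ = S ^+ m.+1).
  apply: le_trans H _; apply: ler_wpM2l; first by rewrite exprn_ge0// ltW.
  rewrite le_eqVlt; apply/orP; left; apply/eqP.
  by apply: eq_avg => x; apply: eq_avg => y; rewrite exprM.
by rewrite mulrA -exprSr expr_div_n mulrC divfK// expf_neq0// gt_eqF.
Qed.

Lemma powers_sum_ge2 (x y : R) a : 0 <= x -> 0 <= y -> 2 <= x + y ->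
  2 <= x ^+ a + y ^+ a.
Proof.
move=> x0 y0 xy; case: a => [|a]; first by rewrite !expr0; lra.
have := exp_ge_tangent a x0 ler01; have := exp_ge_tangent a y0 ler01.
rewrite !expr1n !mulr1.
have : 0 <= a.+1%:R * (x + y - 2) by rewrite mulr_ge0 ?ler0n//; lra.
lra.
Qed.

(** The numbers [X] and [X'] are within order [L] of [1] only, but [e] cancels in
    their sum, which falls short of [2] by order [L ^+ 2]; hence so does the product
    fall short of [1]. *)
Lemma prod_near (C L X X' a a' r r' e : R) :
    X = a + e + r -> X' = a' - e + r' -> 2 - 2 * C * L ^+ 2 <= a + a' ->
    - r <= C * L ^+ 2 -> - r' <= C * L ^+ 2 ->
    `|X - 1| <= 3 * C * L -> `|X' - 1| <= 3 * C * L ->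
  1 - (4 * C + 9 * C ^+ 2) * L ^+ 2 <= X * X'.
Proof.
move=> XE XE' aa hr hr' h h'.
have : `|(X - 1) * (X' - 1)| <= 9 * (C ^+ 2 * L ^+ 2).
  rewrite normrM (_ : 9 * _ = (3 * C * L) * (3 * C * L)); last by ring.
  exact: ler_pM.
rewrite ler_norml => /andP[+ _].
have : X * X' = 1 + (X - 1 + (X' - 1)) + (X - 1) * (X' - 1) by ring.
move: ((X - 1) * _) => q -> hq.
have -> : (4 * C + 9 * C ^+ 2) * L ^+ 2 = 4 * (C * L ^+ 2) + 9 * (C ^+ 2 * L ^+ 2).
  ring.
move: hq aa hr hr'; rewrite -[2 * C * _]mulrA.
move: (C * L ^+ 2) (C ^+ 2 * L ^+ 2) XE XE' => u v -> ->; clear; lra.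
Qed.

(** The Jensen steps reduce both densities to the four-cycle, where [wcodeg2_ge]
    applies to [U] and to [- U].  The choice of [del] makes the fourth root of the
    defect small enough for the terms of higher order to be absorbed. *)
Lemma near_regime (C : R) : 1 <= C ->
  exists2 del : R, 0 < del & exists b0 : nat,
  forall (T : finType) (U : T -> T -> R) (f f' : T -> R) (m a : nat),
    (0 < #|T|)%N -> symk U -> (forall x y, `|U x y| <= 1) ->
    (forall x, 0 <= f x <= C) -> (forall x, 0 <= f' x <= C) ->
    defect U <= del ->
    \avg_x (f x - 1) ^+ 2 <= C ^+ 2 * defect U ->
    \avg_x (f' x - 1) ^+ 2 <= C ^+ 2 * defect U ->
    2 - 2 * C * defect U <= avg f + avg f' -> (b0 <= m)%N ->
  2 <= bip (fun x y => 1 + U x y) (act (fun x y => 1 + U x y) f) (2 * a) (2 * m.+1)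
     + bip (fun x y => 1 - U x y) (act (fun x y => 1 - U x y) f') (2 * a) (2 * m.+1).
Proof.
move=> C1; have C0 : 0 < C by lra.
have [del del0 delP] : exists2 del : R, 0 < del & forall lam : R, 0 <= lam ->
    lam ^+ 4 <= del -> 200 * 100 * C ^+ 2 * lam <= 1.
  have k0 : 0 < 200 * 100 * C ^+ 2 by have := exprn_gt0 2 C0; lra.
  move: k0; move: (_ * C ^+ 2) => k k0.
  exists (k^-1 ^+ 4) => [|lam lam0]; first by rewrite exprn_gt0// invr_gt0.
  rewrite ler_pXn2r ?nnegrE ?invr_ge0//; last exact: ltW.
  by move=> h; rewrite mulrC -ler_pdivlMr// mul1r.
exists del => //.
have K0 : 0 <= 3 * C by lra.
have K20 : 0 <= 4 * C + 9 * C ^+ 2 by have := sqr_ge0 C; lra.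
have gam0 : 0 < (256 * C)^-1 by rewrite invr_gt0; lra.
have [b0 Hb0] := balanced_powers K0 K20 gam0.
exists b0 => T U f f' m a T0 sU U1 fC fC' sdel fn fn' ff mb.
pose lam := Num.sqrt (Num.sqrt (defect U)).
have lam0 : 0 <= lam by apply: sqrtr_ge0.
have lamE : defect U = lam ^+ 4.
  by rewrite (exprM lam 2 2) /lam !sqr_sqrtr ?sqrtr_ge0 ?defect_ge0.
have lamC : 200 * 100 * C ^+ 2 * lam <= 1 by apply: delP => //; rewrite -lamE.
pose nU x y := - U x y.
have snU : symk nU by apply: symk_opp.
have nU1 x y : `|nU x y| <= 1 by rewrite normrN.
have lamE' : defect nU = lam ^+ 4 by rewrite defect_opp.
rewrite lamE in fn fn' ff.
have /andP[X_ge X_le] := avg_act_bounds T0 sU C1 lam0 lamC lamE fn.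
have /andP[X_ge' X_le'] := avg_act_bounds T0 snU C1 lam0 lamC lamE' fn'.
have Xn := avg_act_near1 T0 sU C1 lam0 lamC lamE fn.
have Xn' := avg_act_near1 T0 snU C1 lam0 lamC lamE' fn'.
have S := wcodeg2_ge T0 sU U1 fC C1 lam0 lamC lamE fn.
have S' := wcodeg2_ge T0 snU nU1 fC' C1 lam0 lamC lamE' fn'.
have XE := avg_act_decomp T0 U f; have XE' := avg_act_decomp T0 nU f'.
have P := avg_act_dev_le sU C1 lam0 lamE fn.
have P' := avg_act_dev_le snU C1 lam0 lamE' fn'.
have g0 x := proj1 (andP (act_bounds T0 U1 fC x)).
have g0' x := proj1 (andP (act_bounds T0 nU1 fC' x)).
move: XE XE' Xn Xn' X_ge X_le X_ge' X_le' S S' g0 g0'.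
set g := act _ f; set g' := act _ f'; set X := avg g; set X' := avg g'.
move=> XE XE' Xn Xn' X_ge X_le X_ge' X_le' S S' g0 g0'.
have U1ge x y : 0 <= 1 + U x y by have := U1 x y; rewrite ler_norml => /andP[]; lra.
have nU1ge x y : 0 <= 1 + nU x y by have := nU1 x y; rewrite ler_norml => /andP[]; lra.
have := lerD (bip_ge_wcodeg a (2 * m.+1) T0 U1ge g0)
             (bip_ge_wcodeg a (2 * m.+1) T0 nU1ge g0').
apply: le_trans; apply: powers_sum_ge2.
- apply: avg_ge0 => x; apply: avg_ge0 => y; rewrite mulr_ge0 ?mulr_ge0//.
  by apply: exprn_ge0; apply: avg_ge0 => z; rewrite mulr_ge0.
- apply: avg_ge0 => x; apply: avg_ge0 => y; rewrite mulr_ge0 ?mulr_ge0//.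
  by apply: exprn_ge0; apply: avg_ge0 => z; rewrite mulr_ge0.
have X0 : 0 < X by lra.
have X0' : 0 < X' by lra.
apply: le_trans (lerD (wcodeg_Jensen _ m g0 X0) (wcodeg_Jensen _ m g0' X0')).
have dE : avg (deg nU) = - avg (deg U).
  by rewrite -avgN; apply: eq_avg => x; rewrite deg_opp.
have l4 : lam ^+ 4 = (lam ^+ 2) ^+ 2 by rewrite -exprM.
have s_ge : 1 + 4 * avg (deg U) + (256 * C)^-1 * lam ^+ 4
    <= wcodeg (fun x y => 1 + U x y) g 2 / X ^+ 2.
  by rewrite ler_pdivlMr ?exprn_gt0// [leLHS]mulrC [_^-1 * _]mulrC -lamE.
have s_ge' : 1 - 4 * avg (deg U) + (256 * C)^-1 * lam ^+ 4
    <= wcodeg (fun x y => 1 + nU x y) g' 2 / X' ^+ 2.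
  rewrite ler_pdivlMr ?exprn_gt0// [leLHS]mulrC [_^-1 * _]mulrC -lamE'.
  by rewrite -mulrN -dE.
have wc_ge0 (P0 : T -> T -> R) h : (forall x, 0 <= h x) ->
    0 <= wcodeg P0 h 2.
  move=> h0; apply: avg_ge0 => x; apply: avg_ge0 => y.
  by apply: mulr_ge0; [apply: mulr_ge0|apply: sqr_ge0].
apply: (Hb0 _ _ _ _ _ (lam ^+ 2)) => //; rewrite ?X_ge ?X_ge' ?divr_ge0 ?sqr_ge0 ?wc_ge0//.
  rewrite dE in XE'; rewrite l4 in ff P P'.
  by apply: prod_near XE XE' ff _ _ Xn Xn'; [case/ler_normlP: P|case/ler_normlP: P'];
    lra.
apply: le_trans (lerD s_ge s_ge'); rewrite -l4; lra.
Qed.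

End NearTwoColors.

(** * Paths in edge sets of graphs without short cycles *)

(** The bound [12] lets paths with eleven vertices be induced, which leaves room for
    an induced matching of four edges. *)
Definition no_short_cycle (G : sgraph) :=
  forall p : seq G, (2 < size p < 12)%N -> uniq p -> ~~ cycle adj p.

Section Structure.
Variable G : sgraph.
Hypothesis girthG : no_short_cycle G.
Implicit Types (F : {set G * G}) (p : seq G).

(** Adjacency by an edge of [F], which lists only one of the two orders of its ends. *)
Definition link F : rel G := fun u v => ((u, v) \in F) || ((v, u) \in F).

Definition leaf F a w := link F a w /\ forall x, link F a x -> x = w.

Lemma link_sym F : symmetric (link F).
Proof. by move=> u v; rewrite /link orbC. Qed.

Lemma link_adj F : F \subset edges G -> forall u v, link F u v -> adj u v.
Proof.
move=> FE u v /orP[] /(fintype.subsetP FE); rewrite inE => /andP[+ _] //=.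
by rewrite adj_sym.
Qed.

(** A chord would close a cycle with the segment of the path that it spans. *)
Lemma chordless p i j : uniq p -> sorted adj p -> (size p < 12)%N ->
  (i.+1 < j < size p)%N -> forall x0, ~~ adj (nth x0 p i) (nth x0 p j).
Proof.
move=> up sp p12 /andP[ij jp] x0; apply/negP => a.
pose c := take (j - i).+1 (drop i p).
have sc : size c = (j - i).+1 by rewrite size_takel// size_drop; lia.
have uc : uniq c by rewrite take_uniq// drop_uniq.
have cn k : (k <= j - i)%N -> nth x0 c k = nth x0 p (i + k).
  by move=> kij; rewrite nth_take// nth_drop.
have := girthG (p := c); rewrite sc => /(_ _ uc)/negP; apply; first by lia.
have : sorted adj c by rewrite take_sorted// drop_sorted.
case: c sc uc cn => // x s [sc] _ cn; rewrite /= rcons_path => ->/=.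
have -> : last x s = nth x0 p j.
  by rewrite (last_nth x0) sc cn//; congr (nth _ _ _); lia.
rewrite adj_sym; have := cn 0%N isT; rewrite addn0 /= => ->.
exact: a.
Qed.

Lemma head_extend F (x y : G) (s : seq G) : F \subset edges G ->
  uniq [:: x, y & s] -> sorted (link F) [:: x, y & s] -> (size s < 9)%N ->
  leaf F x y \/ exists z, uniq [:: z, x, y & s] && sorted (link F) [:: z, x, y & s].
Proof.
move=> FE up sp s9.
have [/existsP[z /andP[xz zy]]|/existsPn lf] := boolP [exists z, link F x z && (z != y)]; last first.
  left; split=> [|z xz]; first by case/andP: sp.
  by have := lf z; rewrite xz/= negbK => /eqP.
right; exists z.
have spa : sorted adj [:: x, y & s] := sub_sorted (link_adj FE) sp.
have axz := link_adj FE xz.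
rewrite cons_uniq up andbT /= link_sym xz /= andbC; apply/andP; split => //.
rewrite !inE !negb_or zy /=; apply/andP; split.
  by apply: contraTneq axz => ->; rewrite adj_irrefl.
apply/negP => zs; move/negP: axz; apply; apply/negP.
have [i ils zE] := nthP x zs; have {}ils : (i < size s)%N := ils.
have c1 : (size [:: x, y & s] < 12)%N by rewrite /=; lia.
have c2 : (0.+1 < i.+2 < size [:: x, y & s])%N by rewrite /=; lia.
by have := chordless up spa c1 c2 x; rewrite /= zE.
Qed.

Lemma edge_path F : F \subset edges G -> F != finset.set0 ->
  exists p, [/\ size p = 2, uniq p & sorted (link F) p].
Proof.
move=> FE /finset.set0Pn[[u v] uvF]; exists [:: u; v]; split => //=.
  rewrite inE andbT; have := fintype.subsetP FE _ uvF; rewrite inE /= => /andP[a _].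
  by apply: contraTneq a => ->; rewrite adj_irrefl.
by rewrite /link uvF.
Qed.

(** A path can be prolonged at an end, unless this end is a leaf, since an edge
    back to the path would close a short cycle. *)
Lemma long_path_or_leaves F : F \subset edges G -> F != finset.set0 ->
  (exists p, [/\ size p = 11, uniq p & sorted (link F) p]) \/
  (exists x y s x' y' s', [/\ uniq [:: x, y & s], leaf F x y, leaf F x' y' &
    rev [:: x, y & s] = [:: x', y' & s']]).
Proof.
move=> FE F0.
suff H k : (k < 10)%N -> (exists p, [/\ size p = k.+2, uniq p & sorted (link F) p]) \/
  (exists x y s x' y' s', [/\ uniq [:: x, y & s], leaf F x y, leaf F x' y' &
    rev [:: x, y & s] = [:: x', y' & s']]) by have := H 9 isT.
elim: k => [_|k IH k10]; first by left; apply: edge_path.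
have [|[p [sp up pp]]|lv] := IH _; [lia| |by right].
have ext p' : size p' = k.+2 -> uniq p' -> sorted (link F) p' ->
    (exists x y s, p' = [:: x, y & s] /\ leaf F x y) \/
    (exists p, [/\ size p = k.+3, uniq p & sorted (link F) p]).
  case: p' => [|x [|y s]]// [ss] up' pp'.
  have [|lf|[z /andP[uz pz]]] := head_extend FE up' pp' _; first lia.
    by left; exists x, y, s.
  by right; exists [:: z, x, y & s]; rewrite /= ss.
have [[x [y [s [pE lxy]]]]|] := ext p sp up pp; last by left.
have rp : sorted (link F) (rev p).
  rewrite rev_sorted; apply: sub_sorted pp => u v; by rewrite link_sym.
have [||||] := ext (rev p); rewrite ?size_rev ?rev_uniq//; last by left.
move=> [x' [y' [s' [pE' lxy']]]]; right; exists x, y, s, x', y', s'.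
by rewrite -pE.
Qed.

(** The two ends of the path of [long_path_or_leaves] will do unless this path is a
    single edge that forms a component; then a leaf of the rest of [F] is the second
    one. *)
Lemma two_leaves F : F \subset edges G -> (1 < #|F|)%N ->
  (exists p, [/\ size p = 11, uniq p & sorted (link F) p]) \/
  (exists a wa b wb, [/\ leaf F a wa, leaf F b wb, a != b, a != wb & b != wa]).
Proof.
move=> FE F2; have F0 : F != finset.set0 by rewrite -card_gt0; lia.
have [|[x [y [s [x' [y' [s' [up lx lx' rE]]]]]]]] := long_path_or_leaves FE F0.
  by left.
case: s => [|t s] in up rE *; last first.
  have nE k : (k < 2)%N ->
      nth x [:: x', y' & s'] k = nth x [:: x, y, t & s] ((size s).+3 - k.+1).
    by move=> k2; rewrite -rE nth_rev//=; lia.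
  have := nE 0%N isT; have := nE 1%N isT; rewrite /= => {nE} y'E x'E.
  have neq i j : (i < (size s).+3)%N -> (j < (size s).+3)%N -> i != j ->
      nth x [:: x, y, t & s] i != nth x [:: x, y, t & s] j.
    by move=> il jl; rewrite nth_uniq.
  right; exists x, y, x', y'; split => //; rewrite ?x'E ?y'E.
  - by apply: (neq 0%N (size s).+2); lia.
  - by apply: (neq 0%N (size s).+1); lia.
  - by apply: (neq (size s).+2 1%N); lia.
have {s' rE} [x'E y'E] : x' = y /\ y' = x by case: rE.
rewrite {}x'E {}y'E {x' y'} in lx'.
have [lxy lx_only] := lx; have [_ ly_only] := lx'.
(* The edge between [x] and [y] is a component of [F]; [F'] is the rest. *)
pose F' := [set e in F | (e.1 != x) && (e.2 != x)]%SET.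
have F'F : F' \subset F by apply/fintype.subsetP => e; rewrite inE => /andP[].
have link' : forall u v, link F' u v = [&& link F u v, u != x & v != x].
  move=> u v; rewrite /link !inE /=.
  by case: (_ \in F); case: (_ \in F); case: (u != x); case: (v != x).
have F'0 : F' != finset.set0.
  apply/negP => /eqP F'0; move: F2; apply/negP; rewrite -leqNgt.
  apply/card_le1_eqP.
  have H e : e \in F -> e = if adj x y && (enum_rank x < enum_rank y)%N then (x, y) else (y, x).
    case: e => u v uvF.
    have /[!inE]/=/andP[auv ruv] := fintype.subsetP FE _ uvF.
    have := finset.in_set0 (u, v); rewrite -F'0 !inE uvF /= => /negbT.
    rewrite negb_and !negbK => /orP[]/eqP E; subst.
      have E : v = y by apply: lx_only; rewrite /link uvF.
      by rewrite E in auv ruv *; rewrite auv ruv.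
    have E : u = y by apply: lx_only; rewrite /link uvF orbT.
    by rewrite E in ruv *; rewrite ltnNge (ltnW ruv) andbF.
  move=> e1 e2 e1F e2F; rewrite (H e1)// (H e2)//.
have [|[x2 [y2 [s2 [x3 [y3 [s3 [_ [lk lk_only] _ _]]]]]]]] :=
    long_path_or_leaves (fintype.subset_trans F'F FE) F'0.
  move=> [p [sp up' pp]]; left; exists p; split => //.
  by apply: sub_sorted pp => u v; rewrite link' => /andP[].
move: lk; rewrite link' => /and3P[lk x2x y2x]; right.
have x2y : x2 != y.
  by apply: contraNneq y2x => E; rewrite [y2]ly_only// -E.
exists x, y, x2, y2; split => //; last 2 first.
- by rewrite eq_sym.
- by rewrite eq_sym.
split=> // z xz; apply: lk_only; rewrite link' xz x2x /=.
apply: contraNneq x2y => zx; rewrite [x2]lx_only// link_sym -zx//.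
Qed.

End Structure.

(** * Densities of signed subgraphs *)

Section Monomials.
Variables (R : realFieldType) (T : finType) (G : sgraph).
Variable U : T -> T -> R.
Local Open Scope ring_scope.
Implicit Types (F : {set G * G}) (phi : {ffun G -> T}).

Definition mon F phi : R := \prod_(e in F) U (phi e.1) (phi e.2).

Definition touch (e : G * G) v := (e.1 == v) || (e.2 == v).

Definition indep (X : Type) (Psi : {ffun G -> T} -> X) (v : G) :=
  forall phi z, Psi (upd phi v z) = Psi phi.

Lemma mon_indep F v : (forall e, e \in F -> ~~ touch e v) -> indep (mon F) v.
Proof.
move=> Fv phi z; apply: eq_bigr => e /Fv; rewrite negb_or => /andP[e1 e2].
by rewrite !upd_neq.
Qed.

Hypothesis sU : symk U.
Hypothesis U1 : forall x y, `|U x y| <= 1.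
Hypothesis T0 : (0 < #|T|)%N.

Lemma ffunT0 : (0 < #|{: {ffun G -> T}}|)%N.
Proof. by rewrite card_ffun expn_gt0 T0. Qed.

Lemma mon_norm F phi : `|mon F phi| <= 1.
Proof. by rewrite /mon normr_prod prodr_ile1// => e; rewrite normr_ge0 U1. Qed.

Lemma mon1 e phi : mon [set e]%SET phi = U (phi e.1) (phi e.2).
Proof. by rewrite /mon big_set1. Qed.

Lemma mon_split F (P : pred (G * G)) phi :
  mon F phi = mon [set e in F | P e]%SET phi * mon [set e in F | ~~ P e]%SET phi.
Proof.
rewrite /mon (bigID P) /=; congr (_ * _); apply: eq_bigl => e; by rewrite inE.
Qed.

Lemma link_edge F u v : F \subset edges G -> link F u v ->
  exists2 e, [set e in F | touch e u && touch e v]%SET = [set e]%SET &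
    forall phi, U (phi e.1) (phi e.2) = U (phi u) (phi v).
Proof.
move=> FE uv.
have uv_neq : u != v.
  by apply: contraTneq (link_adj FE uv) => ->; rewrite adj_irrefl.
have H e : e \in F -> touch e u && touch e v -> e = if (enum_rank u < enum_rank v)%N
    then (u, v) else (v, u).
  case: e => a b abF; have /[!inE]/=/andP[ab rab] := fintype.subsetP FE _ abF.
  have ab_neq : a != b by apply: contraTneq ab => ->; rewrite adj_irrefl.
  rewrite /touch /= => /andP[/orP[]/eqP Eu /orP[]/eqP Ev]; move: uv_neq ab_neq rab; rewrite -?Eu -?Ev ?eqxx//.
    by move=> _ _ ->.
  by move=> _ _ ba; rewrite ltnNge (ltnW ba).
pose e := if (enum_rank u < enum_rank v)%N then (u, v) else (v, u).
have eF : e \in F.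
  case/orP: uv => h; have := H _ h; rewrite /touch /= !eqxx ?orbT /= => /(_ isT) E; by rewrite /e -E.
have te : touch e u && touch e v.
  by rewrite /e /touch; case: ifP => _ /=; rewrite !eqxx ?orbT.
exists e; last by move=> phi; rewrite /e; case: ifP => _ //=; rewrite sU.
apply/setP => e'; rewrite !inE; apply/idP/eqP => [/andP[e'F te']|->]; last by rewrite eF.
by rewrite /e; apply: H.
Qed.

Lemma leaf_split F a w : F \subset edges G -> leaf F a w ->
  let F' := [set e in F | ~~ touch e a]%SET in
  forall phi, mon F phi = mon F' phi * U (phi a) (phi w).
Proof.
move=> FE [aw a_only] F' phi; rewrite (mon_split _ (fun e => touch e a)) mulrC.
congr (_ * _); have [e eE eU] := link_edge FE aw.
rewrite -eU -mon1 -eE; congr mon; apply/setP => e'; rewrite !inE.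
case: (boolP (e' \in F)) => //= e'F.
case: (boolP (touch e' a)) => //= /orP[]/eqP ea; apply/esym.
  by rewrite /touch (a_only e'.2) ?eqxx ?orbT// -ea /link -surjective_pairing e'F.
by rewrite /touch (a_only e'.1) ?eqxx ?orbT// -ea /link -surjective_pairing e'F orbT.
Qed.

(** Averaging over the value at a leaf replaces its edge by a degree. *)
Lemma leaf_avg (Psi : {ffun G -> T} -> R) (om : {ffun G -> T} -> T) a :
  indep Psi a -> indep om a ->
  \avg_phi (Psi phi * U (phi a) (om phi)) = \avg_phi (Psi phi * deg U (om phi)).
Proof.
move=> iP io; rewrite (avg_upd a); apply: eq_avg => phi.
rewrite -avgZl; apply: eq_avg => z; rewrite iP io upd_eq; congr (_ * _); exact: sU.
Qed.

Lemma avg_at (v : G) (h : T -> R) : \avg_(phi : {ffun G -> T}) h (phi v) = avg h.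
Proof.
rewrite (avg_upd v) (eq_avg (G := fun=> avg h)) ?avg_const ?ffunT0// => phi.
by apply: eq_avg => z; rewrite upd_eq.
Qed.

(** The density of [F] when the value at [r] is [z]. *)
Definition tz F r z := \avg_phi mon F (upd phi r z).

Lemma tz_norm F r z : `|tz F r z| <= 1.
Proof.
apply: le_trans (ler_norm_avg _) _; apply: avg_le_const; first exact: ffunT0.
by move=> phi; apply: mon_norm.
Qed.

(** Once the edge at the leaf is averaged to a degree, Cauchy-Schwarz gets rid of all
    other edges. *)
Lemma tz_leaf F r a w : F \subset edges G -> leaf F a w -> a != r ->
  \avg_z tz F r z ^+ 2 <= \avg_x deg U x ^+ 2.
Proof.
move=> FE lf ar.
apply: (@le_trans _ _ (\avg_z \avg_phi deg U (upd phi r z w) ^+ 2)).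
  apply: ler_avg => z; rewrite /tz.
  pose F' := [set e in F | ~~ touch e a]%SET.
  rewrite (eq_avg (G := fun phi => mon F' (upd phi r z) * U (phi a) (upd phi r z w))); last first.
    by move=> phi; rewrite (leaf_split FE lf) [upd phi r z a]upd_neq.
  have wa : w != a.
    by apply: contraTneq (link_adj FE (proj1 lf)) => ->; rewrite adj_irrefl.
  rewrite leaf_avg; last 2 first.
  - move=> phi z'; rewrite updC// mon_indep// => e.
    by rewrite inE => /andP[].
  - by move=> phi z'; rewrite updC// upd_neq.
  apply: le_trans (avg_CS _ _) _.
  rewrite -[leRHS]mul1r ler_wpM2r//; first by apply: avg_ge0 => ?; apply: sqr_ge0.
  apply: avg_le_const => [|phi]; first exact: ffunT0.
  by rewrite -real_normK ?num_real// expr_le1// mon_norm.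
rewrite avg_swap -(avg_upd r (fun phi => deg U (phi w) ^+ 2)).
by rewrite (avg_at w (fun x => deg U x ^+ 2)).
Qed.

(** Averaging over both leaves leaves the product of two degrees. *)
Lemma mon_two_leaves F a wa b wb : F \subset edges G ->
  leaf F a wa -> leaf F b wb -> a != b -> a != wb -> b != wa ->
  `|\avg_phi mon F phi| <= \avg_x deg U x ^+ 2.
Proof.
move=> FE la lb ab awb bwa.
pose F' := [set e in F | ~~ touch e a]%SET.
pose F'' := [set e in F' | ~~ touch e b]%SET.
have F'E : F' \subset edges G.
  by apply: fintype.subset_trans FE; apply/fintype.subsetP => e; rewrite inE => /andP[].
have lb' : leaf F' b wb.
  have [lk only] := lb; split.
    rewrite /link !inE /touch /= !(eq_sym _ a) (negPf ab) (negPf awb) /=.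
    by rewrite !andbT.
  move=> x lx; apply: only; move: lx; rewrite /link !inE.
  by case/orP => /andP[->]; rewrite ?orbT.
have awa : wa != a.
  by apply: contraTneq (link_adj FE (proj1 la)) => ->; rewrite adj_irrefl.
have bwb : wb != b.
  by apply: contraTneq (link_adj FE (proj1 lb)) => ->; rewrite adj_irrefl.
have nt (A : {set G * G}) v : forall e, e \in [set e in A | ~~ touch e v]%SET -> ~~ touch e v.
  by move=> e; rewrite inE => /andP[].
rewrite (eq_avg (G := fun phi => mon F' phi * U (phi a) (phi wa))); last first.
  by move=> phi; rewrite (leaf_split FE la).
rewrite leaf_avg; last 2 first.
- exact: mon_indep (@nt F a).
- by move=> phi z; rewrite upd_neq.
rewrite (eq_avg (G := fun phi => mon F'' phi * deg U (phi wa) * U (phi b) (phi wb))); last first.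
  by move=> phi; rewrite (leaf_split F'E lb') mulrAC.
rewrite (leaf_avg (om := fun phi => phi wb)); last 2 first.
- move=> phi z; rewrite (mon_indep (@nt F' b)) upd_neq// eq_sym//.
- by move=> phi z; rewrite upd_neq.
apply: le_trans (ler_norm_avg _) _.
apply: (@le_trans _ _ (\avg_(phi : {ffun G -> T})
    ((deg U (phi wa) ^+ 2 + deg U (phi wb) ^+ 2) * 2^-1))).
  apply: ler_avg => phi; rewrite -mulrA normrM normrM.
  apply: (@le_trans _ _ (`|deg U (phi wa)| * `|deg U (phi wb)|)).
    by rewrite ler_piMl ?mulr_ge0// mon_norm.
  have := sqr_ge0 (`|deg U (phi wa)| - `|deg U (phi wb)|).
  rewrite sqrrB !real_normK ?num_real//.
  by move: (`|_| * `|_|) (_ ^+ 2) (_ ^+ 2) => x y z; lra.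
rewrite avgZr avgD (avg_at wa (fun x => deg U x ^+ 2)) (avg_at wb (fun x => deg U x ^+ 2)).
by move: (\avg_x _) => s; lra.
Qed.

Section Matching.
Variable lam : R.
Hypothesis lam0 : 0 <= lam.
Hypothesis lamE : c4 U <= lam ^+ 4.

(** The cut norm is bounded by the operator norm. *)
Lemma cut_bound (p q : T -> R) :
  (forall x, `|p x| <= 1) -> (forall x, `|q x| <= 1) ->
  `|\avg_x \avg_y (U x y * p x * q y)| <= lam.
Proof.
move=> p1 q1; rewrite -ler_sqr ?nnegrE// real_normK ?num_real//.
have sq1 (h : T -> R) : (forall x, `|h x| <= 1) -> \avg_x h x ^+ 2 <= 1.
  by move=> h1; apply: avg_le_const => // x; rewrite -real_normK ?num_real// expr_le1.
rewrite (eq_avg (G := fun x => p x * act U q x)); last first.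
  by move=> x; rewrite -avgZl; apply: eq_avg => y; ring.
apply: le_trans (avg_CS _ _) _.
rewrite -[leRHS]mul1r; apply: ler_pM; try by apply: avg_ge0 => x; apply: sqr_ge0.
  exact: sq1.
have l2 : c4 U <= (lam ^+ 2) ^+ 2 by rewrite -exprM.
apply: le_trans (act_norm q sU (sqr_ge0 _) l2) _.
by rewrite -[leRHS]mulr1 ler_wpM2l ?sqr_ge0// sq1.
Qed.

Definition apart (q q' : G * G) := all (fun x => all (fun y =>
  (x != y) && ~~ adj x y) [:: q'.1; q'.2]) [:: q.1; q.2].

(** Each edge of an induced matching contributes a factor [lam]: with all other
    values fixed, the averages over the pairs of ends of these edges are
    independent of one another. *)
Lemma matching_avg (om : {ffun G -> T} -> {ffun G -> T}) ps F
    (Psi : {ffun G -> T} -> R) c :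
    F \subset edges G -> (forall phi, `|Psi phi| <= c) ->
    (forall q, q \in ps -> link F q.1 q.2) ->
    (forall q v, q \in ps -> v \in [:: q.1; q.2] -> indep Psi v /\
       forall phi z, om (upd phi v z) = upd (om phi) v z) ->
    pairwise apart ps ->
  `|\avg_phi (Psi phi * mon F (om phi))| <= c * lam ^+ size ps.
Proof.
elim: ps F Psi c => [|[u v] ps IH] F Psi c FE Pc lk ind ap.
  rewrite expr0 mulr1; apply: le_trans (ler_norm_avg _) _.
  apply: avg_le_const => [|phi]; first exact: ffunT0.
  rewrite normrM -[leRHS]mulr1; apply: ler_pM => //; exact: mon_norm.
pose F1 := [set e in F | touch e u || touch e v]%SET.
pose F2 := [set e in F | ~~ (touch e u || touch e v)]%SET.
have [[iu ou] [iv ov]] : (indep Psi u /\ forall phi z, om (upd phi u z) = upd (om phi) u z) /\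
    (indep Psi v /\ forall phi z, om (upd phi v z) = upd (om phi) v z).
  by split; apply: (ind (u, v)); rewrite ?inE ?eqxx ?orbT.
pose B phi := \avg_z \avg_z' mon F1 (upd (upd (om phi) u z) v z').
have uv : link F u v by apply: (lk (u, v)); rewrite inE eqxx.
have F2u e : e \in F2 -> ~~ touch e u by rewrite inE negb_or => /and3P[].
have F2v e : e \in F2 -> ~~ touch e v by rewrite inE negb_or => /and3P[].
have -> : \avg_phi (Psi phi * mon F (om phi)) =
    \avg_phi (Psi phi * B phi * mon F2 (om phi)).
  rewrite (avg_upd v) (avg_upd u); apply: eq_avg => phi.
  rewrite mulrAC -avgZl; apply: eq_avg => z; rewrite -avgZl; apply: eq_avg => z'.
  rewrite iv iu ov ou (mon_split _ (fun e => touch e u || touch e v)) -/F1 -/F2.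
  by rewrite (mon_indep F2v) (mon_indep F2u); ring.
have uv_neq : u != v.
  by apply: contraTneq (link_adj FE uv) => ->; rewrite adj_irrefl.
have Bl phi : `|B phi| <= lam.
  pose psi := om phi; have [e eE eU] := link_edge FE uv.
  pose Fu := [set e in F | touch e u && ~~ touch e v]%SET.
  pose Fv := [set e in F | ~~ touch e u && touch e v]%SET.
  have Fuv e' : e' \in Fu -> ~~ touch e' v by rewrite inE => /and3P[].
  have Fvu e' : e' \in Fv -> ~~ touch e' u by rewrite inE => /and3P[].
  rewrite /B (eq_avg (G := fun z => \avg_z' (U z z' * mon Fu (upd psi u z) *
      mon Fv (upd psi v z')))).
    by apply: cut_bound => z; apply: mon_norm.
  move=> z; apply: eq_avg => z'; rewrite -/psi; set ph := upd (upd psi u z) v z'.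
  have -> : mon Fu (upd psi u z) = mon Fu ph by rewrite (mon_indep Fuv).
  have -> : mon Fv (upd psi v z') = mon Fv ph by rewrite /ph updC// (mon_indep Fvu).
  have -> : U z z' = mon [set e]%SET ph.
    by rewrite mon1 eU /ph upd_eq upd_neq// upd_eq.
  rewrite (mon_split F1 (fun e => touch e u)) (mon_split [set _ in F1 | _]%SET (fun e => touch e v)).
  rewrite -eE; congr (mon _ _ * mon _ _ * mon _ _); apply/setP => e'; rewrite !inE;
    by case: (e' \in F); case: (touch e' u); case: (touch e' v).
have -> : c * lam ^+ size ((u, v) :: ps) = c * lam * lam ^+ size ps.
  by rewrite /= exprS mulrA.
move: ap => /= /andP[/allP apuv ap].
apply: IH => //.
- by apply: fintype.subset_trans FE; apply/fintype.subsetP => e; rewrite inE => /andP[].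
- by move=> phi; rewrite normrM; apply: ler_pM.
- move=> q qps; have := lk q; rewrite inE qps orbT => /(_ isT).
  have := apuv _ qps; rewrite /apart /= !andbT.
  case/andP => /andP[/andP[u1 _] /andP[u2 _]] /andP[/andP[v1 _] /andP[v2 _]].
  rewrite /link !inE /touch /= !(eq_sym _ u) !(eq_sym _ v).
  by rewrite (negPf u1) (negPf u2) (negPf v1) (negPf v2) /= !andbT.
- move=> q x qps xq.
  have [ix ox] : indep Psi x /\ forall phi z, om (upd phi x z) = upd (om phi) x z.
    by apply: (ind q) => //; rewrite inE qps orbT.
  have [/andP[ux aux] /andP[vx avx]] :
      ((u != x) && ~~ adj u x) /\ ((v != x) && ~~ adj v x).
    have /andP[/allP h1 /andP[/allP h2 _]] := apuv _ qps.
    by split; [apply: h1|apply: h2].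
  have F1x e : e \in F1 -> ~~ touch e x.
    rewrite inE => /andP[eF ten]; apply/negP => tex.
    have ae : adj e.1 e.2 by have := fintype.subsetP FE _ eF; rewrite inE => /andP[].
    have ae' : adj e.2 e.1 by rewrite adj_sym.
    move: ten tex aux avx; rewrite /touch.
    by case/orP => /orP[]/eqP E1 /orP[]/eqP E2 h1 h2; move: ux vx h1 h2;
      rewrite -?E1 -?E2 ?eqxx ?ae ?ae'.
  split => // phi z; rewrite ix; congr (_ * _).
  apply: eq_avg => w; apply: eq_avg => w'; rewrite ox.
  by rewrite (updC _ _ _ (_ : x != u)) 1?eq_sym// (updC _ _ _ (_ : x != v)) 1?eq_sym// (mon_indep F1x).
Qed.

Hypothesis girthG : no_short_cycle G.

(** The first, fourth, seventh and tenth edge of the path: they are so far apart that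
    an edge between two of them would be a chord. *)
Definition third_pairs (p : seq G) (r : G) :=
  [seq (nth r p (3 * i), nth r p (3 * i).+1) | i <- iota 0 4].

Lemma third_pairs_apart F p r : F \subset edges G ->
  size p = 11 -> uniq p -> sorted (link F) p -> pairwise apart (third_pairs p r).
Proof.
move=> FE sp up pp; rewrite /third_pairs pairwise_map.
have spa : sorted adj p := sub_sorted (link_adj FE) pp.
have H i j : (i.+1 < j < 11)%N ->
    (nth r p i != nth r p j) && ~~ adj (nth r p i) (nth r p j).
  move=> ij; rewrite (chordless girthG)// ?sp// andbT nth_uniq ?sp//; lia.
by rewrite /= /apart /= !H.
Qed.

Lemma third_pairs_link F p r : size p = 11 -> sorted (link F) p ->
  forall q, q \in third_pairs p r -> link F q.1 q.2.
Proof.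
move=> sp /(sortedP r) pp q /mapP[i]; rewrite mem_iota => /andP[_ i4] -> /=.
apply: pp; rewrite sp; lia.
Qed.

Lemma apart_count ps r : pairwise apart ps ->
  (size ps <= (size [seq q <- ps | r \notin [:: q.1; q.2]]).+1)%N.
Proof.
elim: ps => //= q ps IH /andP[/allP aq aps].
case: ifPn => [_ /=|/negPn rq]; first by rewrite ltnS IH.
rewrite ltnS (_ : [seq _ <- ps | _] = ps)//; apply/all_filterP/allP => q' q'ps.
apply/negP => rq'; have /allP/(_ r rq)/allP/(_ r rq') := aq _ q'ps.
by rewrite eqxx.
Qed.

(** Pairs that contain the root are useless, as the value there is fixed; as the
    pairs are disjoint, at most one of them is lost. *)
Lemma tz_matching F p r z : F \subset edges G -> lam <= 1 ->
  size p = 11 -> uniq p -> sorted (link F) p -> `|tz F r z| <= lam ^+ 2.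
Proof.
move=> FE lam1 sp up pp; have ap := third_pairs_apart r FE sp up pp.
pose ps := [seq q <- third_pairs p r | r \notin [:: q.1; q.2]].
have sps : (2 <= size ps)%N by have := apart_count r ap; rewrite -/ps /=; lia.
have /= := @matching_avg (fun phi => upd phi r z) ps F (fun=> 1) 1 FE.
rewrite mul1r => H; apply: le_trans (_ : lam ^+ size ps <= _); last first.
  by rewrite -(subnKC sps) exprD ler_piMr ?exprn_ge0// exprn_ile1.
rewrite /tz (eq_avg (G := fun phi => 1 * mon F (upd phi r z))) => [|phi]; last by rewrite mul1r.
apply: H => [phi|q|q v|]; first by rewrite normr1.
- by rewrite mem_filter => /andP[_]; apply: third_pairs_link.
- rewrite mem_filter => /andP[rq _] vq; split => // phi z'.
  by rewrite updC//; apply: contraNneq rq => <-.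
- exact: pairwise_filter.
Qed.

Lemma mon_matching F p : F \subset edges G ->
  size p = 11 -> uniq p -> sorted (link F) p -> `|\avg_phi mon F phi| <= lam ^+ 4.
Proof.
move=> FE sp up pp; case: p sp up pp => // r p' sp up pp; set p := r :: p' in sp up pp.
have ap := third_pairs_apart r FE sp up pp.
have /= := @matching_avg id (third_pairs p r) F (fun=> 1) 1 FE.
rewrite mul1r => H.
rewrite (eq_avg (G := fun phi => 1 * mon F phi)) => [|phi]; last by rewrite mul1r.
apply: H => // [phi|]; first by rewrite normr1.
exact: third_pairs_link.
Qed.

End Matching.

Section Bounds.
Variable lam : R.
Hypothesis lam0 : 0 <= lam.
Hypothesis lamE : c4 U = lam ^+ 4.
Hypothesis girthG : no_short_cycle G.

Lemma lam_c4_le1 : lam <= 1.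
Proof.
have : c4 U <= 1.
  apply: avg_le_const => // x; apply: avg_le_const => // y.
  rewrite -real_normK ?num_real// expr_le1//.
  apply: le_trans (ler_norm_avg _) _; apply: avg_le_const => // z.
  by rewrite normrM mulr_ile1 ?normr_ge0.
by rewrite lamE expr_le1.
Qed.

(** A graph without leaves other than the root has a long path. *)
Lemma tz_sqr_le F r : F \subset edges G -> F != finset.set0 ->
  \avg_z tz F r z ^+ 2 <= defect U.
Proof.
move=> FE F0; have lamE' : c4 U <= lam ^+ 4 by rewrite lamE.
have [[p [sp up pp]]|] := long_path_or_leaves girthG FE F0.
  apply: le_trans (c4_le_defect U); rewrite lamE; apply: avg_le_const => // z.
  have := tz_matching lam0 lamE' girthG r z FE lam_c4_le1 sp up pp.
  move=> h; rewrite -[leLHS]real_normK ?num_real// (exprM lam 2 2).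
  by rewrite ler_sqr ?nnegrE ?sqr_ge0.
move=> [x [y [s [x' [y' [s' [up lx lx' rE]]]]]]].
apply: le_trans (deg_le_defect U).
have [xr|xr] := eqVneq x r; last exact: tz_leaf lx xr.
apply: tz_leaf lx' _ => //; rewrite -xr.
have x's : x' \in y :: s.
  rewrite -mem_rev; move: rE; rewrite rev_cons.
  case E: (rev (y :: s)) => [|b t]; first by have := size_rev (y :: s); rewrite E.
  by case=> -> _; rewrite mem_head.
by move: up; rewrite cons_uniq => /andP[+ _]; apply: contraNneq => <-.
Qed.

(** For a single edge the average is that of [U], which is only of the order of the
    square root of the defect; with two edges, there are two leaves or a long path. *)
Lemma mon_avg_le F : F \subset edges G -> (1 < #|F|)%N ->
  `|\avg_phi mon F phi| <= defect U.
Proof.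
move=> FE F2; have lamE' : c4 U <= lam ^+ 4 by rewrite lamE.
have [[p [sp up pp]]|] := two_leaves girthG FE F2.
  by apply: le_trans (c4_le_defect U); rewrite lamE; apply: mon_matching FE sp up pp.
move=> [a [wa [b [wb [la lb ab awb bwa]]]]].
by apply: le_trans (deg_le_defect U); apply: mon_two_leaves la lb ab awb bwa.
Qed.

End Bounds.
End Monomials.

(** * Expansion of rooted densities *)

Section Expansion.
Variables (R : realType) (G : sgraph) (r : G).
Local Open Scope ring_scope.

Definition rooted (T : finType) (P : T -> T -> R) (z : T) : R :=
  tz P (edges G) r z.

Lemma rooted_ge0 (T : finType) (A : T -> T -> R) z :
  (forall x y, 0 <= A x y) -> 0 <= rooted A z.
Proof. by move=> A0; apply: avg_ge0 => phi; apply: prodr_ge0. Qed.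

(** Joining a new vertex to the root. *)
Lemma act_rooted (T : finType) (A : T -> T -> R) x :
  act A (rooted A) x =
  \avg_(phi : {ffun G -> T}) (A x (phi r) * mon A (edges G) phi).
Proof.
rewrite /act [RHS](avg_upd r) avg_swap; apply: eq_avg => z; rewrite -avgZl.
by apply: eq_avg => phi; rewrite upd_eq.
Qed.

(** A crude bound for the number of subgraphs of [G]. *)
Definition nsub : R := #|{: {set G * G}}|%:R.

Lemma nsub_ge1 : 1 <= nsub.
Proof. by rewrite ler1n; apply/card_gt0P; exists finset.set0. Qed.

Section OneKernel.
Variables (T : finType) (U : T -> T -> R).
Hypothesis T0 : (0 < #|T|)%N.
Hypothesis sU : symk U.
Hypothesis U1 : forall x y, `|U x y| <= 1.

Lemma mon_add1 (F : {set G * G}) (phi : {ffun G -> T}) :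
  mon (fun x y => 1 + U x y) F phi = \sum_(A : {set G * G} | A \subset F) mon U A phi.
Proof.
rewrite /mon big_mkcond /=.
rewrite (eq_bigr (fun e => (if e \in F then U (phi e.1) (phi e.2) else 0) + 1)).
  rewrite bigA_distr [RHS]big_mkcond /=; apply: eq_bigr => A _.
  case: ifPn => [AF|/subsetPn[e eA eF]].
    rewrite [RHS]big_mkcond /=; apply: eq_bigr => e _; case: ifP => // eA.
    by rewrite (fintype.subsetP AF).
  by rewrite (bigD1 e)//= eA (negPf eF) mul0r.
by move=> e _; case: ifP => _; [rewrite addrC|rewrite add0r].
Qed.

Lemma rooted_expand z :
  rooted (fun x y => 1 + U x y) z = \sum_(A : {set G * G} | A \subset edges G) tz U A r z.
Proof.
by rewrite /rooted /tz -avg_sum; apply: eq_avg => phi; rewrite mon_add1.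
Qed.

Lemma tz_set0 z : tz U finset.set0 r z = 1.
Proof.
rewrite /tz (eq_avg (G := fun=> 1)) ?avg_const ?ffunT0// => phi.
by rewrite /mon big_set0.
Qed.

Lemma sum_sqr_le (I : finType) (P : pred I) (a : I -> R) :
  (\sum_(i | P i) a i) ^+ 2 <= #|I|%:R * \sum_(i | P i) a i ^+ 2.
Proof.
have [I0|I0] := posnP #|I|.
  rewrite !big1 ?expr0n ?mulr0// => i _; by have := fintype0 i I0.
rewrite [X in X ^+ 2]big_mkcond [X in _ * X]big_mkcond /=.
have := avg_sqr (fun i => if P i then a i else 0) I0.
rewrite [X in _ <= X](eq_avg (G := fun i => if P i then a i ^+ 2 else 0)); last first.
  by move=> i; case: ifP => _; rewrite ?expr0n.
rewrite !avg.unlock.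
have n0 : 0 < #|I|%:R :> R by rewrite ltr0n.
rewrite expr_div_n ler_pdivrMr ?exprn_gt0// => h; apply: le_trans h _.
by rewrite le_eqVlt; apply/orP; left; apply/eqP; field; rewrite gt_eqF.
Qed.

Hypothesis girthG : no_short_cycle G.

Lemma c4_root : exists2 lam, 0 <= lam & c4 U = lam ^+ 4.
Proof.
exists (Num.sqrt (Num.sqrt (c4 U))); first exact: sqrtr_ge0.
by rewrite (exprM _ 2 2) !sqr_sqrtr ?sqrtr_ge0 ?c4_ge0.
Qed.

(** Each nonempty subgraph of [G] has a rooted density whose mean square is at most
    the defect. *)
Lemma rooted_near :
  \avg_z (rooted (fun x y => 1 + U x y) z - 1) ^+ 2 <= nsub ^+ 2 * defect U.
Proof.
have [lam lam0 lamE] := c4_root.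
rewrite (eq_avg (G := fun z => (\sum_(A : {set G * G} |
    (A \subset edges G) && (A != finset.set0)) tz U A r z) ^+ 2)); last first.
  move=> z; rewrite rooted_expand (bigD1 finset.set0) ?finset.sub0set//= tz_set0.
  by congr (_ ^+ 2); ring.
apply: le_trans (ler_avg (fun z => sum_sqr_le _ _)) _.
rewrite avgZl expr2 -mulrA ler_wpM2l ?ler0n// avg_sum.
apply: le_trans (_ : \sum_(A : {set G * G} |
    (A \subset edges G) && (A != finset.set0)) defect U <= _).
  by apply: ler_sum => A /andP[AE A0]; exact: (tz_sqr_le sU U1 T0 lam0 lamE girthG r AE A0).
rewrite sumr_const -mulr_natl ler_wpM2r ?defect_ge0// ler_nat.
exact: max_card.
Qed.

Lemma rooted_le z : rooted (fun x y => 1 + U x y) z <= nsub.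
Proof.
rewrite rooted_expand; apply: le_trans (_ : \sum_(A : {set G * G} | A \subset edges G) 1 <= _).
  apply: ler_sum => A _; have := tz_norm U1 T0 A r z.
  by rewrite ler_norml => /andP[].
by rewrite sumr_const ler_nat; apply: max_card.
Qed.

Lemma avg_rooted (P : T -> T -> R) :
  avg (rooted P) = \avg_phi mon P (edges G) phi.
Proof. by rewrite [RHS](avg_upd r) avg_swap. Qed.

End OneKernel.

Lemma mon_opp (T : finType) (U : T -> T -> R) (A : {set G * G}) phi :
  mon (fun x y => - U x y) A phi = (-1) ^+ #|A| * mon U A phi.
Proof. by rewrite /mon prodrN. Qed.

(** Subgraphs with an odd number of edges cancel between the two colors. *)
Lemma rooted_sum (T : finType) (U : T -> T -> R) :
    (0 < #|T|)%N -> symk U -> (forall x y, `|U x y| <= 1) -> no_short_cycle G ->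
  2 - 2 * nsub * defect U <=
  avg (rooted (fun x y => 1 + U x y)) + avg (rooted (fun x y => 1 - U x y)).
Proof.
move=> T0 sU U1 girthG; have [lam lam0 lamE] := c4_root U.
rewrite !avg_rooted (eq_avg (mon_add1 U _)) avg_sum.
rewrite (eq_avg (mon_add1 (fun x y => - U x y) _)) avg_sum -big_split /=.
rewrite (bigD1 finset.set0) ?finset.sub0set//=.
have m0 (V : T -> T -> R) : \avg_phi mon V finset.set0 phi = 1.
  rewrite (eq_avg (G := fun=> 1)) ?avg_const ?ffunT0// => phi.
  by rewrite /mon big_set0.
rewrite !m0; set S := \sum_(A | _) _; suff : - (2 * nsub * defect U) <= S by lra.
apply: (@le_trans _ _ (\sum_(A : {set G * G} |
    (A \subset edges G) && (A != finset.set0)) - (2 * defect U))).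
  rewrite sumr_const -[_ *+ #|_|]mulr_natl.
  set k := #|_|; have : k%:R <= nsub by rewrite ler_nat; apply: max_card.
  by move=> /(ler_wpM2r (defect_ge0 U)); lra.
apply: ler_sum => A /andP[AE A0].
have -> : \avg_phi mon (fun x y => - U x y) A phi = (-1) ^+ #|A| * \avg_phi mon U A phi.
  by rewrite -avgZl; apply: eq_avg => phi; apply: mon_opp.
have D0 := defect_ge0 U.
rewrite -signr_odd; case: (boolP (odd #|A|)) => oA /=; first by rewrite expr1; lra.
have A1 : (1 < #|A|)%N.
  by move: A0 oA; rewrite -card_gt0; case: #|A| => [|[|n]].
have := mon_avg_le sU U1 T0 lam0 lamE girthG AE A1; rewrite ler_norml expr0.
case/andP; lra.
Qed.

(** The expansion of the rooted densities supplies the hypotheses of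
    [near_regime]. *)
Lemma near_rooted : no_short_cycle G ->
  exists2 del : R, 0 < del & exists b0 : nat,
  forall (T : finType) (U : T -> T -> R) (m a : nat),
    (0 < #|T|)%N -> symk U -> (forall x y, `|U x y| <= 1) ->
    defect U <= del -> (b0 <= m)%N ->
  let P x y := 1 + U x y in let P' x y := 1 - U x y in
  2 <= bip P (act P (rooted P)) (2 * a) (2 * m.+1)
     + bip P' (act P' (rooted P')) (2 * a) (2 * m.+1).
Proof.
move=> girthG; have [del del0 [b0 H]] := near_regime nsub_ge1.
exists del => //; exists b0 => T U m a T0 sU U1 Ud mb /=.
have snU := symk_opp sU.
have nU1 x y : `|- U x y| <= 1 by rewrite normrN.
apply: H => //.
- move=> x; rewrite rooted_le// andbT; apply: rooted_ge0 => y z.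
  by have := U1 y z; rewrite ler_norml => /andP[]; lra.
- move=> x; rewrite (rooted_le T0 nU1) andbT; apply: rooted_ge0 => y z.
  by have := U1 y z; rewrite ler_norml => /andP[]; lra.
- exact: rooted_near.
- rewrite -(defect_opp U); exact: rooted_near.
- exact: rooted_sum.
Qed.

End Expansion.

(** * Many cliques or a sparse weighted set *)

Section Cliques.
Variable R : realType.
Local Open Scope ring_scope.

(** The density of [k]-cliques under the vertex weight [h]. *)
Fixpoint clique (T : finType) (W : T -> T -> R) k (h : T -> R) : R :=
  if k is k'.+1 then \avg_x (h x * clique W k' (fun y => h y * W x y)) else 1.

Lemma clique_ge0 (T : finType) (W : T -> T -> R) k (h : T -> R) :
  (forall x y, 0 <= W x y) -> (forall x, 0 <= h x) -> 0 <= clique W k h.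
Proof.
move=> W0; elim: k h => [|k IH] h h0 //=.
by apply: avg_ge0 => x; rewrite mulr_ge0// IH// => y; rewrite mulr_ge0.
Qed.

(** A weighted form of the fact that a graph with few cliques has a large sparse
    set of vertices: either the weight itself is sparse, or many
    neighborhoods are large, and induction applies to them. *)
Lemma sparse_or_clique k (eta c : R) : 0 < eta -> 0 < c ->
  exists eps c' : R, [/\ 0 < eps, 0 < c' &
  forall (T : finType) (W : T -> T -> R) (h : T -> R), (0 < #|T|)%N ->
    (forall x y, 0 <= W x y <= 1) -> (forall x, 0 <= h x <= 1) -> c <= avg h ->
  eps <= clique W k h \/
  exists h' : T -> R, [/\ forall x, 0 <= h' x <= h x, c' <= avg h' &
    \avg_x \avg_y (h' x * h' y * W x y) <= eta * avg h' ^+ 2]].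
Proof.
move=> eta0; elim: k c => [|k IH] c c0.
  by exists 1, 1; split => // T W h _ _ _ _; left.
(* If [h] is not sparse, the weighted degrees have an average of at least
   [2 * c1], so many of them exceed [c1]. *)
pose c1 := eta * c ^+ 2 / 2.
have c10 : 0 < c1 by rewrite divr_gt0// mulr_gt0// exprn_gt0.
have [e1 [c1' [e10 c1'0 H]]] := IH c1 c10.
exists (e1 * c1), (Num.min c c1'); split; rewrite ?mulr_gt0 ?lt_min ?c0//.
move=> T W h T0 W01 h01 ch.
have h0 x : 0 <= h x by case/andP: (h01 x).
have h1 x : h x <= 1 by case/andP: (h01 x).
have W0 x y : 0 <= W x y by case/andP: (W01 x y).
have [sp|nsp] := lerP (\avg_x \avg_y (h x * h y * W x y)) (eta * avg h ^+ 2).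
  by right; exists h; split=> // [x|]; rewrite ?h0 ?lexx// ge_min ch.
pose D x := \avg_y (h y * W x y).
have hW x y : 0 <= h y * W x y <= 1.
  have /andP[w0 w1] := W01 x y; by rewrite mulr_ge0//= mulr_ile1.
have D01 x : 0 <= D x <= 1.
  rewrite avg_ge0 /=; last by move=> y; case/andP: (hW x y).
  by apply: avg_le_const => // y; case/andP: (hW x y).
have [/existsP[x /andP[Dx cx]]|/existsPn all_cl] :=
    boolP [exists x, (c1 <= D x) && (clique W k (fun y => h y * W x y) < e1)].
  right; have [|[h' [h'h ch' sp]]] := H T W _ T0 W01 (hW x) Dx; first by rewrite leNgt cx.
  exists h'; split => // [y|]; last by rewrite ge_min ch' orbT.
  have /andP[-> h'y] := h'h y; apply: le_trans h'y _; rewrite ler_piMr//.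
  by case/andP: (W01 x y).
left; rewrite /=.
apply: (@le_trans _ _ (\avg_x (e1 * (h x * D x) - e1 * c1 * h x))); last first.
  apply: ler_avg => x; rewrite (_ : _ - _ = h x * (e1 * (D x - c1))); last by ring.
  rewrite ler_wpM2l//; have := all_cl x; rewrite negb_and -ltNge -leNgt.
  case/orP => [Dc|]; last first.
    apply: le_trans; rewrite ler_piMr ?ltW//; have /andP[_] := D01 x; lra.
  apply: (@le_trans _ _ 0); last by apply: clique_ge0 => // y; rewrite mulr_ge0.
  by rewrite pmulr_rle0//; lra.
rewrite avgB !avgZl.
have -> : \avg_x (h x * D x) = \avg_x \avg_y (h x * h y * W x y).
  by apply: eq_avg => x; rewrite -avgZl; apply: eq_avg => y; rewrite mulrA.
have hle1 : avg h <= 1 by apply: avg_le_const.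
have cc : eta * c ^+ 2 <= eta * avg h ^+ 2.
  have hp : 0 < avg h by apply: lt_le_trans ch.
  by rewrite ler_pM2l// ler_sqr ?nnegrE//; apply: ltW.
rewrite -mulrA -mulrBr ler_pM2l//.
have : c1 * avg h <= c1 by rewrite ler_piMr// ltW.
have : eta * c ^+ 2 = 2 * c1 by rewrite /c1; field.
lra.
Qed.

End Cliques.

Section CliqueGraph.
Variables (R : realType) (G : sgraph) (r : G) (T : finType) (W : T -> T -> R).
Hypothesis T0 : (0 < #|T|)%N.
Hypothesis W01 : (forall x y, 0 <= W x y <= 1)%R.
Local Open Scope ring_scope.

Let xpredT2 : rel G := fun _ _ => true.

(** The list [s] of vertices provides the recursion that [clique] follows. *)
Fixpoint pairs_prod (a : rel G) (s : seq G) (phi : {ffun G -> T}) : R :=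
  if s is v :: s' then
    (\prod_(u <- s' | a v u) W (phi v) (phi u)) * pairs_prod a s' phi
  else 1.

Lemma pairs_prod_indep a s v : v \notin s -> indep (pairs_prod a s) v.
Proof.
move=> + phi z; elim: s => //= w s IH; rewrite inE negb_or => /andP[vw vs].
rewrite IH//; congr (_ * _); rewrite upd_neq 1?eq_sym//.
rewrite big_seq_cond [RHS]big_seq_cond; apply: eq_bigr => u /andP[us _].
by rewrite upd_neq//; apply: contraNneq vs => <-.
Qed.

Lemma clique_avg s h : uniq s -> clique W (size s) h =
  \avg_(phi : {ffun G -> T}) ((\prod_(v <- s) h (phi v)) * pairs_prod xpredT2 s phi).
Proof.
elim: s h => [|v s IH] h /=.
  by move=> _; rewrite (eq_avg (G := fun=> 1)) ?avg_const ?ffunT0// => phi; rewrite big_nil mulr1.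
move=> /andP[vs us]; rewrite (avg_upd v) avg_swap; apply: eq_avg => z.
rewrite IH// -avgZl; apply: eq_avg => phi.
rewrite pairs_prod_indep// big_cons upd_eq big_split /= -!mulrA; congr (_ * _).
have E (g : T -> R) : \prod_(u <- s) g (upd phi v z u) = \prod_(u <- s) g (phi u).
  rewrite big_seq [RHS]big_seq; apply: eq_bigr => u us'.
  by rewrite upd_neq//; apply: contraNneq vs => <-.
by rewrite !E.
Qed.

Lemma pairs_prod_ge0 a s phi : 0 <= pairs_prod a s phi.
Proof.
elim: s => //= v s IH; rewrite mulr_ge0// prodr_ge0// => u _.
by case/andP: (W01 (phi v) (phi u)).
Qed.

Lemma pairs_prod_le a s phi : pairs_prod xpredT2 s phi <= pairs_prod a s phi.
Proof.
elim: s => //= v s IH; apply: ler_pM => //.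
- by rewrite prodr_ge0// => u _; case/andP: (W01 (phi v) (phi u)).
- exact: pairs_prod_ge0.
rewrite [leRHS]big_mkcond /=; apply: ler_prod => u _.
by have /andP[w0 w1] := W01 (phi v) (phi u); case: (a v u); rewrite w0 ?lexx ?w1.
Qed.

Lemma enum_pairwise : pairwise (fun u v : G => enum_rank u < enum_rank v)%N (enum G).
Proof.
apply/(pairwiseP r) => i j; rewrite !inE -cardE => iG jG ij.
rewrite (_ : nth r (enum G) i = enum_val (Ordinal iG)) ?enum_valK; last by rewrite (enum_val_nth r).
by rewrite (_ : nth r (enum G) j = enum_val (Ordinal jG)) ?enum_valK; last by rewrite (enum_val_nth r).
Qed.

Lemma mon_pairs_prod phi : mon W (edges G) phi = pairs_prod adj (enum G) phi.
Proof.
rewrite /mon (eq_bigl (fun e : G * G => adj e.1 e.2 && (enum_rank e.1 < enum_rank e.2)%N)); last first.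
  by move=> e; rewrite inE.
rewrite -(pair_big_dep predT (fun u v => adj u v && (enum_rank u < enum_rank v)%N)
  (fun u v => W (phi u) (phi v))) /=.
rewrite -big_enum /=.
rewrite (eq_bigr (fun u => \prod_(w <- enum G | adj u w && (enum_rank u < enum_rank w)%N)
   W (phi u) (phi w))); last by move=> u _; rewrite big_enum_cond.
have := enum_pairwise; elim: (enum G) => [|v s IH]; first by rewrite big_nil.
rewrite pairwise_cons => /andP[/allP vs ps]; rewrite !big_cons /= ltnn andbF.
congr (_ * _).
  rewrite big_seq_cond [RHS]big_seq_cond; apply: eq_bigl => w.
  by case: (boolP (w \in s)) => //= /vs ->; rewrite andbT.
rewrite -IH// big_seq [RHS]big_seq; apply: eq_bigr => u us.
rewrite big_cons ifF//; apply/negbTE; rewrite negb_and; apply/orP; right.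
by rewrite -leqNgt ltnW// vs.
Qed.

(** [G] is a subgraph of the complete graph on its vertices, and omitting factors
    which are at most [1] increases the product. *)
Lemma clique_le_rooted h : (forall x, 0 <= h x <= 1) ->
  clique W #|G| h <= \avg_z (h z * rooted r W z).
Proof.
move=> h01; rewrite cardE clique_avg ?enum_uniq//.
have -> : \avg_z (h z * rooted r W z) = \avg_(phi : {ffun G -> T}) (h (phi r) * mon W (edges G) phi).
  rewrite [RHS](avg_upd r) avg_swap; apply: eq_avg => z; rewrite -avgZl.
  by apply: eq_avg => phi; rewrite upd_eq.
apply: ler_avg => phi; apply: ler_pM.
- by rewrite prodr_ge0// => u _; case/andP: (h01 (phi u)).
- exact: pairs_prod_ge0.
- rewrite big_enum /= (bigD1 r)//= ler_piMr//; first by case/andP: (h01 (phi r)).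
  by rewrite prodr_ile1// => u _; apply: h01.
- by rewrite mon_pairs_prod; apply: pairs_prod_le.
Qed.

End CliqueGraph.

(** * Kernels far from constant *)

Section Far.
Variables (R : realType) (G : sgraph) (r : G).
Local Open Scope ring_scope.

Lemma pow_large (q y : R) : 1 < q -> exists n0, forall n, (n0 <= n)%N -> y <= q ^+ n.
Proof.
move=> q1; exists (Num.trunc (`|y| / (q - 1))).+1 => n hn.
have q0 : 0 < q - 1 by lra.
have : `|y| / (q - 1) <= n%:R.
  apply: ltW; apply: lt_le_trans (truncnS_gt _) _; by rewrite ler_nat.
rewrite ler_pdivrMr// => h; apply: le_trans (ler_norm y) _; apply: le_trans h _.
case: n {hn} => [|n]; first by rewrite mul0r expr0.
have := exp_ge_tangent n (_ : 0 <= q) ler01; rewrite !expr1n mulr1 => /(_ _)-h.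
by apply: le_trans (h _); lra.
Qed.

(** Restrict the second side to the weight [be] and the first one to [al]: by Jensen's
    inequality with the weight of a whole tuple of the second side, it suffices to
    treat a single vertex of the first side. *)
Lemma bip_weighted (T : finType) (P : T -> T -> R) (g al be : T -> R) (p : R) N M :
    (0 < #|T|)%N -> (forall x y, 0 <= P x y) -> 0 <= p ->
    (forall x, 0 <= al x <= g x) -> (forall y, 0 <= be y <= 1) ->
    (forall x, al x != 0 -> p * avg be <= \avg_y (be y * P x y)) -> 0 < avg be ->
  avg be ^+ M * (avg al * p ^+ M) ^+ N.+1 <= bip P g N.+1 M.
Proof.
move=> T0 P0 p0 alg be1 pbe b0.
have al0 x : 0 <= al x by case/andP: (alg x).
have be0 x : 0 <= be x by case/andP: (be1 x).
pose w (y : {ffun 'I_M -> T}) := \prod_j be (y j).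
pose F (y : {ffun 'I_M -> T}) := \avg_x (al x * \prod_j P x (y j)).
have w0 y : 0 <= w y by apply: prodr_ge0.
have F0 y : 0 <= F y.
  by apply: avg_ge0 => x; rewrite mulr_ge0// prodr_ge0.
apply: (@le_trans _ _ (\avg_y (w y * F y ^+ N.+1))); last first.
  apply: ler_avg => y; rewrite -[leRHS]mul1r; apply: ler_pM => //.
  - exact: exprn_ge0.
  - by apply: prodr_ile1 => j _; apply: be1.
  - apply: lerXn2r; rewrite ?nnegrE//.
      apply: avg_ge0 => x; rewrite mulr_ge0 ?prodr_ge0//.
      by apply: le_trans (al0 x) _; case/andP: (alg x).
    apply: ler_avg => x; rewrite ler_wpM2r ?prodr_ge0//.
    by case/andP: (alg x).
have wE : avg w = avg be ^+ M by rewrite -{2}(card_ord M) avg_expr.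
have wF : avg al * (p * avg be) ^+ M <= \avg_y (w y * F y).
  rewrite (eq_avg (F := fun y => w y * F y)
    (G := fun y => \avg_x (al x * \prod_j (be (y j) * P x (y j))))); last first.
    by move=> y; rewrite /F -avgZl; apply: eq_avg => x; rewrite big_split /= mulrCA.
  rewrite avg_swap -avgZr; apply: ler_avg => x; rewrite avgZl.
  have [->|alx] := eqVneq (al x) 0; first by rewrite !mul0r.
  rewrite ler_wpM2l// -{1}(card_ord M) -(avg_expr _ (fun y => be y * P x y)) card_ord.
  apply: lerXn2r; rewrite ?nnegrE ?pbe// ?mulr_ge0// ?(ltW b0)//.
  by apply: avg_ge0 => y; rewrite mulr_ge0.
have := avg_Jensen N w0 F0; rewrite wE => J.
have bM : 0 < avg be ^+ M by rewrite exprn_gt0.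
rewrite -(ler_pM2l (exprn_gt0 N bM)); apply: le_trans J.
apply: le_trans (_ : (avg al * (p * avg be) ^+ M) ^+ N.+1 <= _); last first.
  apply: lerXn2r wF; rewrite nnegrE.
    rewrite mulr_ge0 ?avg_ge0// exprn_ge0// mulr_ge0// ltW//.
  by apply: avg_ge0 => y; rewrite mulr_ge0.
rewrite le_eqVlt; apply/orP; left; apply/eqP.
by rewrite mulrA -exprSr !exprMn; ring.
Qed.

Lemma avg_two (T : finType) (K : {ffun G -> T} -> R) (q : T -> T -> R) a b :
    a != b -> indep K a -> indep K b ->
  \avg_phi (K phi * q (phi a) (phi b)) = avg K * \avg_x \avg_y q x y.
Proof.
move=> ab Ka Kb; rewrite (avg_upd b) (avg_upd a) -avgZr; apply: eq_avg => phi.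
rewrite -avgZl; apply: eq_avg => z; rewrite -avgZl; apply: eq_avg => z'.
by rewrite Kb Ka upd_neq// !upd_eq.
Qed.

Lemma avg_one (T : finType) (K : {ffun G -> T} -> R) (q : T -> R) a :
  indep K a -> \avg_phi (K phi * q (phi a)) = avg K * avg q.
Proof.
move=> Ka; rewrite (avg_upd a) -avgZr; apply: eq_avg => phi.
by rewrite -avgZl; apply: eq_avg => z; rewrite Ka upd_eq.
Qed.

(** The union bound. *)
Lemma prod_1B_ge (I : finType) (A : {pred I}) (w : I -> R) :
  (forall i, 0 <= w i <= 1) -> 1 - \sum_(i in A) w i <= \prod_(i in A) (1 - w i).
Proof.
move=> w01.
suff [] : [/\ 1 - \sum_(i in A) w i <= \prod_(i in A) (1 - w i),
  0 <= \sum_(i in A) w i & 0 <= \prod_(i in A) (1 - w i) <= 1] by [].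
elim/big_rec2: _ => [|i x y _ [h1 h2 /andP[h3 h4]]]; first by rewrite subr0 !lexx ler01.
have /andP[wi0 wi1] := w01 i; split; [|lra|].
  have : 0 <= w i * (1 - y) by rewrite mulr_ge0// subr_ge0.
  lra.
apply/andP; split; first by rewrite mulr_ge0//; lra.
by rewrite mulr_ile1//; lra.
Qed.

Lemma rooted_mono (T : finType) (A B : T -> T -> R) z :
  (forall x y, 0 <= A x y <= B x y) -> rooted r A z <= rooted r B z.
Proof.
move=> AB; apply: ler_avg => phi; apply: ler_prod => e _; exact: AB.
Qed.

(** Small enough for a union bound over the edges of [G] and over the edge that joins
    [G] to a further vertex. *)
Definition sparsity : R := (16 * (#|edges G|%:R + 1))^-1.

Lemma sparsity_gt0 : 0 < sparsity.
Proof. by rewrite invr_gt0 mulr_gt0// ltr_wpDl// ler0n. Qed.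

Section Sparse.
Variables (T : finType) (W : T -> T -> R) (h : T -> R).
Hypothesis T0 : (0 < #|T|)%N.
Hypothesis W01 : forall x y, 0 <= W x y <= 1.
Hypothesis h01 : forall x, 0 <= h x <= 1.
Hypothesis hpos : 0 < avg h.
Hypothesis sparse : \avg_x \avg_y (h x * h y * W x y) <= sparsity * avg h ^+ 2.

Let H (phi : {ffun G -> T}) := \prod_v h (phi v).
Let Wd x := \avg_y (h y * W x y).

Lemma weight_ge0 phi : 0 <= H phi.
Proof. by apply: prodr_ge0 => v _; case/andP: (h01 (phi v)). Qed.

Lemma avg_weight : avg H = avg h ^+ #|G|.
Proof. by rewrite avg_expr. Qed.

Lemma weight_vertex x : (\avg_phi (H phi * W x (phi r))) * avg h = avg H * Wd x.
Proof.
pose K (phi : {ffun G -> T}) := \prod_(v | v != r) h (phi v).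
have Kr : indep K r by move=> phi z; apply: eq_bigr => v vr; rewrite upd_neq.
have HE phi : H phi = K phi * h (phi r) by rewrite /H (bigD1 r)//= mulrC.
rewrite (eq_avg (G := fun phi => K phi * (h (phi r) * W x (phi r)))); last first.
  by move=> phi; rewrite HE -mulrA.
rewrite (avg_one (fun z => h z * W x z) Kr) (eq_avg HE) (avg_one h Kr) -/(Wd x).
by rewrite -!mulrA; congr (_ * _); rewrite mulrC.
Qed.

Lemma weight_edge a b : a != b -> \avg_phi (H phi * W (phi a) (phi b)) <= sparsity * avg H.
Proof.
move=> ab.
pose K (phi : {ffun G -> T}) := \prod_(v | (v != a) && (v != b)) h (phi v).
have Ka : indep K a by move=> phi z; apply: eq_bigr => v /andP[va _]; rewrite upd_neq.
have Kb : indep K b by move=> phi z; apply: eq_bigr => v /andP[_ vb]; rewrite upd_neq.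
have HE phi : H phi = K phi * (h (phi a) * h (phi b)).
  by rewrite /H (bigD1 a)//= (bigD1 b) 1?eq_sym//= mulrA mulrC.
rewrite (eq_avg (G := fun phi => K phi * (h (phi a) * h (phi b) * W (phi a) (phi b)))); last first.
  by move=> phi; rewrite HE -mulrA.
rewrite (avg_two (fun x y => h x * h y * W x y) ab Ka Kb).
rewrite (eq_avg HE) (avg_two (fun x y => h x * h y) ab Ka Kb) -mul_avg -expr2.
rewrite mulrCA ler_wpM2l//; apply: avg_ge0 => phi.
by apply: prodr_ge0 => v _; case/andP: (h01 (phi v)).
Qed.

Let good x := Wd x <= 4 * sparsity * avg h.

(** Markov's inequality for the degrees on the sparse set. *)
Lemma good_weight : 3 / 4 * avg h <= \avg_x (if good x then h x else 0).
Proof.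
have s0 := sparsity_gt0.
suff : \avg_x (if good x then 0 else h x) <= 1 / 4 * avg h.
  have -> : \avg_x (if good x then 0 else h x) = avg h - \avg_x (if good x then h x else 0).
    by rewrite -avgB; apply: eq_avg => x; case: (good x); ring.
  lra.
have hs : 0 < 4 * sparsity * avg h by have hp := hpos; rewrite mulr_gt0// mulr_gt0.
rewrite -(ler_pM2l hs).
rewrite (_ : 4 * sparsity * avg h * (1 / 4 * avg h) = sparsity * avg h ^+ 2); last by field.
apply: le_trans sparse; rewrite -avgZl; apply: ler_avg => x.
have /andP[hx0 _] := h01 x.
have -> : \avg_y (h x * h y * W x y) = h x * Wd x.
  by rewrite -avgZl; apply: eq_avg => y; rewrite mulrA.
case: ifPn; last by rewrite -ltNge => /ltW g; rewrite mulrC ler_wpM2l.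
move=> _; rewrite mulr0 mulr_ge0//; apply: avg_ge0 => y.
by rewrite mulr_ge0//; [case/andP: (h01 y)|case/andP: (W01 x y)].
Qed.

Let P' x y := 2 * (1 - W x y).

(** On a sparse set of vertices the complementary color is so dense that a
    union bound over the edges of [G] is enough. *)
Lemma sparse_weight : exists al : T -> R,
  [/\ forall x, 0 <= al x <= act P' (rooted r P') x,
      avg h ^+ (#|G|.+1) / 2 <= avg al &
      forall x, al x != 0 -> 3 / 2 * avg h <= \avg_y (h y * P' x y)].
Proof.
have s0 := sparsity_gt0.
have es : (4 + #|edges G|%:R) * sparsity <= 1 / 4.
  have e0 : 0 <= #|edges G|%:R :> R by rewrite ler0n.
  rewrite ler_pdivrMr; last by lra.
  lra.
have s16 : 4 * sparsity <= 1 / 4.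
  have : 0 <= #|edges G|%:R * sparsity by rewrite mulr_ge0 ?ler0n//; apply: ltW.
  lra.
have P'0 x y : 0 <= P' x y by rewrite mulr_ge0//; case/andP: (W01 x y) => _; rewrite subr_ge0.
have g0 x : 0 <= act P' (rooted r P') x.
  by apply: avg_ge0 => z; rewrite mulr_ge0// rooted_ge0.
exists (fun x => (if good x then h x else 0) * act P' (rooted r P') x); split.
- move=> x; have /andP[hx0 hx1] := h01 x.
  by case: ifP => _; rewrite ?mul0r ?lexx ?g0// mulr_ge0//= ler_piMl.
- apply: (@le_trans _ _ (\avg_x ((if good x then h x else 0) * (3 / 4 * avg H)))).
    rewrite avgZr avg_weight; have := ler_wpM2r (exprn_ge0 #|G| (ltW hpos)) good_weight.
    rewrite exprS; set q := _ ^+ _ => hq.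
    have q0 : 0 <= avg h * q by rewrite mulr_ge0 ?exprn_ge0// ltW.
    lra.
  apply: ler_avg => x; case: ifP => gx; last by rewrite !mul0r.
  apply: ler_wpM2l; first by case/andP: (h01 x).
  apply: (@le_trans _ _ (\avg_phi (H phi * (1 - W x (phi r) -
      \sum_(e in edges G) W (phi e.1) (phi e.2))))).
    rewrite (eq_avg (F := fun phi => H phi * _) (G := fun phi => H phi - H phi * W x (phi r) -
      \sum_(e in edges G) H phi * W (phi e.1) (phi e.2))); last first.
      by move=> phi; rewrite !mulrBr mulr1 mulr_sumr.
    rewrite !avgB avg_sum.
    have e1 : \avg_phi (H phi * W x (phi r)) <= 4 * sparsity * avg H.
      rewrite -(ler_pM2r hpos) weight_vertex mulrAC [leRHS]mulrC ler_wpM2l//.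
      by apply: avg_ge0 => phi; apply: weight_ge0.
    have e2 : \sum_(e in edges G) \avg_phi (H phi * W (phi e.1) (phi e.2))
        <= #|edges G|%:R * (sparsity * avg H).
      apply: le_trans (_ : \sum_(e in edges G) sparsity * avg H <= _).
        apply: ler_sum => e; rewrite inE => /andP[ae _]; apply: weight_edge.
        by apply: contraTneq ae => ->; rewrite adj_irrefl.
      by rewrite sumr_const mulr_natl.
    have H0 : 0 <= avg H by apply: avg_ge0 => phi; apply: weight_ge0.
    have := ler_wpM2r H0 es; lra.
  apply: (@le_trans _ _ (\avg_(phi : {ffun G -> T}) ((1 - W x (phi r)) * mon (fun x y => 1 - W x y) (edges G) phi))).
    apply: ler_avg => phi.
    have H1 : H phi <= 1 by apply: prodr_ile1 => v _; apply: h01.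
    have /andP[w0 w1] := W01 x (phi r).
    set S := \sum_(e in _) _.
    have M1 : 1 - S <= mon (fun x y => 1 - W x y) (edges G) phi.
      by apply: prod_1B_ge => e; apply: W01.
    have M0 : 0 <= mon (fun x y => 1 - W x y) (edges G) phi.
      by apply: prodr_ge0 => e _; have /andP[_] := W01 (phi e.1) (phi e.2); rewrite subr_ge0.
    have S0 : 0 <= S by apply: sumr_ge0 => e _; case/andP: (W01 (phi e.1) (phi e.2)).
    apply: (@le_trans _ _ (H phi * ((1 - W x (phi r)) * mon (fun x y => 1 - W x y) (edges G) phi))).
      apply: ler_wpM2l; first exact: weight_ge0.
      apply: (@le_trans _ _ ((1 - W x (phi r)) * (1 - S))); last first.
        by apply: ler_wpM2l => //; rewrite subr_ge0.
      have : 0 <= W x (phi r) * S by rewrite mulr_ge0.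
      lra.
    rewrite ler_piMl// mulr_ge0// subr_ge0//.
  rewrite act_rooted.
  have WP y z : 0 <= 1 - W y z <= P' y z by have /andP[] := W01 y z; rewrite /P'; lra.
  apply: ler_avg => phi; apply: ler_pM.
  + by case/andP: (WP x (phi r)).
  + by apply: prodr_ge0 => e _; case/andP: (WP (phi e.1) (phi e.2)).
  + by case/andP: (WP x (phi r)).
  + by apply: ler_prod => e _; apply: WP.
move=> x; case: ifP; last by rewrite mul0r eqxx.
move=> gx _.
have -> : \avg_y (h y * P' x y) = 2 * (avg h - Wd x).
  by rewrite -avgB -avgZl; apply: eq_avg => y; rewrite /P'; ring.
have := ler_wpM2r (ltW hpos) s16; move: gx; rewrite /good; lra.
Qed.

End Sparse.

(** A color with an excess of four-cycles has many pairs with large codegree.  If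
    many copies of [G] hang at many of these pairs,
    large bipartite graphs with pendant copies are abundant in this color.
    Otherwise [G] is rare in this color on a set of positive measure, and a sparse
    part of it makes the other color abundant. *)
Lemma far_color (del : R) : 0 < del <= 1 ->
  exists n0, forall (T : finType) (W : T -> T -> R) m,
    (0 < #|T|)%N -> (forall x y, 0 <= W x y <= 1) -> (n0 <= m)%N ->
  let P x y := 2 * W x y in let P' x y := 2 * (1 - W x y) in
    1 + del <= \avg_x \avg_y codeg P x y ^+ 2 ->
  2 <= bip P (act P (rooted r P)) (2 * m.+1) (2 * m.+1)
     + bip P' (act P' (rooted r P')) (2 * m.+1) (2 * m.+1).
Proof.
case/andP=> del0 del1.
have d256 : 0 < del / 256 by lra.
have [ek [c2 [ek0 c20 HS]]] := sparse_or_clique #|G|.+1 sparsity_gt0 d256.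
(* [del / 256] is the measure of the set where [g < e1] in the second case, and
   [ek] the density of cliques that a set of this measure without sparse part
   has; the cliques contribute to [g], so [e1] has to be below [ek]. *)
pose e1 := ek / 2; have e10 : 0 < e1 by rewrite /e1; lra.
pose e := e1 ^+ 2 * (del / 128).
have e0 : 0 < e by rewrite mulr_gt0 ?exprn_gt0//; lra.
have q1 : 1 < 1 + del / 4 by lra.
have [n1 Hn1] := pow_large (2 / e) q1.
have q2 : 1 < 3 / 2 :> R by lra.
pose c3 := c2 ^+ #|G|.+2 / 2; have c30 : 0 < c3 by rewrite divr_gt0 ?exprn_gt0.
have [n2 Hn2] := pow_large (2 / c3) q2.
exists (maxn n1 n2) => T W m T0 W01 nm P P' hk.
have W0 x y : 0 <= W x y by case/andP: (W01 x y).
have P0 x y : 0 <= P x y by rewrite mulr_ge0.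
have P'0 x y : 0 <= P' x y by rewrite mulr_ge0// subr_ge0; case/andP: (W01 x y).
set g := act P _; set g' := act P' _.
have g0 x : 0 <= g x by apply: avg_ge0 => z; rewrite mulr_ge0// rooted_ge0.
have g'0 x : 0 <= g' x by apply: avg_ge0 => z; rewrite mulr_ge0// rooted_ge0.
have k0 x y : 0 <= codeg P x y by apply: avg_ge0 => z; rewrite mulr_ge0.
have b0 (Q : T -> T -> R) (f : T -> R) N M : (forall x y, 0 <= Q x y) ->
    (forall x, 0 <= f x) -> 0 <= bip Q f N M.
  move=> Q0 f0; apply: avg_ge0 => y; apply: exprn_ge0; apply: avg_ge0 => x.
  by rewrite mulr_ge0// prodr_ge0.
pose big x y := 1 + del / 4 <= codeg P x y.
pose B : R := \avg_x \avg_y (if big x y then g x * g y else 0).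
set n := (2 * m.+1)%N.
have mn : (m <= n)%N by rewrite /n mul2n -addnn (leq_trans (leqnSn m))// leq_addr.
have n_ge : (n1 <= n)%N /\ (n2 <= n)%N.
  by move: nm; rewrite geq_max => /andP[l1 l2]; split; [exact: leq_trans l1 mn|exact: leq_trans l2 mn].
have [eB|Be] := lerP e B.
  suff : 2 <= bip P g n n by have := b0 P' g' n n P'0 g'0; lra.
  apply: le_trans (bip_ge_wcodeg _ _ T0 P0 g0).
  apply: (@le_trans _ _ (2 ^+ m.+1)).
    by rewrite exprS ler_peMr// exprn_ege1//; lra.
  apply: lerXn2r; rewrite ?nnegrE//.
    by apply: avg_ge0 => x; apply: avg_ge0 => y; rewrite mulr_ge0 ?exprn_ge0// mulr_ge0.
  apply: (@le_trans _ _ (B * (1 + del / 4) ^+ n)).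
    have := Hn1 n n_ge.1; rewrite ler_pdivrMr// mulrC => h.
    by apply: le_trans h _; rewrite ler_wpM2r// exprn_ge0//; lra.
  rewrite /B -avgZr; apply: ler_avg => x; rewrite -avgZr; apply: ler_avg => y.
  have gg : 0 <= g x * g y by rewrite mulr_ge0.
  case: ifP => [bxy|_]; last by rewrite mul0r mulr_ge0 ?exprn_ge0.
  by rewrite ler_wpM2l//; apply: lerXn2r; rewrite ?nnegrE//; lra.
pose h x : R := if g x < e1 then 1 else 0.
have h01 x : 0 <= h x <= 1 by rewrite /h; case: ifP; rewrite lexx ler01.
have avg_big : del / 64 <= \avg_x \avg_y (if big x y then 1 else 0).
  (* Codegrees are at most [4], so their squares are at most [16]. *)
  suff : 1 + del <= (1 + del / 4) ^+ 2 + 16 * \avg_x \avg_y (if big x y then 1 else 0).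
    move: (avg _) => s; have : del ^+ 2 <= del by rewrite expr2 ler_piMl// ltW.
    by rewrite sqrrD; lra.
  apply: le_trans hk _; rewrite -avgZl -[X in _ <= X + _](avg_const _ T0) -avgD.
  apply: ler_avg => x; rewrite -avgZl -[X in _ <= X + _](avg_const _ T0) -avgD.
  apply: ler_avg => y.
  have kle : codeg P x y <= 4.
    apply: avg_le_const => // z; have /andP[w0 w1] := W01 x z; have /andP[w2 w3] := W01 y z.
    rewrite (_ : P x z * P y z = 4 * (W x z * W y z)); last by rewrite /P; ring.
    by have := mulr_ile1 w0 w2 w1 w3; lra.
  rewrite /big; case: (lerP (1 + del / 4) (codeg P x y)) => c /=.
    have : codeg P x y ^+ 2 <= 4 ^+ 2 by apply: lerXn2r; rewrite ?nnegrE//.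
    by have := sqr_ge0 (1 + del / 4); lra.
  rewrite mulr0 addr0; apply: lerXn2r; rewrite ?nnegrE//; lra.
have avg_h : del / 256 <= avg h.
  have : \avg_x \avg_y (if big x y then 1 else 0) <=
      avg h + avg h + (e1 ^+ 2)^-1 * B.
    have -> : avg h + avg h = \avg_x \avg_y (h x + h y).
      rewrite [RHS](eq_avg (G := fun x => h x + avg h)) ?avgD ?avg_const// => x.
      by rewrite avgD avg_const.
    rewrite /B -avgZl -avgD; apply: ler_avg => x; rewrite -avgZl -avgD; apply: ler_avg => y.
    have /andP[hx0 _] := h01 x; have /andP[hy0 _] := h01 y.
    have s0 : 0 <= (e1 ^+ 2)^-1 by rewrite invr_ge0 sqr_ge0.
    case: ifP => _; last by rewrite mulr0 addr0 addr_ge0.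
    have gg : 0 <= (e1 ^+ 2)^-1 * (g x * g y) by rewrite mulr_ge0// mulr_ge0.
    rewrite /h; case: ltP => gx; first by case: ltP => _; lra.
    case: ltP => gy; first lra.
    rewrite !add0r mulrC ler_pdivlMr ?exprn_gt0// mul1r expr2.
    by apply: ler_pM => //; apply: ltW.
  have : (e1 ^+ 2)^-1 * B <= del / 128.
    by rewrite mulrC ler_pdivrMr ?exprn_gt0// mulrC ltW.
  lra.
have [cl|[h' [h'h ch' sp]]] := HS T W h T0 W01 h01 avg_h.
  exfalso; suff : ek <= e1 by rewrite /e1; lra.
  apply: le_trans cl _; apply: avg_le_const => // x; rewrite /=.
  have /andP[hx0 hx1] := h01 x.
  apply: (@le_trans _ _ (h x * g x)).
    apply: ler_wpM2l => //; apply: le_trans (clique_le_rooted r T0 W01 _) _ => [y|].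
      have /andP[w0 w1] := W01 x y; have /andP[hy0 hy1] := h01 y.
      by rewrite mulr_ge0//= mulr_ile1.
    apply: ler_avg => z; have /andP[w0 w1] := W01 x z; have /andP[hz0 hz1] := h01 z.
    apply: ler_pM; rewrite ?mulr_ge0 ?rooted_ge0//.
      by apply: le_trans (_ : W x z <= _); [rewrite ler_piMl|rewrite /P; lra].
    by apply: rooted_mono => a b; rewrite W0 /P /=; have := W0 a b; lra.
  by rewrite /h; case: ltP => [gx|_]; rewrite ?mul1r ?mul0r// ltW.
have h'01 x : 0 <= h' x <= 1.
  by have /andP[-> a] := h'h x; apply: le_trans a _; case/andP: (h01 x).
have h'0 : 0 < avg h' by apply: lt_le_trans ch'.
have [al [alg al_avg al_deg]] := sparse_weight W01 h'01 h'0 sp.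
suff : 2 <= bip P' g' n n by have := b0 P g n n P0 g0; lra.
have p0 : 0 <= 3 / 2 :> R by lra.
have nE : n = (2 * m).+2 by rewrite /n mulnS.
rewrite {1}nE; apply: le_trans (bip_weighted _ n T0 P'0 p0 alg h'01 al_deg h'0).
rewrite -nE -exprMn; set base := _ * (_ * _).
have base2 : 2 <= base.
  have al0 : avg h' ^+ #|G|.+2 / 2 <= avg h' * avg al.
    by rewrite exprS -mulrA; apply: ler_wpM2l => //; apply: ltW.
  have c3h : c3 <= avg h' * avg al.
    apply: le_trans al0; rewrite /c3 ler_pM2r ?invr_gt0//.
    by apply: lerXn2r; rewrite ?nnegrE//; apply: ltW.
  have := Hn2 n n_ge.2; rewrite ler_pdivrMr// mulrC => h2; apply: le_trans h2 _.
  by rewrite /base mulrA ler_wpM2r// exprn_ge0.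
have base1 : 1 <= base by apply: le_trans base2; rewrite ler1n.
rewrite nE exprS; apply: le_trans base2 _.
by rewrite ler_peMr ?exprn_ege1// (le_trans ler01).
Qed.

(** In the sum over both colors all terms of odd degree in [U] cancel; of the
    others the squared degrees and squared codegrees are kept, and the averages of
    the rest are nonnegative. *)
Lemma codeg_sum (T : finType) (U : T -> T -> R) : (0 < #|T|)%N ->
  2 + 2 * defect U <= (\avg_x \avg_y codeg (fun x y => 1 + U x y) x y ^+ 2)
    + \avg_x \avg_y codeg (fun x y => 1 - U x y) x y ^+ 2.
Proof.
move=> T0.
have v0 : 0 <= \avg_x \avg_y codeg U x y.
  rewrite /codeg (eq_avg (G := fun x => \avg_z \avg_y (U x z * U y z))); last first.
    by move=> x; rewrite avg_swap.
  by rewrite avg_swap; apply: avg_ge0 => z; rewrite -mul_avg -expr2 sqr_ge0.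
rewrite -avgD (eq_avg (G := fun x => 2 + 4 * (\avg_y codeg U x y)
    + 2 * deg U x ^+ 2 + 4 * avg (deg U) * deg U x + 2 * (\avg_y deg U y ^+ 2)
    + 2 * \avg_y codeg U x y ^+ 2)).
  rewrite !avgD !avg_const// !avgZl /defect /c4.
  have := sqr_ge0 (avg (deg U)); have d2 := avg_ge0 (fun x => sqr_ge0 (deg U x)).
  move: v0; move: (avg (deg U)) => e; move: (\avg_x \avg_y codeg _ _ _).
  move: d2; move: (\avg_x deg _ _ ^+ 2) => D; move: (\avg_x \avg_y _) => V.
  by move=> D0 v v0; rewrite -mulrA -expr2; lra.
move=> x; transitivity (\avg_y (2 + 4 * codeg U x y + 2 * deg U x ^+ 2
    + 4 * deg U x * deg U y + 2 * deg U y ^+ 2 + 2 * codeg U x y ^+ 2)).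
  rewrite -avgD; apply: eq_avg => y.
  by rewrite (codeg_add1 T0 U) (codeg_add1 T0 (fun x y => - U x y)) !deg_opp codeg_opp; ring.
by rewrite !avgD !avg_const// !avgZl; ring.
Qed.

(** By [codeg_sum] one of the colors has an excess of four-cycles. *)
Lemma far_rooted (del : R) : 0 < del ->
  exists n0, forall (T : finType) (U : T -> T -> R) m,
    (0 < #|T|)%N -> symk U -> (forall x y, `|U x y| <= 1) -> (n0 <= m)%N ->
    del <= defect U ->
  let P x y := 1 + U x y in let P' x y := 1 - U x y in
  2 <= bip P (act P (rooted r P)) (2 * m.+1) (2 * m.+1)
     + bip P' (act P' (rooted r P')) (2 * m.+1) (2 * m.+1).
Proof.
move=> del0; have d01 : 0 < Num.min del 1 <= 1 by rewrite lt_min del0 ltr01 ge_min lexx orbT.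
have [n0 H] := far_color d01.
exists n0 => T U m T0 sU U1 nm Ud /=.
have W01 (V : T -> T -> R) x y : `|V x y| <= 1 -> 0 <= (1 + V x y) / 2 <= 1.
  by rewrite ler_norml => /andP[? ?]; apply/andP; split; lra.
have PE : (fun x y => 2 * ((1 + U x y) / 2)) = (fun x y => 1 + U x y).
  by apply/funext => x; apply/funext => y; field.
have PE1 : (fun x y => 2 * (1 - (1 + U x y) / 2)) = (fun x y => 1 - U x y).
  by apply/funext => x; apply/funext => y; field.
have PE2 : (fun x y => 2 * ((1 - U x y) / 2)) = (fun x y => 1 - U x y).
  by apply/funext => x; apply/funext => y; field.
have PE3 : (fun x y => 2 * (1 - (1 - U x y) / 2)) = (fun x y => 1 + U x y).
  by apply/funext => x; apply/funext => y; field.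
have := H T _ m T0 (fun x y => W01 U x y (U1 x y)) nm.
have nU1 x y : `|- U x y| <= 1 by rewrite normrN.
have := H T _ m T0 (fun x y => W01 (fun x y => - U x y) x y (nU1 x y)) nm.
rewrite /= PE PE1 PE2 PE3 => h1 h2.
have sm : Num.min del 1 <= defect U by rewrite ge_min Ud.
have := codeg_sum U T0.
have [h _|lt] := lerP (1 + Num.min del 1) (\avg_x \avg_y codeg (fun x y => 1 + U x y) x y ^+ 2).
  exact: h2.
by move=> cs; rewrite addrC; apply: h1; lra.
Qed.

End Far.

(** * Complete bipartite graphs with pendant copies of a graph *)

Section Pendant.
Variables (G : sgraph) (r : G) (n : nat).

Definition pvertex : finType := (('I_n + 'I_n) + ('I_n * G))%type.

(** The vertices are [inl (inl i)] on the left, [inl (inr j)] on the right, and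
    [inr (i, w)] for the vertex [w] of the copy of [G] that belongs to [i]. *)
Definition padj (u v : pvertex) : bool :=
  match u, v with
  | inl (inl _), inl (inr _) | inl (inr _), inl (inl _) => true
  | inl (inl i), inr (j, w) | inr (j, w), inl (inl i) => (i == j) && (w == r)
  | inr (i, w), inr (j, w') => (i == j) && adj w w'
  | _, _ => false
  end.

Lemma padj_sym : symmetric padj.
Proof.
move=> [[i|i]|[i w]] [[j|j]|[j w']] //=.
by rewrite eq_sym adj_sym.
Qed.

Lemma padj_irrefl : irreflexive padj.
Proof. by move=> [[i|i]|[i w]] //=; rewrite adj_irrefl andbF. Qed.

Definition pendant : sgraph := SGraph padj_sym padj_irrefl.

Lemma pendant_adjE (u v : pvertex) : @adj pendant u v = padj u v.
Proof. by []. Qed.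

Lemma chromatic_numberP (H : sgraph) l : colorable H l ->
  (forall k, colorable H k -> (l <= k)%N) -> chromatic_number H = l.
Proof.
move=> cl lk; rewrite /chromatic_number; case: ex_minnP => m cm mk.
by apply/eqP; rewrite eqn_leq lk// mk.
Qed.

(** The left side avoids the color of [r], and the right side that of the left. *)
Lemma colorable_pendant k : (1 < k)%N -> colorable G k -> colorable pendant k.
Proof.
case: k => [|[|k]] // _ /existsP[c /forallP cP].
pose a : 'I_k.+2 := if c r == ord0 then ord_max else ord0.
have ar : a != c r by rewrite /a; case: (eqVneq (c r) ord0) => [->//|]; rewrite eq_sym.
pose b : 'I_k.+2 := if a == ord0 then ord_max else ord0.
have ba : b != a by rewrite /b; case: (eqVneq a ord0) => [->//|]; rewrite eq_sym.
apply/existsP; exists [ffun u : pvertex => match u with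
  | inl (inl _) => a | inl (inr _) => b | inr (_, w) => c w end].
apply/forallP => u; apply/forallP => v; apply/implyP; rewrite !ffunE pendant_adjE.
case: u v => [[i|i]|[i w]] [[j|j]|[j w']] //=.
- by rewrite eq_sym.
- by move=> /andP[_ /eqP->].
- by move=> /andP[_ /eqP->]; rewrite eq_sym.
- by move=> /andP[_ ww]; have /forallP/(_ w')/implyP := cP w; apply.
Qed.

Lemma colorable_of_pendant k : (0 < n)%N -> colorable pendant k -> colorable G k.
Proof.
move=> n0 /existsP[c /forallP cP]; apply/existsP.
exists [ffun w => c (inr (Ordinal n0, w) : pvertex)].
apply/forallP => u; apply/forallP => v; apply/implyP => uv; rewrite !ffunE.
by have /forallP/(_ (inr (Ordinal n0, v)))/implyP := cP (inr (Ordinal n0, u)); apply; rewrite pendant_adjE /= ?eqxx.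
Qed.

Lemma chromatic_number_pendant : (0 < n)%N -> (1 < chromatic_number G)%N ->
  chromatic_number pendant = chromatic_number G.
Proof.
move=> n0; rewrite {1 3}/chromatic_number; case: ex_minnP => l cl lk l1.
apply: chromatic_numberP; first exact: colorable_pendant.
by move=> k ck; apply: lk; apply: colorable_of_pendant.
Qed.

Lemma connected_pendant : (0 < n)%N -> connected_graph G -> connected_graph pendant.
Proof.
move=> n0 [_ cG]; split; first by apply/card_gt0P; exists (inl (inl (Ordinal n0))).
have csym : connect_sym (@adj pendant) := sym_connect_sym padj_sym.
pose o : pendant := inl (inr (Ordinal n0)).
have left i : connect adj (inl (inl i) : pendant) o by apply: connect1.
suff H u : connect adj u o.
  by move=> u v; apply: connect_trans (H u) _; rewrite csym; apply: H.
case: u => [[i|j]|[i w]].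
- exact: left.
- by apply: connect_trans (left (Ordinal n0)); apply: connect1.
apply: connect_trans (left i); apply: (@connect_trans _ _ (inr (i, r) : pendant)); last first.
  by apply: connect1; rewrite pendant_adjE /= !eqxx.
have /connectP[p pp ->] := cG w r.
elim: p w pp => [|v p IH] w /=; first by rewrite connect0.
move=> /andP[wv pp]; apply: connect_trans (IH v pp).
by apply: connect1; rewrite pendant_adjE /= ?eqxx.
Qed.

End Pendant.

Section PendantDensity.
Variable R : realType.
Local Open Scope ring_scope.

(** The counterpart of [hom_density] for a matrix. *)
Definition dens (T : finType) (H : sgraph) (A : T -> T -> R) : R :=
  \avg_phi mon A (edges H) phi.

(** Each edge counts in both directions; unlike the left-hand side, the product on
    the right does not refer to the enumeration of the vertices. *)
Lemma mon_edges_sqr (H : sgraph) (T : finType) (A : T -> T -> R) (phi : {ffun H -> T}) :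
  symk A -> mon A (edges H) phi ^+ 2 =
  \prod_u \prod_v (if adj u v then A (phi u) (phi v) else 1).
Proof.
move=> sA.
rewrite (pair_bigA _ (fun u v => if adj u v then A (phi u) (phi v) else 1)) /=.
rewrite -big_mkcond /= (bigID (fun p : H * H => enum_rank p.1 < enum_rank p.2)%N) /=.
rewrite expr2; congr (_ * _).
  by apply: eq_bigl => p; rewrite inE.
rewrite (reindex_inj (h := fun p : H * H => (p.2, p.1))) /=; last first.
  by move=> [u v] [u' v'] /= [-> ->].
rewrite /mon; apply: eq_big => [p|p _]; last exact: sA.
rewrite inE adj_sym; case: (boolP (adj p.2 p.1)) => //= a.
rewrite -leqNgt ltn_neqAle; case: (eqVneq (enum_rank p.1) (enum_rank p.2)) => //.
  by move=> /enum_rank_inj e; move: a; rewrite e adj_irrefl.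
by move=> ne; rewrite (_ : _ != _ :> nat).
Qed.

Variables (G : sgraph) (r : G) (n : nat) (T : finType) (A : T -> T -> R).
Hypothesis A0 : forall x y, 0 <= A x y.
Hypothesis sA : symk A.

(** The two sides are compared after squaring, when [mon_edges_sqr] makes the edges
    of [pendant r n] explicit; all factors are nonnegative. *)
Lemma mon_pendant (x y : {ffun 'I_n -> T}) (Phi : {ffun 'I_n * G -> T}) :
  mon A (edges (pendant r n)) (ffun_sum (ffun_sum x y) Phi) =
  (\prod_i \prod_j A (x i) (y j)) *
  \prod_i (A (x i) (Phi (i, r)) * mon A (edges G) [ffun v => Phi (i, v)]).
Proof.
have mon0 (H : sgraph) (phi : {ffun H -> T}) : 0 <= mon A (edges H) phi by apply: prodr_ge0.
apply/eqP; rewrite -(@eqrXn2 _ 2)//; last first.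
  by rewrite mulr_ge0// prodr_ge0// => i _; rewrite ?prodr_ge0// mulr_ge0.
rewrite mon_edges_sqr//.
(* [KL], [KR] and [KC] collect the factors at a left vertex, at a right vertex and
   at a vertex of a copy of [G]. *)
pose K u v := if padj r u v then A (ffun_sum (ffun_sum x y) Phi u)
  (ffun_sum (ffun_sum x y) Phi v) else 1.
rewrite (eq_bigr (fun u => \prod_v K u v))//.
have KL i : \prod_v K (inl (inl i)) v = (\prod_j A (x i) (y j)) * A (x i) (Phi (i, r)).
  rewrite big_sumType big_sumType /= big1 ?mul1r => [|j _]; last by [].
  congr (_ * _); first by apply: eq_bigr => j _; rewrite /K /ffun_sum /= !ffunE.
  rewrite (eq_bigr (fun p => if p == (i, r) then A (x i) (Phi p) else 1)).
    by rewrite -big_mkcond big_pred1_eq.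
  move=> [j w] _; rewrite /K /ffun_sum /= !ffunE xpair_eqE [j == i]eq_sym//.
have KR j : \prod_v K (inl (inr j)) v = \prod_i A (x i) (y j).
  rewrite big_sumType big_sumType /= [X in _ * X * _]big1 => [|k _]; last by [].
  rewrite [X in _ * X]big1 ?mulr1 => [|[k w] _]; last by [].
  by apply: eq_bigr => i _; rewrite /K /ffun_sum /= !ffunE sA.
have KC i w : \prod_v K (inr (i, w)) v = (if w == r then A (x i) (Phi (i, r)) else 1) *
    \prod_v (if adj w v then A (Phi (i, w)) (Phi (i, v)) else 1).
  rewrite big_sumType big_sumType /= [X in _ * X * _]big1 ?mulr1 => [|k _]; last by [].
  congr (_ * _).
    rewrite (eq_bigr (fun j => if j == i then (if w == r then A (x i) (Phi (i, r)) else 1) else 1)).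
      by rewrite -big_mkcond big_pred1_eq.
    move=> j _; rewrite /K /ffun_sum /= !ffunE; case: (eqVneq j i) => //= ->.
    by case: (eqVneq w r) => //= ->; rewrite sA.
  rewrite (eq_bigr (fun p : 'I_n * G => (fun j v => K (inr (i, w)) (inr (j, v))) p.1 p.2)); last by case.
  rewrite -(pair_bigA _ (fun j v => K (inr (i, w)) (inr (j, v)))) /= (bigD1 i)//=.
  rewrite [X in _ * X]big1 ?mulr1 => [|j ji]; last first.
    by apply: big1 => v _; rewrite /K /= eq_sym (negPf ji).
  by apply: eq_bigr => v _; rewrite /K /ffun_sum /= eqxx !ffunE.
rewrite big_sumType big_sumType /=.
rewrite (eq_bigr _ (fun i _ => KL i)) big_split /= (eq_bigr _ (fun j _ => KR j)).
rewrite (eq_bigr (fun p : 'I_n * G => (fun i w => \prod_v K (inr (i, w)) v) p.1 p.2)); last by case.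
rewrite -(pair_bigA _ (fun i w => \prod_v K (inr (i, w)) v)) /=.
have HC i : \prod_w \prod_v K (inr (i, w)) v =
    A (x i) (Phi (i, r)) * mon A (edges G) [ffun v => Phi (i, v)] ^+ 2.
  under eq_bigr do rewrite KC; rewrite big_split /= -big_mkcond big_pred1_eq.
  congr (_ * _); rewrite mon_edges_sqr//; apply: eq_bigr => w _; apply: eq_bigr => v _.
  by rewrite !ffunE.
rewrite [X in _ * X](eq_bigr _ (fun i _ => HC i)) [X in _ * X * _]exchange_big /=.
rewrite !big_split /= ?prodrXl.
by apply/eqP; ring.
Qed.

(** For given values on the right side, the left vertices and their copies of [G] are
    independent of one another. *)
Lemma dens_pendant : dens (pendant r n) A = bip A (act A (rooted r A)) n n.
Proof.
rewrite /dens avg_ffun_sum avg_ffun_sum.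
rewrite (eq_avg (G := fun x : {ffun 'I_n -> T} => \avg_(y : {ffun 'I_n -> T}) ((\prod_i \prod_j A (x i) (y j)) *
  \prod_i act A (rooted r A) (x i)))); last first.
  move=> x; apply: eq_avg => y.
  rewrite (eq_avg (mon_pendant x y)) avgZl; congr (_ * _).
  rewrite (eq_bigr _ (fun i _ => act_rooted r A (x i))).
  rewrite -(avg_ffun_prod (fun i (phi : {ffun G -> T}) => A (x i) (phi r) * mon A (edges G) phi)).
  by apply: eq_avg => Phi; apply: eq_bigr => i _; rewrite ffunE.
rewrite avg_swap; apply: eq_avg => y.
have := avg_expr 'I_n (fun x => act A (rooted r A) x * \prod_j A x (y j)).
rewrite card_ord => ->; apply: eq_avg => x.
by rewrite -big_split /=; apply: eq_bigr => i _; rewrite mulrC.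
Qed.

End PendantDensity.

Section FiniteCommon.
Variables (R : realType) (G : sgraph) (r : G).
Local Open Scope ring_scope.

Lemma mon_scale (H : sgraph) (T : finType) (A : T -> T -> R) c phi :
  mon (fun x y => c * A x y) (edges H) phi = c ^+ num_edges H * mon A (edges H) phi.
Proof. by rewrite /mon big_split prodr_const. Qed.

(** Scaling [W] and [1 - W] by [2] turns them into [1 + U] and [1 - U]. *)
Lemma pendant_common_finite : no_short_cycle G ->
  exists m, forall (T : finType) (W : T -> T -> R), (0 < #|T|)%N ->
    (forall x y, 0 <= W x y <= 1) -> symk W ->
  2 <= 2 ^+ num_edges (pendant r (2 * m.+1)) *
    (dens (pendant r (2 * m.+1)) W + dens (pendant r (2 * m.+1)) (fun x y => 1 - W x y)).
Proof.
move=> girthG; have [del del0 [b0 near]] := near_rooted R r girthG.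
have [n0 far] := far_rooted r del0.
pose m := maxn b0 n0; exists m => T W T0 W01 sW.
pose U x y := 2 * W x y - 1.
have sU : symk U by move=> x y; rewrite /U sW.
have U1 x y : `|U x y| <= 1.
  by have /andP[w0 w1] := W01 x y; rewrite ler_norml /U; apply/andP; split; lra.
have E1 : (fun x y => 1 + U x y) = (fun x y => 2 * W x y).
  by apply/funext => x; apply/funext => y; rewrite /U; ring.
have E2 : (fun x y => 1 - U x y) = (fun x y => 2 * (1 - W x y)).
  by apply/funext => x; apply/funext => y; rewrite /U; ring.
have W0 x y : 0 <= 2 * W x y by have /andP[w0 w1] := W01 x y; lra.
have W0' x y : 0 <= 2 * (1 - W x y) by have /andP[w0 w1] := W01 x y; lra.
have sW1 : symk (fun x y => 2 * W x y) by move=> x y; rewrite sW.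
have sW2 : symk (fun x y => 2 * (1 - W x y)) by move=> x y; rewrite sW.
have hd (A : T -> T -> R) H : 2 ^+ num_edges H * dens H A = dens H (fun x y => 2 * A x y).
  by rewrite /dens -avgZl; apply: eq_avg => phi; rewrite mon_scale.
rewrite mulrDr !hd !dens_pendant// -E1 -E2.
have [le_del|/ltW ge_del] := lerP (defect U) del.
  by apply: near => //; apply: leq_maxl.
by apply: far => //; apply: leq_maxr.
Qed.

End FiniteCommon.

(** * Critical sets of vertices *)

Section Subgraph.
Variables (V : finType) (e : rel V) (S : {set V}).
Hypothesis e_sym : symmetric e.
Hypothesis e_irrefl : irreflexive e.

Definition sub_vertex : finType := {x : V | x \in S}.

Lemma sub_sym : symmetric (fun x y : sub_vertex => e (val x) (val y)).
Proof. by move=> x y; apply: e_sym. Qed.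

Lemma sub_irrefl : irreflexive (fun x y : sub_vertex => e (val x) (val y)).
Proof. by move=> x; apply: e_irrefl. Qed.

Definition subgraph : sgraph := SGraph sub_sym sub_irrefl.

Definition set_colorable k (A : {set V}) := [exists c : {ffun V -> 'I_k},
  [forall u in A, forall v in A, e u v ==> (c u != c v)]].

Lemma set_colorableP k (A : {set V}) : reflect (exists c : {ffun V -> 'I_k},
  forall u v, u \in A -> v \in A -> e u v -> c u != c v) (set_colorable k A).
Proof.
apply: (iffP existsP) => -[c h]; exists c.
  move=> u v uA vA uv; move/forall_inP: h => /(_ u uA)/forall_inP/(_ v vA)/implyP.
  exact.
apply/forall_inP => u uA; apply/forall_inP => v vA; apply/implyP; exact: h.
Qed.

Lemma colorable_subgraph k : (0 < k)%N -> colorable subgraph k -> set_colorable k S.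
Proof.
case: k => // k _ /existsP[c /forallP cP]; apply/set_colorableP.
exists [ffun x => if insub x is Some y then c (y : sub_vertex) else ord0].
move=> u v uS vS uv; rewrite !ffunE !insubT.
by have /forallP/(_ (Sub v vS))/implyP := cP (Sub u uS); apply.
Qed.

Lemma colorable_leq (H : sgraph) j k : (j <= k)%N -> colorable H j -> colorable H k.
Proof.
move=> jk /existsP[c /forallP cP]; apply/existsP.
exists [ffun x => widen_ord jk (c x)].
apply/forallP => u; apply/forallP => v; apply/implyP => uv; rewrite !ffunE.
have /forallP/(_ v)/implyP/(_ uv) := cP u.
by apply: contraNneq => h; apply/eqP/val_inj; have := congr1 val h.
Qed.

Variable k : nat.
Hypothesis k0 : (0 < k)%N.
Hypothesis minS : minset (fun A => ~~ set_colorable k A) S.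

Lemma proper_colorable (A : {set V}) : A \proper S -> set_colorable k A.
Proof.
move=> AS; case: (boolP (set_colorable k A)) => // nA.
have /minsetP[_ /(_ A nA (proper_sub AS)) E] := minS.
by move: AS; rewrite E fintype.properxx.
Qed.

Lemma not_colorable_critical : ~~ set_colorable k S.
Proof. by have /minsetP[] := minS. Qed.

Lemma critical_neq0 : exists x, x \in S.
Proof.
apply/finset.set0Pn; apply/negP => /eqP S0; move/negP: not_colorable_critical; apply.
apply/set_colorableP; exists [ffun=> Ordinal k0] => u v.
by rewrite S0 inE.
Qed.

(** A [k]-coloring of the set without one vertex extends by an extra color. *)
Lemma chromatic_number_critical : chromatic_number subgraph = k.+1.
Proof.
apply: chromatic_numberP => [|j cj].
  have [x xS] := critical_neq0.
  have /set_colorableP[c cP] : set_colorable k (S :\ x)%SET.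
    by apply: proper_colorable; apply: properD1.
  apply/existsP; exists [ffun y : sub_vertex => if val y == x then ord_max
    else widen_ord (leqnSn k) (c (val y))].
  apply/forallP => u; apply/forallP => v; apply/implyP; rewrite !ffunE => uv.
  have uvV : e (val u) (val v) := uv.
  case: (eqVneq (val u) x) => [ux|ux]; case: (eqVneq (val v) x) => [vx|vx].
  - by move: uvV; rewrite ux vx e_irrefl.
  - by rewrite -val_eqE /= neq_ltn ltn_ord orbT.
  - by rewrite -val_eqE /= neq_ltn ltn_ord.
  have inSx (y : sub_vertex) : val y != x -> val y \in (S :\ x)%SET.
    by move=> yx; rewrite inE inE yx (valP y).
  have := cP (val u) (val v) (inSx u ux) (inSx v vx) uvV.
  by apply: contraNneq => h; apply/eqP/val_inj; have := congr1 val h.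
rewrite ltnNge; apply/negP => jk; move/negP: not_colorable_critical; apply.
by apply: colorable_subgraph => //; apply: colorable_leq jk cj.
Qed.

(** Colorings of a component and of the rest can be combined. *)
Lemma connected_critical : connected_graph subgraph.
Proof.
have [x xS] := critical_neq0; split; first by apply/card_gt0P; exists (Sub x xS).
move=> u v; apply/negPn/negP => nuv; move/negP: not_colorable_critical; apply.
(* [C] is a component: it and the rest of [S] are colorable by minimality. *)
pose C := [set val y | y : subgraph & connect adj u y]%SET.
have inC (y : subgraph) : (val y \in C) = connect adj u y.
  apply/imsetP/idP => [[z +]|uy]; last by exists y; rewrite ?inE.
  by rewrite inE => uz /val_inj ->.
have CS : C \subset S by apply/fintype.subsetP => _ /imsetP[y _ ->]; apply: valP.
have /set_colorableP[c1 c1P] : set_colorable k C.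
  apply: proper_colorable; rewrite properE CS /=; apply/subsetPn.
  by exists (val v); [apply: valP|rewrite inC].
have /set_colorableP[c2 c2P] : set_colorable k (S :\: C)%SET.
  apply: proper_colorable; rewrite properE finset.subsetDl /=; apply/subsetPn.
  by exists (val u); [apply: valP|rewrite inE inC connect0].
apply/set_colorableP; exists [ffun y => if y \in C then c1 y else c2 y].
have step (y z : subgraph) : adj y z -> (val y \in C) = (val z \in C).
  move=> yz; rewrite !inC; apply/idP/idP => h; apply: connect_trans h (connect1 _) => //.
  by rewrite adj_sym.
move=> y z yS zS yz; rewrite !ffunE.
have := step (Sub y yS) (Sub z zS) yz; rewrite /= => E.
case: ifP => yC; rewrite -E yC; first by apply: c1P; rewrite -?E.
by apply: c2P; rewrite // inE -?E yC.
Qed.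

End Subgraph.

(** * Random graphs *)

Section Random.
Variable R : realFieldType.
Local Open Scope ring_scope.

Lemma avg_indicator (I Q : finType) (P : {set I}) (p : pred Q) : (0 < #|Q|)%N ->
  \avg_(f : {ffun I -> Q}) ([forall c in P, p (f c)])%:R =
  (\avg_j (p j)%:R) ^+ #|P| :> R.
Proof.
move=> Q0.
rewrite (eq_avg (G := fun f : {ffun I -> Q} =>
    \prod_c (fun c j => if c \in P then (p j)%:R else 1) c (f c))).
  rewrite -(prod_avg (fun c j => if c \in P then (p j)%:R else 1)).
  rewrite -prodr_const [RHS]big_mkcond; apply: eq_bigr => c _.
  by case: ifP => // _; rewrite avg_const.
move=> f; case: (boolP [forall c in P, p (f c)]) => [/forall_inP h|].
  by rewrite big1// => c _; case: ifP => // cP; rewrite h.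
rewrite negb_forall => /existsP[c]; rewrite negb_imply => /andP[cP /negPf pf].
by rewrite (bigD1 c)//= cP pf mul0r.
Qed.

Lemma avg_zero q : \avg_(j : 'I_q.+1) (j == ord0)%:R = q.+1%:R^-1 :> R.
Proof.
rewrite avg.unlock (bigD1 ord0)//= big1 ?addr0 ?mul1r ?card_ord//.
by move=> j /negPf->.
Qed.

Lemma avg_nonzero q : \avg_(j : 'I_q.+1) (j != ord0)%:R = 1 - q.+1%:R^-1 :> R.
Proof.
rewrite -avg_zero -[X in X - _](@avg_const _ 'I_q.+1) ?card_ord// -avgB.
by apply: eq_avg => j; case: eqVneq; rewrite ?subrr ?subr0.
Qed.

(** Bernoulli's inequality, in the form of the tangent at [t = 1 - 1 / q.+1]. *)
Lemma half_power q : 2 * (1 - q.+1%:R^-1) ^+ q.+1 <= 1 :> R.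
Proof.
set t := 1 - _; have q0 : 0 < q.+1%:R^-1 :> R by rewrite invr_gt0 ltr0n.
have q1 : q.+1%:R^-1 <= 1 :> R by rewrite invf_le1 ?ltr0n// ler1n.
have t0 : 0 <= t by rewrite subr_ge0.
have t1 : t <= 1 by rewrite lerBlDr lerDl ltW.
have := exp_ge_tangent q ler01 t0; rewrite expr1n.
rewrite {3}/t opprB addrCA subrr addr0 mulrAC mulfV ?pnatr_eq0// mul1r.
apply: le_trans; rewrite mulr_natl mulr2n lerD2l exprS.
by apply: ler_piMl => //; apply: exprn_ge0.
Qed.

End Random.

Section RandomGraph.
Variables n q : nat.
Local Notation V := 'I_n.
Implicit Type f : {ffun V * V -> 'I_q.+1}.

(** The random map is only read at ordered pairs, so that each pair of vertices has a
    single coordinate. *)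
Definition pair_of (u v : V) := if (u < v)%N then (u, v) else (v, u).

Lemma pair_ofC u v : pair_of u v = pair_of v u.
Proof. by rewrite /pair_of; case: (ltngtP u v) => // /val_inj->. Qed.

Lemma pair_of_inj u v x y :
  pair_of u v = pair_of x y -> (u = x /\ v = y) \/ (u = y /\ v = x).
Proof. by rewrite /pair_of; do 2!case: ifP => _; case=> -> ->; auto. Qed.

(** Each pair of vertices is an edge with probability [1 / q.+1]. *)
Definition random_adj f : rel V :=
  fun u v => (u != v) && (f (pair_of u v) == ord0).

Lemma random_adj_sym f : symmetric (random_adj f).
Proof. by move=> u v; rewrite /random_adj eq_sym pair_ofC. Qed.

Lemma random_adj_irrefl f : irreflexive (random_adj f).
Proof. by move=> u; rewrite /random_adj eqxx. Qed.

Lemma next_next (T : eqType) (p : seq T) x : uniq p -> (2 < size p)%N ->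
  x \in p -> next p (next p x) != x.
Proof.
move=> up sp xp; have [i [//|a [|b p']] E] := rot_to xp.
- by move: sp; rewrite -(size_rot i) E.
- by move: sp; rewrite -(size_rot i) E.
rewrite -!(next_rot i up) E /= eqxx.
have := up; rewrite -(rot_uniq i) E /= !inE !negb_or.
case/and3P=> /and3P[xa xb _] /andP[ab _] _.
by rewrite eq_sym in xa; rewrite (negPf xa) eqxx eq_sym.
Qed.

Definition cycle_pairs (p : seq V) := [set pair_of x (next p x) | x in p]%SET.

(** Two vertices with the same pair would be the successors of each other. *)
Lemma card_cycle_pairs p : uniq p -> (2 < size p)%N ->
  #|cycle_pairs p| = size p.
Proof.
move=> up sp; rewrite -(card_uniqP up) card_in_imset// => x y xp yp.
case/pair_of_inj => -[//] xE yE.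
by move: (next_next up sp yp); rewrite -xE yE eqxx.
Qed.

Lemma prob_cycle (R : realFieldType) (p : seq V) : (2 < size p)%N ->
  (\avg_f (uniq p && cycle (random_adj f) p)%:R <= q.+1%:R^-1 ^+ size p :> R)%R.
Proof.
move=> sp; case: (boolP (uniq p)) => up /=; last first.
  by rewrite avg0 exprn_ge0// invr_ge0 ler0n.
rewrite -(card_cycle_pairs up sp) -avg_zero -avg_indicator ?card_ord//.
apply: ler_avg => f; rewrite ler_nat; case: (boolP (cycle _ p)) => // cp.
rewrite lt0b; apply/forall_inP => _ /imsetP[x xp ->].
by have /andP[] := next_cycle cp xp.
Qed.

Definition stable f (A : {set V}) :=
  [forall u in A, forall v in A, ~~ random_adj f u v].

Definition pairs (A : {set V}) :=
  [set z : V * V | [&& z.1 \in A, z.2 \in A & (z.1 < z.2)%N]]%SET.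

Lemma card_pairs (A : {set V}) : (#|A| * #|A| <= #|pairs A|.*2 + #|A|)%N.
Proof.
rewrite -cardsX -addnn.
pose sw (z : V * V) := (z.2, z.1).
have : finset.setX A A \subset
    (pairs A :|: (sw @: pairs A)%SET :|: [set (x, x) | x in A]%SET)%SET.
  apply/fintype.subsetP => -[x y]; rewrite !inE /= => /andP[xA yA].
  rewrite xA yA /=; case: (ltngtP x y) => [//|yx|/val_inj xy].
    have -> : (x, y) \in [set sw z | z in pairs A]%SET; last by rewrite orbT.
    by apply/imsetP; exists (y, x); rewrite // inE /= xA yA.
  have -> // : (x, y) \in [set (x, x) | x in A]%SET.
    by apply/imsetP; exists x; rewrite // xy.
  by rewrite orbT.
move/subset_leq_card/leq_trans; apply.
apply: leq_trans (leq_card_setU _ _) _; apply: leq_add (leq_imset_card _ _).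
apply: leq_trans (leq_card_setU _ _) _; apply: leq_add => //.
exact: leq_imset_card.
Qed.

(** All pairs of the stable set have to be missed. *)
Lemma prob_stable (R : realFieldType) (A : {set V}) :
  (\avg_f (stable f A)%:R <= (1 - q.+1%:R^-1) ^+ #|pairs A| :> R)%R.
Proof.
rewrite -avg_nonzero -(@avg_indicator _ _ _ _ (fun j => j != ord0)) ?card_ord//.
apply: ler_avg => f; rewrite ler_nat; case: (boolP (stable f A)) => // st.
rewrite lt0b; apply/forall_inP => -[u v]; rewrite inE /= => /and3P[uA vA uv].
move/forall_inP: st => /(_ u uA)/forall_inP/(_ v vA); rewrite /random_adj.
by rewrite /pair_of uv neq_ltn uv.
Qed.

Definition short_cycles f j : {set j.-tuple V} :=
  [set p : j.-tuple V | uniq p && cycle (random_adj f) p]%SET.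

Definition num_short_cycles f := (\sum_(j < 12 | (2 < j)%N) #|short_cycles f j|)%N.

Definition num_stable f a := #|[set A : {set V} | (a <= #|A|)%N && stable f A]%SET|.

Lemma card_avg (R : realFieldType) (I T : finType) (P : T -> pred I) :
  (\avg_f (#|[set x | P f x]%SET|%:R : R) = \sum_x \avg_f (P f x)%:R)%R.
Proof.
rewrite -avg_sum; apply: eq_avg => f.
rewrite -sum1_card natr_sum big_mkcond /=; apply: eq_bigr => x _.
by rewrite inE; case: (P f x).
Qed.

(** There are [n ^ j] tuples of length [j], each of them being a cycle with
    probability at most [q.+1 ^- j]. *)
Lemma avg_num_short_cycles (R : realFieldType) (s : nat) :
  (0 < s)%N -> n = (s * q.+1)%N ->
  (\avg_f (num_short_cycles f)%:R <= 9 * s%:R ^+ 11 :> R)%R.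
Proof.
move=> s0 nE.
rewrite (eq_avg (G := fun f => \sum_(j < 12 | (2 < j)%N) (#|short_cycles f j|%:R : R))%R).
  rewrite avg_sum.
  apply: (@le_trans _ _ (\sum_(j < 12 | (2 < j)%N) s%:R ^+ 11)%R); last first.
    rewrite sumr_const -[leLHS]mulr_natl ler_wpM2r ?exprn_ge0 ?ler0n//.
    rewrite ler_nat -sum1_card big_mkcond !big_ord_recl big_ord0 //.
  apply: ler_sum => j j2; rewrite card_avg.
  apply: (@le_trans _ _ (\sum_(p : j.-tuple V) (q.+1%:R^-1) ^+ j)%R).
    apply: ler_sum => p _; have := @prob_cycle R p.
    by rewrite size_tuple => /(_ j2).
  rewrite sumr_const card_tuple card_ord -[leLHS]mulr_natl natrX -exprMn nE natrM.
  rewrite mulfK ?pnatr_eq0//; apply: ler_weXn2l; first by rewrite ler1n.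
  by rewrite -ltnS ltn_ord.
by move=> f; rewrite natr_sum.
Qed.

(** A union bound over the [2 ^ n] sets: by [half_power] each of them is stable with
    probability at most [2 ^- m]. *)
Lemma avg_num_stable (R : realFieldType) a m :
    (forall A : {set V}, (a <= #|A|)%N -> (q.+1 * m <= #|pairs A|)%N) ->
    (n < m)%N ->
  (\avg_f (num_stable f a)%:R <= 2^-1 :> R)%R.
Proof.
move=> am nm; rewrite card_avg.
have t0 : (0 <= 1 - q.+1%:R^-1 :> R)%R.
  by rewrite subr_ge0 invf_le1 ?ltr0n// ler1n.
apply: (@le_trans _ _ (\sum_(A : {set V}) 2^-1 ^+ m)%R).
  apply: ler_sum => A _; case: leqP => [aA|_] /=; last first.
    by rewrite avg0 exprn_ge0// invr_ge0 ler0n.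
  apply: le_trans (prob_stable R A) _.
  apply: (@le_trans _ _ ((1 - q.+1%:R^-1) ^+ (q.+1 * m))%R).
    by apply: ler_wiXn2l; rewrite ?am// lerBlDr lerDl invr_ge0 ler0n.
  rewrite exprM; apply: lerXn2r; rewrite ?nnegrE ?exprn_ge0 ?invr_ge0 ?ler0n//.
  by have := half_power R q; lra.
rewrite sumr_const -cardsT -powersetT card_powerset cardsT card_ord.
rewrite -[leLHS]mulr_natl natrX -(subnKC nm) exprD exprSr mulrA mulrA -exprMn.
rewrite mulfV ?pnatr_eq0// expr1n mul1r; apply: ler_piMr; first by lra.
by apply: exprn_ile1; lra.
Qed.

End RandomGraph.

(** * Large girth and chromatic number *)

Section Erdos.

(** With the ratio [s = n / q.+1] and hence the bound [9 * s ^+ 11] on the expected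
    number of short cycles fixed, a large [q] makes this number small compared with
    [n].  The value of [s] is such that sets of [n / (2 k)] vertices contain more than
    [n * q.+1] pairs. *)
Lemma exists_sparse_map k : (0 < k)%N ->
  exists n q a (f : {ffun 'I_n * 'I_n -> 'I_q.+1}),
    [/\ n = (2 * (k * a))%N, num_stable f a = 0 & (2 * num_short_cycles f < n)%N].
Proof.
move=> k0; pose s := (32 * k ^ 2)%N; pose q := (36 * s ^ 10)%N.
pose n := (s * q.+1)%N; pose a := (16 * k * q.+1)%N.
have s0 : (0 < s)%N by rewrite muln_gt0 expn_gt0 k0.
have n0 : (0 < n)%N by rewrite muln_gt0 s0.
exists n, q, a.
have pairs_big (A : {set 'I_n}) : (a <= #|A|)%N ->
    (q.+1 * (8 * k * a.-1) <= #|pairs A|)%N.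
  move=> aA; have := card_pairs A.
  have a0 : (0 < a)%N by rewrite !muln_gt0 k0.
  have : (a * a.-1 <= #|A| * #|A|.-1)%N.
    by apply: leq_mul => //; rewrite -!subn1 leq_sub2r.
  rewrite /a; case: #|A| aA => [|c]; lia.
have n_small : (n < 8 * k * a.-1)%N.
  rewrite /n /s /a; move: (q) k0 => j; case: (k) => // i _; nia.
have hX := avg_num_stable rat pairs_big n_small.
have hY := avg_num_short_cycles rat (n := n) (q := q) s0 (erefl _).
have [f h] : exists f : {ffun 'I_n * 'I_n -> 'I_q.+1},
    (n%:R^-1 * (2 * (num_short_cycles f)%:R) + (num_stable f a)%:R < 1 :> rat)%R.
  apply/existsP; apply: contraT => /existsPn h.
  suff : (1 < 1 :> rat)%R by rewrite ltxx.
  apply: (@le_lt_trans _ _ (\avg_(f : {ffun 'I_n * 'I_n -> 'I_q.+1})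
    (n%:R^-1 * (2 * (num_short_cycles f)%:R) + (num_stable f a)%:R))%R).
    apply: avg_ge_const => [|f]; last by rewrite leNgt h.
    by rewrite card_ffun expn_gt0 card_ord.
  rewrite avgD !avgZl.
  suff : (n%:R^-1 * (2 * \avg_(f : {ffun 'I_n * 'I_n -> 'I_q.+1})
      (num_short_cycles f)%:R) < 2^-1 :> rat)%R by move: hX; lra.
  have n0R : (0 < n%:R :> rat)%R by rewrite ltr0n.
  rewrite -(ltr_pM2l n0R) mulVKf ?gt_eqF//.
  have : ((36 * s ^ 11)%N%:R < n%:R :> rat)%R.
    by rewrite ltr_nat /n /q expnSr mulnA [ltnRHS]mulnC ltn_pmul2r.
  rewrite natrM natrX; move: hY; set y := avg _; set z := (s%:R ^+ 11)%R.
  by lra.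
have fX : num_stable f a = 0.
  apply/eqP; rewrite -leqn0 -ltnS -(ltr_nat rat); apply: le_lt_trans h.
  by rewrite lerDr mulr_ge0 ?invr_ge0 ?mulr_ge0 ?ler0n.
exists f; split => //; first by rewrite /n /s /a; lia.
move: h; rewrite fX addr0 mulrC ltr_pdivrMr ?ltr0n// mul1r -natrM ltr_nat.
exact.
Qed.

(** The color classes of a [k]-coloring of the complement of [D] would be stable sets
    with less than [a] vertices, which cannot cover more than half of all vertices; and [D]
    meets all short cycles. *)
Lemma exists_large_girth_chromatic k : (0 < k)%N -> exists G : sgraph,
  [/\ connected_graph G, no_short_cycle G & chromatic_number G = k.+1].
Proof.
move=> k0; have [n [q [a [f [nE stab short]]]]] := exists_sparse_map k0.
have x0 : 'I_n by exists 0; apply: leq_ltn_trans short.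
pose e := random_adj f.
pose D := (\bigcup_(j < 12 | (2 < j)%N)
  [set head x0 (tval p) | p in short_cycles f j])%SET.
have cardD : (#|D| <= num_short_cycles f)%N.
  rewrite /D /num_short_cycles.
  elim/big_ind2: _ => [|A i B j Ai Bj|j _]; first by rewrite cards0.
    by apply: leq_trans (leq_card_setU _ _) _; apply: leq_add.
  exact: leq_imset_card.
have nD : ~~ set_colorable e k (~: D)%SET.
  apply/negP => /set_colorableP[c cP].
  have class_small (i : 'I_k) : (#|[set v in ~: D | c v == i]%SET| <= a)%N.
    rewrite leqNgt; apply/negP => big.
    suff : (0 < num_stable f a)%N by rewrite stab.
    apply/card_gt0P; exists [set v in ~: D | c v == i]%SET.
    rewrite inE ltnW//=; apply/forall_inP => u; rewrite inE => /andP[uD /eqP cu].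
    apply/forall_inP => v; rewrite inE => /andP[vD /eqP cv].
    by apply/negP => /(cP u v uD vD); rewrite cu cv eqxx.
  have : (#|(~: D)%SET| <= k * a)%N.
    rewrite -sum1_card (partition_big c xpredT)//= -[k in (k * a)%N]card_ord -sum_nat_const.
    apply: leq_sum => i _; apply: leq_trans (class_small i).
    by rewrite -sum1_card; apply/eq_leq/eq_bigl => v; rewrite !inE.
  have := cardsC D; rewrite card_ord; lia.
have [S minS SD] := @minset_exists _ (fun A => ~~ set_colorable e k A) _ nD.
have esym : symmetric e := random_adj_sym f.
have eirr : irreflexive e := random_adj_irrefl f.
exists (subgraph S esym eirr); split.
- exact: connected_critical minS.
- move=> p /andP[p2 p12] up; apply/negP => cp.
  pose p' := map val p.
  have up' : uniq p' by rewrite map_inj_uniq//; apply: val_inj.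
  have cp' : cycle e p'.
    by rewrite /p' cycle_map.
  have sp' : size p' == size p by rewrite size_map.
  have : head x0 p' \in D.
    apply/bigcupP; exists (Ordinal p12) => //.
    by apply/imsetP; exists (Tuple sp'); rewrite // inE /= up'.
  have : head x0 p' \in S.
    by rewrite /p'; case: p p2 {up p12 cp p' up' cp' sp'} => //= x p _; apply: valP.
  by move/(fintype.subsetP SD); rewrite inE => /negPf->.
- exact: chromatic_number_critical.
Qed.

End Erdos.

(** * Sampling *)

Section Boxes.
Context d (T : measurableType d) (n : nat).
Local Open Scope classical_set_scope.

Definition box (A : 'I_n -> set T) : set (n.-tuple T) :=
  [set x | forall i, A i (tnth x i)].

Lemma measurable_box A : (forall i, measurable (A i)) -> measurable (box A).
Proof.
move=> mA; rewrite (_ : box A = \bigcap_(i in [set: 'I_n]) ((@tnth n T ^~ i) @^-1` A i)).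
  apply: fin_bigcap_measurable => // i _.
  by rewrite -[X in measurable X]setTI; exact: measurable_tnth.
by apply/seteqP; split => x h i => [_|]; [exact: (h i)|exact: (h i I)].
Qed.

Definition boxes : set (set (n.-tuple T)) :=
  [set box A | A in [set A : 'I_n -> set T | forall i, measurable (A i)]].

Lemma boxes_setI : setI_closed boxes.
Proof.
move=> _ _ [A mA <-] [B mB <-]; exists (fun i => A i `&` B i).
  by move=> i /=; apply: measurableI; [apply: mA|apply: mB].
by apply/seteqP; split => x h; [split => i; have [] := h i|move=> i; have [h1 h2] := h; split].
Qed.

Lemma measurable_boxes : @measurable _ (n.-tuple T) = <<s boxes >>.
Proof.
apply/seteqP; split; last first.
  apply: smallest_sub; first exact: sigma_algebra_measurable.
  by move=> _ [A mA <-]; apply: measurable_box.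
apply: smallest_sub; first exact: smallest_sigma_algebra.
elim/big_ind: _ => [|X Y XG YG|i _]; first exact: sub0set.
  by rewrite subUset; split.
move=> _ [A mA <-]; rewrite setTI; apply: sub_sigma_algebra.
exists (fun j => if j == i then A else setT).
  by move=> j /=; case: (j == i).
apply/seteqP; split => x /= h.
  by have := h i; rewrite eqxx.
by move=> j; case: eqVneq => [->|].
Qed.

End Boxes.

Section Sampling.
Variable R : realType.
Local Open Scope classical_set_scope.
Local Open Scope ring_scope.
Local Notation RB := (measurableTypeR R).
Local Notation mu n := (lebesgue_tuple R n).
Local Notation cube n := (@unit_cube R n).

Let I01 : set RB := [set` `[0 : R, 1]].

Lemma lebesgue_unit : (@lebesgue_measure R I01 = 1)%E.
Proof. by rewrite lebesgue_measure_itv /= lte01 oppr0 adde0. Qed.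

Lemma cube_box n : cube n = box (fun=> I01).
Proof. by apply/seteqP; split => x h i; have := h i; rewrite /I01 /= in_itv /=. Qed.

Lemma measurable_cube n : measurable (cube n).
Proof. by rewrite cube_box; apply: measurable_box => i; apply: measurable_itv. Qed.

Lemma measure_cube n : (mu n (cube n) = 1)%E.
Proof.
rewrite cube_box tuple_measureE; last by move=> i; apply: measurable_itv.
by rewrite big1// => i _; apply: lebesgue_unit.
Qed.

Lemma mu_cube_fin n : (mu n (cube n) < +oo)%E.
Proof. by rewrite measure_cube ltry. Qed.

Section Subsample.
Variables (v n : nat) (psi : 'I_v -> 'I_n).

Definition subsample (x : n.-tuple RB) : v.-tuple RB := [tuple tnth x (psi i) | i < v].

Lemma measurable_subsample : measurable_fun setT subsample.
Proof.
apply/measurable_fun_tnthP => i.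
rewrite (_ : _ \o _ = @tnth n RB ^~ (psi i)); first exact: measurable_tnth.
by apply/funext => x; rewrite /= tnth_mktuple.
Qed.

Lemma subsample_cube x : cube n x -> cube v (subsample x).
Proof. by move=> h i; rewrite tnth_mktuple; apply: h. Qed.

Hypothesis inj_psi : injective psi.

Let mcn : measurable (cube n) := @measurable_cube n.
Let mcv : measurable (cube v) := @measurable_cube v.

(** The uniform measure of the cube is mapped by a choice of distinct
    coordinates to that of the smaller cube, as both agree on boxes. *)
Lemma subsample_measure A : measurable A ->
  (mu v (A `&` cube v) = mu n (subsample @^-1` A `&` cube n))%E.
Proof.
move=> mA.
pose m1 := mrestr (mu v) mcv.
pose m2 := pushforward (mrestr (mu n) mcn) subsample.
have : m1 A = m2 A.
  pose m2' : {measure set (v.-tuple RB) -> \bar R} :=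
    measure_function_pushforward__canonical__measure_function_Measure
    (mrestr (mu n) mcn) measurable_subsample.
  pose m1' : {measure set (v.-tuple RB) -> \bar R} := mrestr (mu v) mcv.
  apply: (@measure_unique _ _ _ (@boxes _ RB v) (fun=> setT) _ _ _ _ m1' m2') => //.
  - exact: measurable_boxes.
  - exact: boxes_setI.
  - move=> _; exists (fun=> setT) => //.
    by apply/seteqP; split.
  - by apply/seteqP; split => // x _; exists 0%N.
  - move=> _ [B mB <-].
    rewrite /= /mrestr /pushforward /=.
    have -> : box B `&` cube v = box (fun i => B i `&` I01).
      rewrite cube_box; apply/seteqP; split => x h.
        by move=> i; have [h1 h2] := h; split.
      by split => i; have [] := h i.
    have -> : subsample @^-1` box B `&` cube n =
        box (fun j => (if [pick i | psi i == j] is Some i then B i else setT) `&` I01).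
      rewrite cube_box; apply/seteqP; split => x h.
        move=> j; have [h1 h2] := h; split; last exact: h2.
        case: pickP => // i /eqP <-; have := h1 i; by rewrite /= tnth_mktuple.
      split => i; last by have [] := h i.
      have [+ _] := h (psi i); case: pickP => [k /eqP/inj_psi ->|/(_ i)]; last by rewrite eqxx.
      by rewrite /= tnth_mktuple.
    have mI : measurable I01 by apply: measurable_itv.
    rewrite !tuple_measureE; last 2 first.
    + by move=> j; apply: measurableI => //; case: pickP => // i _; apply: mB.
    + by move=> i; apply: measurableI => //; apply: mB.
    rewrite (bigID (fun j => j \in codom psi)) /= [X in (_ * X)%E]big1 ?mule1.
      rewrite -big_uniq; last by rewrite map_inj_uniq// enum_uniq.
      rewrite big_image; apply: eq_bigr => i _.
      by case: pickP => [k /eqP/inj_psi ->|/(_ i)] //; rewrite eqxx.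
    move=> j; case: pickP => [i /eqP <-|_ _]; first by rewrite codom_f.
    by rewrite setTI lebesgue_unit.
  - move=> _; rewrite /= /mrestr setTI; exact: mu_cube_fin.
by [].
Qed.

Lemma subsample_integral (f : v.-tuple RB -> R) :
    measurable_fun (cube v) f -> (forall x, cube v x -> 0 <= f x) ->
  \int[mu n]_(x in cube n) f (subsample x) = \int[mu v]_(x in cube v) f x.
Proof.
move=> mf f0; rewrite /Rintegral; congr fine.
pose rn : {measure set (n.-tuple RB) -> \bar R} := mrestr (mu n) mcn.
have msub : measurable (subsample @^-1` cube v).
  by rewrite -[X in measurable X]setTI; apply: measurable_subsample.
pose Ef y := (f y)%:E.
have mEf : measurable_fun (cube v) Ef by exact/measurable_EFinP.
have msub' : measurable_fun (subsample @^-1` cube v) subsample.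
  exact: measurable_funTS measurable_subsample.
have im : subsample @` (subsample @^-1` cube v) `<=` cube v by move=> _ [x + <-].
have mfs := measurable_comp mcv im mEf msub'.
transitivity (\int[rn]_(x in cube n) (Ef \o subsample) x)%E.
  apply: eq_measure_integral => A mA An.
  by rewrite /= /mrestr setIidl.
transitivity (\int[rn]_(x in subsample @^-1` cube v) (Ef \o subsample) x)%E.
  pose N := subsample @^-1` cube v `\` cube n.
  have mN : measurable N by apply: measurableD.
  have rN : rn N = 0%E.
    rewrite /rn /= /mrestr (_ : N `&` cube n = set0) ?measure0//.
    by apply/seteqP; split => // x [[]].
  rewrite (ge0_negligible_integral mN msub mfs _ rN); last first.
    by move=> x xc; rewrite lee_fin f0.
  congr (integral _ _ _); rewrite /N setDD; apply/esym/setIidr.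
  exact: subsample_cube.
rewrite -(ge0_integral_pushforward measurable_subsample rn mcv mEf).
  apply: eq_measure_integral; first exact: measurable_subsample.
  move=> msubs A mA Av.
  transitivity (mu v (A `&` cube v)); last by rewrite setIidl.
  by rewrite subsample_measure.
by move=> x; rewrite inE => xc; rewrite lee_fin f0.
Qed.

End Subsample.
End Sampling.

(** * From matrices to graphons *)

Section Common.
Variable R : realType.
Local Open Scope classical_set_scope.
Local Open Scope ring_scope.
Local Notation RB := (measurableTypeR R).
Local Notation mu n := (lebesgue_tuple R n).
Local Notation cube n := (@unit_cube R n).

Lemma measurable_unit_square : measurable (@unit_square R).
Proof.
rewrite (_ : unit_square (R:=R) = ([set` `[0 : R, 1]] : set RB) `*` ([set` `[0 : R, 1]] : set RB)).
  by apply: measurableX; apply: measurable_itv.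
by apply/seteqP; split => -[x y] /=; rewrite /unit_square /= !in_itv.
Qed.

Lemma graphon_compl (W : R * R -> R) : graphon W -> graphon (fun z => 1 - W z).
Proof.
move=> [mW W01 Ws]; split.
- by apply: measurable_funB => //; apply: measurable_cst.
- by move=> x y /W01 /andP[w0 w1]; apply/andP; split; lra.
- by move=> x y xy; rewrite Ws.
Qed.

Section OneGraphon.
Variables (H : sgraph) (W : R * R -> R).
Hypothesis gW : graphon W.

Definition edge_prod n (a : H -> 'I_n) (x : n.-tuple RB) : R :=
  \prod_(e in edges H) W (tnth x (a e.1), tnth x (a e.2)).

Lemma cube_square n (x : n.-tuple RB) i j : cube n x ->
  unit_square (tnth x i, tnth x j).
Proof. by move=> xc; split; apply: xc. Qed.

Lemma edge_prod_01 n (a : H -> 'I_n) x : cube n x -> 0 <= edge_prod a x <= 1.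
Proof.
move=> xc; have [_ W01 _] := gW.
have w01 e := W01 _ _ (cube_square (a e.1) (a e.2) xc).
apply/andP; split; first by apply: prodr_ge0 => e _; case/andP: (w01 e).
by apply: prodr_ile1 => e _; exact: w01.
Qed.

Lemma measurable_edge_prod n (a : H -> 'I_n) : measurable_fun (cube n) (edge_prod a).
Proof.
have [mW _ _] := gW.
rewrite (_ : edge_prod a = fun x => \prod_(e <- enum (edges H)) W (tnth x (a e.1), tnth x (a e.2))).
  apply: measurable_prod => e _.
  apply: (measurable_comp measurable_unit_square _ mW).
    by move=> _ [x xc <-]; apply: cube_square.
  by apply: measurable_funTS; apply: measurable_fun_pair; apply: measurable_tnth.
by apply/funext => x; rewrite big_enum.
Qed.

Lemma integrable_bounded n (f : n.-tuple RB -> R) (c : R) : measurable_fun (cube n) f ->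
  (forall x, cube n x -> 0 <= f x <= c) -> (mu n).-integrable (cube n) (EFin \o f).
Proof.
move=> mf f01; apply: measurable_bounded_integrable => //.
- exact: (@measurable_cube R n).
- exact: mu_cube_fin.
exists c; split; first exact: num_real.
move=> M cM x xc /=; have /andP[f0 f1] := f01 x xc.
by rewrite ger0_norm//; apply: le_trans f1 (ltW cM).
Qed.

(** Distinct sampled points are independent and uniform. *)
Lemma integral_edge_prod n (a : H -> 'I_n) : injective a ->
  \int[mu n]_(x in cube n) edge_prod a x = hom_density H W.
Proof.
move=> inja; pose psi (i : 'I_#|H|) := a (enum_val i).
have injp : injective psi by move=> i j /inja /enum_val_inj.
have h (x : n.-tuple RB) : edge_prod a x =
    \prod_(e in edges H) W (tnth (subsample psi x) (enum_rank e.1), tnth (subsample psi x) (enum_rank e.2)).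
  by apply: eq_bigr => e _; rewrite !tnth_mktuple /psi !enum_rankK.
rewrite /hom_density -(@subsample_integral R _ _ psi injp).
- by apply: eq_Rintegral => x _; rewrite h.
- exact: (@measurable_edge_prod _ (@enum_rank H)).
- by move=> x xc; case/andP: (@edge_prod_01 _ (@enum_rank H) x xc).
Qed.

Lemma integral_edge_prod_le n (a : H -> 'I_n) :
  \int[mu n]_(x in cube n) edge_prod a x <=
  hom_density H W + (~~ injectiveb a)%:R.
Proof.
have [/injectiveP ia|_] := boolP (injectiveb a); first by rewrite integral_edge_prod// addr0.
rewrite -[leLHS]add0r; apply: lerD.
  apply: Rintegral_ge0 => x xc.
  by case/andP: (@edge_prod_01 _ (@enum_rank H) x xc).
apply: le_trans (_ : \int[mu n]_(x in cube n) (cst 1 x) <= _); last first.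
  rewrite Rintegral_cst; last exact: (@measurable_cube R n).
  by rewrite (_ : fine _ = 1) ?mul1r//; exact: (congr1 fine (measure_cube R n)).
apply: le_Rintegral.
- exact: (@measurable_cube R n).
- exact: integrable_bounded (measurable_edge_prod a) (@edge_prod_01 _ a).
- apply: (@integrable_bounded _ _ 1) => [|x _]; first exact: measurable_cst.
  by rewrite ler01 lexx.
- by move=> x /(@edge_prod_01 _ a)/andP[].
Qed.

End OneGraphon.

Lemma Rintegral_sum n (I : Type) (s : seq I) (f : I -> n.-tuple RB -> R) :
  (forall i, measurable_fun (cube n) (f i)) ->
  (forall i x, cube n x -> 0 <= f i x <= 1) ->
  \int[mu n]_(x in cube n) (\sum_(i <- s) f i x) =
  \sum_(i <- s) \int[mu n]_(x in cube n) f i x.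
Proof.
move=> mf f01; elim: s => [|i s IH].
  rewrite big_nil; under eq_Rintegral do rewrite big_nil.
  by rewrite Rintegral_cst ?mul0r//; exact: (@measurable_cube R n).
rewrite big_cons -IH; under eq_Rintegral do rewrite big_cons.
rewrite RintegralD//.
- exact: (@measurable_cube R n).
- exact: integrable_bounded (mf i) (f01 i).
apply: (@integrable_bounded _ _ (size s)%:R) => [|x xc].
  exact: measurable_sum.
elim: s {IH} => [|j s IH]; first by rewrite big_nil lexx.
rewrite big_cons /= -addn1 natrD; have /andP[a b] := IH; have /andP[a' b'] := f01 j x xc.
by apply/andP; split; lra.
Qed.

(** A union bound over the pairs of vertices. *)
Lemma not_injective_le (H : sgraph) n : (0 < n)%N ->
  \avg_(phi : {ffun H -> 'I_n}) (~~ injectiveb phi)%:R <= (#|H| ^ 2)%:R / n%:R :> R.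
Proof.
move=> n0; have T0 : (0 < #|'I_n|)%N by rewrite card_ord.
pose ind (p : H * H) (phi : {ffun H -> 'I_n}) : R :=
  if p.1 != p.2 then 1 * (phi p.1 == phi p.2)%:R else 0.
apply: (@le_trans _ _ (\avg_(phi : {ffun H -> 'I_n}) \sum_p ind p phi)).
  apply: ler_avg => phi; case: (boolP (injectiveb phi)) => [_|/injectivePn[u [v uv e]]] /=.
    by apply: sumr_ge0 => p _; rewrite /ind; case: ifP => // _; rewrite mul1r ler0n.
  rewrite (bigD1 (v, u))//= /ind /= eq_sym uv e eqxx mulr1 lerDl.
  by apply: sumr_ge0 => p _; case: ifP => // _; rewrite mul1r ler0n.
rewrite avg_sum.
apply: (@le_trans _ _ (\sum_(p : H * H) n%:R^-1)); last first.
  by rewrite sumr_const card_prod -mulnn mulr_natl.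
apply: ler_sum => -[u v] _; rewrite /ind /=; case: (eqVneq u v) => [_|uv].
  by rewrite avg0 invr_ge0 ler0n.
rewrite (avg_two (fun x y => (x == y)%:R) uv)//.
rewrite avg_const ?mul1r; last by rewrite card_ffun expn_gt0 T0.
apply: avg_le_const => // x; rewrite avg.unlock (bigD1 x)//= eqxx big1.
  by rewrite addr0 card_ord mul1r.
by move=> y yx; rewrite eq_sym (negPf yx).
Qed.

(** Evaluate a graphon at [n] random points and average the inequality for the
    matrix of values over these points.  A map from the vertices of [H] to the points
    contributes the density of [H] if it is injective, and at most [1] otherwise;
    the proportion of the latter maps tends to [0] as [n] grows. *)
Lemma common_of_finite (H : sgraph) :
  (forall (T : finType) (W : T -> T -> R), (0 < #|T|)%N ->
    (forall x y, 0 <= W x y <= 1) -> symk W ->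
    2 <= 2 ^+ num_edges H * (dens H W + dens H (fun x y => 1 - W x y))) ->
  common R H.
Proof.
move=> fin W gW; have gW' := graphon_compl gW; have [_ W01 Ws] := gW.
set h := hom_density H W; set h' := hom_density H _.
have p2 : 0 < 2 ^+ num_edges H :> R by rewrite exprn_gt0.
have -> : 2 ^ (1 - (num_edges H)%:Z) = 2 / 2 ^+ num_edges H :> R.
  by rewrite expfzDr// expr1z -exprnN.
(* A random map is not injective with probability at most [#|H| ^ 2 / n]. *)
suff key n : (0 < n)%N -> 2 / 2 ^+ num_edges H <= h + h' + 2 * ((#|H| ^ 2)%:R / n%:R).
  rewrite leNgt; apply/negP => lt; set a := 2 / _ in key lt.
  pose c : R := 2 * (#|H| ^ 2)%:R; have c0 : 0 <= c by rewrite mulr_ge0 ?ler0n.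
  have g0 : 0 < a - (h + h') by rewrite subr_gt0.
  pose n := (Num.trunc (c / (a - (h + h')))).+1.
  have := key n isT; apply/negP; rewrite -ltNge.
  have : c / (a - (h + h')) < n%:R by apply: truncnS_gt.
  rewrite ltr_pdivrMr// => hn; rewrite mulrA -/c.
  have : c / n%:R < a - (h + h') by rewrite ltr_pdivrMr ?ltr0n// mulrC.
  lra.
move=> n0; have T0 : (0 < #|'I_n|)%N by rewrite card_ord.
have M0 : (0 < #|{ffun H -> 'I_n}|)%N by rewrite card_ffun expn_gt0 T0.
pose F (phi : {ffun H -> 'I_n}) (x : n.-tuple RB) : R :=
  edge_prod W phi x.
pose F' (phi : {ffun H -> 'I_n}) (x : n.-tuple RB) : R :=
  edge_prod (fun z => 1 - W z) phi x.
have mF phi : measurable_fun (cube n) (F phi) := measurable_edge_prod gW phi.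
have mF' phi : measurable_fun (cube n) (F' phi) := measurable_edge_prod gW' phi.
have F01 phi x (xc : cube n x) : 0 <= F phi x <= 1 := edge_prod_01 gW phi xc.
have F01' phi x (xc : cube n x) : 0 <= F' phi x <= 1 := edge_prod_01 gW' phi xc.
pose S x := \sum_phi F phi x; pose S' x := \sum_phi F' phi x.
have mS : measurable_fun (cube n) S by apply: measurable_sum.
have mS' : measurable_fun (cube n) S' by apply: measurable_sum.
pose N : R := #|{ffun H -> 'I_n}|%:R.
have N0 : 0 < N by rewrite ltr0n.
have S_bound (G : {ffun H -> 'I_n} -> n.-tuple RB -> R) x :
    (forall phi, 0 <= G phi x <= 1) -> 0 <= \sum_phi G phi x <= N.
  move=> G01; rewrite sumr_ge0 => [|phi _]; last by case/andP: (G01 phi).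
  rewrite /N -sum1_card natr_sum; apply: ler_sum => phi _.
  by case/andP: (G01 phi).
have iS : (mu n).-integrable (cube n) (EFin \o S).
  by apply: (integrable_bounded (c := N)) => // x xc; apply: S_bound => phi; apply: F01.
have iS' : (mu n).-integrable (cube n) (EFin \o S').
  by apply: (integrable_bounded (c := N)) => // x xc; apply: S_bound => phi; apply: F01'.
have pw x : cube n x -> N * (2 / 2 ^+ num_edges H) <= S x + S' x.
  move=> xc; pose A i j := W (tnth x i, tnth x j).
  have := fin 'I_n A T0 (fun i j => W01 _ _ (cube_square i j xc))
    (fun i j => Ws _ _ (cube_square i j xc)).
  have -> : dens H A = S x / N by rewrite /dens avg.unlock.
  have -> : dens H (fun i j => 1 - A i j) = S' x / N by rewrite /dens avg.unlock.
  rewrite -mulrDl mulrA ler_pdivlMr// mulrA ler_pdivrMr// => k.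
  by rewrite mulrC [leRHS]mulrC.
have mI : \int[mu n]_(x in cube n) (cst (N * (2 / 2 ^+ num_edges H)) x) =
    N * (2 / 2 ^+ num_edges H).
  rewrite Rintegral_cst; last exact: (@measurable_cube R n).
  by rewrite (_ : fine _ = 1) ?mulr1//; exact: (congr1 fine (measure_cube R n)).
have : N * (2 / 2 ^+ num_edges H) <= \int[mu n]_(x in cube n) (S x + S' x).
  rewrite -mI; apply: le_Rintegral => //.
  - exact: (@measurable_cube R n).
  - apply: (integrable_bounded (c := N * (2 / 2 ^+ num_edges H))) => [|x _].
      exact: measurable_cst.
    by rewrite lexx andbT mulr_ge0 ?ltW// divr_gt0.
  - apply: (integrable_bounded (c := N + N)) => [|x xc]; first exact: measurable_funD.
    have /andP[a b] := S_bound F x (fun phi => F01 phi x xc).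
    have /andP[a' b'] := S_bound F' x (fun phi => F01' phi x xc).
    by apply/andP; split; [apply: addr_ge0|apply: lerD].
rewrite RintegralD//; last exact: (@measurable_cube R n).
rewrite (Rintegral_sum _ mF F01) (Rintegral_sum _ mF' F01') => le1.
pose b (phi : {ffun H -> 'I_n}) : R := (~~ injectiveb phi)%:R.
have le2 : \sum_phi \int[mu n]_(x in cube n) F phi x +
    \sum_phi \int[mu n]_(x in cube n) F' phi x <= \sum_phi (h + b phi) + \sum_phi (h' + b phi).
  by apply: lerD; apply: ler_sum => phi _; apply: integral_edge_prod_le.
have bE : \sum_phi b phi = N * avg b.
  by rewrite avg.unlock mulrC divfK// gt_eqF.
have hE (c : R) : \sum_(phi : {ffun H -> 'I_n}) c = N * c.
  by rewrite sumr_const mulr_natl.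
have := le_trans le1 le2; rewrite !big_split /= !hE bE -!mulrDr ler_pM2l// => le3.
have := not_injective_le H n0; rewrite -/(avg b) => le4.
apply: le_trans le3 _; move: le4; move: (_ / n%:R) => q; move: (avg _) => p; lra.
Qed.

End Common.

(** * Common graphs of given chromatic number *)

Section SingleVertex.

Let no_adj : rel unit := fun _ _ => false.

Let no_adj_sym : symmetric no_adj. Proof. by []. Qed.

Let no_adj_irrefl : irreflexive no_adj. Proof. by []. Qed.

Definition single_vertex : sgraph := SGraph no_adj_sym no_adj_irrefl.

Lemma connected_single_vertex : connected_graph single_vertex.
Proof. by split => [|[] []]; [rewrite card_unit|apply: connect0]. Qed.

Lemma chromatic_number_single_vertex : chromatic_number single_vertex = 1.
Proof.
apply: chromatic_numberP => [|[|k]//].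
  apply/existsP; exists [ffun=> ord0].
  by apply/forallP => u; apply/forallP => v; apply/implyP.
by move=> /existsP[c _]; case: (c tt).
Qed.

Lemma common_single_vertex (R : realType) : common R single_vertex.
Proof.
apply: common_of_finite => T W T0 _ _.
have E0 : edges single_vertex = finset.set0.
  by apply/setP => e; rewrite !inE.
have d1 (V : T -> T -> R) : dens single_vertex V = 1%R.
  rewrite /dens (eq_avg (G := fun=> 1%R)) ?avg_const ?card_ffun ?expn_gt0 ?T0// => phi.
  by rewrite /mon E0 big_set0.
by rewrite !d1 /num_edges E0 cards0 expr0 mul1r.
Qed.

End SingleVertex.

Theorem theorem1 (R : realType) (l : nat) (hl : (0 < l)%N) :
  exists H : sgraph,
    [/\ connected_graph H, common R H & chromatic_number H = l].
Proof.
case: l hl => [//|[|k]] _.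
  exists single_vertex; split; first exact: connected_single_vertex.
    exact: common_single_vertex.
  exact: chromatic_number_single_vertex.
have [G [Gc Gg Gchi]] := exists_large_girth_chromatic (ltn0Sn k).
have /card_gt0P[r _] := Gc.1.
have [m fin] := pendant_common_finite R r Gg.
exists (pendant r (2 * m.+1)); split.
- exact: connected_pendant.
- exact: common_of_finite.
- by rewrite chromatic_number_pendant ?Gchi.
Qed.
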